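(* Let $\sigma$ be a synchronization algebra on $\Sigma$, let $P$ be a process name, and let $\ell\colon\square|[P]|\to{!^\sigma\Sigma}$ be its interpretation as a $\sigma$-labelled precubical set. Let $p\ge 1$ and consider a $\sigma$-labelled $p$-shell of $\square|[P]|$, i.e. a commutative square of precubical sets consisting of maps $x\colon\partial\square[p+1]\to\square|[P]|$ and $y\colon\square[p+1]\to{!^\sigma\Sigma}$ with $\ell\circ x=y\circ j$, where $j\colon\partial\square[p+1]\subset\square[p+1]$ is the inclusion. Then there exists at most one lift $k$, i.e. at most one map of precubical sets $k\colon\square[p+1]\to\square|[P]|$ such that $k\circ j=x$ and $\ell\circ k=y$.
   Context: **Precubical sets.** For $n\ge 0$ let $[n]=\{0,1\}^n$ (with $[0]=\{()\}$). For $1\le i\le n$ and $\alpha\in\{0,1\}$ let $\delta_i^\alpha\colon[n-1]\to[n]$ be $\delta_i^\alpha(\epsilon_1,\dots,\epsilon_{n-1})=(\epsilon_1,\dots,\epsilon_{i-1},\alpha,\epsilon_i,\dots,\epsilon_{n-1})$. $\square$ is the subcategory of sets with objects $[n]$, $n\ge0$, generated by the maps $\delta_i^\alpha$. A precubical set is a presheaf $K$ of sets on $\square$; $K_n=K([n])$ is its set of $n$-cubes, with face maps $\partial_i^\alpha\colon K_n\to K_{n-1}$ induced by $\delta_i^\alpha$. $\square[n]=\square(-,[n])$, so $\square[n]_0=[n]$; $\partial\square[n]\subset\square[n]$ has $(\partial\square[n])_k=\square[n]_k$ for $k<n$ and $(\partial\square[n])_k=\varnothing$ for $k\ge n$. $K_{\le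 n}$ is obtained from $K$ by keeping only the cubes of dimension $\le n$. **Synchronization algebra and labels.** $\Sigma$ is a non-empty set of actions. A synchronization algebra on $\Sigma$ (not containing the distinct elements $0,\bot$) is a commutative associative binary operation $\sigma$ on $\Sigma\cup\{0,\bot\}$ with $\sigma(a,\bot)=\bot$ for all $a\in\Sigma\cup\{\bot\}$; $\sigma(a,b)=0\iff a=b=0$; for all $a\in\Sigma$, $\sigma(a,0)=a$ or $\sigma(a,0)=\bot$ (and then necessarily $\sigma(\bot,0)=\bot$). The precubical set $!\Sigma$ has $(!\Sigma)_0=\{()\}$, $(!\Sigma)_n=\Sigma^n$ for $n\ge1$ and $\partial_i^0(a_1,\dots,a_n)=\partial_i^1(a_1,\dots,a_n)=(a_1,\dots,\widehat{a_i},\dots,a_n)$ ($a_i$ removed). $!^\sigma\Sigma\subset{!\Sigma}$ consists of the $(a_1,\dots,a_n)$ with $\sigma(a_i,0)=a_i$ for all $i$. A $\sigma$-labelled precubical set is a map of precubical sets $\ell\colon K\to{!^\sigma\Sigma}$; morphisms are maps over $!^\sigma\Sigma$. **Synchronized tensor product.** For $1$-dimensional $\sigma$-labelled precubical sets $K,L$, $K\times_\sigma L$ is the $1$-dimensional one with $(K\times_\sigma L)_0=K_0\times L_0$, $(K\times_\sigma L)_1=(K_1\times L_0)\sqcup(K_0\times L_1)\sqcup\{(x,y)\in K_1\times L_1:\sigma(\ell(x),\ell(y))\ne\bot\}$; face maps $\partial_1^\alpha(x,y)$ equal to $(\partial_1^\alpha x,y)$, $(x,\partial_1^\alpha y)$,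 $(\partial_1^\alpha x,\partial_1^\alpha y)$ and labels equal to $\ell(x)$, $\ell(y)$, $\sigma(\ell(x),\ell(y))$ on the three summands respectively. A set map $[m]\to[p]$ ($m\ge 2$) is non-twisted if it is a composite $\psi\circ\phi$ with $\psi\colon[q]\to[p]$ a morphism of $\square$ and $\phi(\epsilon_1,\dots,\epsilon_m)=(\epsilon_{i_1},\dots,\epsilon_{i_q})$, where $\{1,\dots,m\}\subset\{i_1,\dots,i_q\}$ and, reading from left to right, the first appearance of $\epsilon_i$ is before that of $\epsilon_{i+1}$ for $1\le i<m$. If $\ell\colon K\to{!^\sigma\Sigma}$ has $K_0=[p]$, a $\sigma$-labelled non-twisted $n$-shell ($n\ge1$) of $K$ is a commutative square given by $x\colon\partial\square[n+1]\to K$ and $\square[n+1]\to{!^\sigma\Sigma}$, over $\ell$ and the inclusion $\partial\square[n+1]\subset\square[n+1]$, with $x_0\colon[n+1]\to[p]$ non-twisted. For $K$ $1$-dimensional with $K_0=[p]$, set $K^{(1)}=K$ and let $K^{(n+1)}$ be the pushout obtained by attaching to $K^{(n)}$, for each $\sigma$-labelled non-twisted $n$-shell of $K^{(n)}$, a copy of $\square[n+1]$ along $x\colon\partial\square[n+1]\to K^{(n)}$; $\overrightarrow{\mathrm{cosk}}^\sigma(K)=\varinjlim_n K^{(n)}$ (for $p\le1$ there are no such shells and this is $K$). For $\sigma$-labelled cubes, $\square[p]\otimes_\sigma\square[q]=\overrightarrow{\mathrm{cosk}}^\sigma(\square[p]_{\le1}\times_\sigma\square[q]_{\le1})$ (with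 $[p]\times[q]=[p+q]$), and for general $\sigma$-labelled $K,L$, $K\otimes_\sigma L=\varinjlim_{\square[p]\to K}\varinjlim_{\square[q]\to L}\square[p]\otimes_\sigma\square[q]$ (labels of cubes being induced from $K$ and $L$). One has $(K\otimes_\sigma L)_0=K_0\times L_0$. **Process names and their interpretation.** Process names are generated by $P::=nil\mid a.P\mid(\nu a)P\mid P+P\mid P\|P\mid\mathrm{rec}(x)P(x)$ with $a\in\Sigma$, where $P(x)$ is a process name with one free variable $x$, and $x$ must be guarded (it lies in a prefix term $a.x$). Let $\mathcal C$ be the category of $\sigma$-labelled precubical sets equipped with a distinguished $0$-cube (initial state). $\square|[P]|\in\mathcal C$ is defined by induction for each process name $P$: - $\square|[nil]|=\square[0]$. - $\square|[\mu.nil]|$ is the $1$-cube $\square[1]$ labelled $(\mu)$, with initial state its source vertex; $\square|[\mu.P]|$ is the pushout of $\square|[\mu.nil]|\leftarrow\square[0]\to\square|[P]|$ identifying the final vertex of $\square|[\mu.nil]|$ with the initial state of $\square|[P]|$ (initial state: that of $\square|[\mu.nil]|$). - $\square|[P+Q]|$ is the binary coproduct of $\square|[P]|$ and $\square|[Q]|$ in $\mathcal C$. - $\square|[(\nu a)P]|$ is the pullback of $\square|[P]|\to{!^\sigma\Sigma}\leftarrow{!^\sigma(\Sigma\setminus(\{a\}\cup\{b:\sigma(a,b)\ne\bot\}))}$. - $\square|[P\|Q]|=\square|[P]|\otimes_\sigma\square|[Q]|$, with initial state the pair of initial states. - These constructions are functorial in $\mathcal C$, so $P(x)$ induces an endofunctor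 $\square|[x]|\mapsto\square|[P(x)]|$ of $\mathcal C$; $\square|[\mathrm{rec}(x)P(x)]|=\varinjlim_n\square|[P^n(nil)]|$, the transition maps being obtained by applying this functor repeatedly to the map $\square|[nil]|=\square[0]\to\square|[P(nil)]|$ picking the initial state.
   Formalization: Process names use only prefixes a.P with σ(a,0)=a; for an action with σ(a,0)=⊥ the 1-cube labelled (a) has no map to !^σΣ, so the interpretation of a.P is undefined. *)

(* Defs.v *)
From HB Require Import structures.
From Stdlib Require Import Relation_Operators.
From mathcomp Require Import all_boot.
From mathcomp Require Import boolp.

Set Implicit Arguments.
Unset Strict Implicit.
Unset Printing Implicit Defensive.

Definition vert (n : nat) : Type := n.-tuple bool.

Section Delta.
Variables (n : nat) (i : 'I_n.+1) (a : bool).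

Lemma delta_size (e : vert n) : size (take i e ++ a :: drop i e) == n.+1.
Proof.
rewrite size_cat /= size_take size_drop size_tuple.
have := ltn_ord i; rewrite ltnS leq_eqVlt => /orP[/eqP->|lt_in].
  by rewrite ltnn subnn addn1.
by rewrite lt_in addnS subnKC // ltnW.
Qed.

(* Coordinates are numbered from 0. *)
Definition delta (e : vert n) : vert n.+1 := Tuple (delta_size e).

End Delta.

Inductive is_box : forall m n, (vert m -> vert n) -> Prop :=
| is_box_id n : @is_box n n id
| is_box_delta n (i : 'I_n.+1) (a : bool) : is_box (delta i a)
| is_box_comp m n p (f : vert n -> vert p) (g : vert m -> vert n) :
    is_box f -> is_box g -> is_box (f \o g).

Record bmap (m n : nat) : Type := BMap {
  bfun :> vert m -> vert n;
  bmapP : is_box bfun }.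

Lemma bmap_eq m n (f g : bmap m n) : f =1 g -> f = g.
Proof.
case: f g => [f fP] [g gP] /= /funext eq_fg; case: _ / eq_fg in gP *.
by rewrite (Prop_irrelevance fP gP).
Qed.

Definition bid n : bmap n n := BMap (is_box_id n).
Definition bdelta n (i : 'I_n.+1) (a : bool) : bmap n n.+1 :=
  BMap (is_box_delta i a).
Definition bcomp m n p (f : bmap n p) (g : bmap m n) : bmap m p :=
  BMap (is_box_comp (bmapP f) (bmapP g)).

Lemma bmap_le m n (f : bmap m n) : m <= n.
Proof.
case: f => f; elim=> {m n f} // m n p f g _ le_np _ le_mn.
exact: leq_trans le_np.
Qed.

Lemma is_box_ext m n (f g : vert m -> vert n) : f =1 g -> is_box f -> is_box g.
Proof. by move=> /funext->. Qed.

Definition vcons n (b : bool) (e : vert n) : vert n.+1 := [tuple of b :: e].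

Lemma is_box_vertex n (e : vert n) : @is_box 0 n (fun=> e).
Proof.
elim: n e => [|n IHn] e.
  by apply: is_box_ext (is_box_id 0) => u; rewrite [u]tuple0 [e]tuple0.
case/tupleP: e => b e.
apply: is_box_ext (is_box_comp (is_box_delta ord0 b) (IHn e)) => u.
by apply: val_inj; rewrite /= take0 drop0.
Qed.

Definition bvertex n (e : vert n) : bmap 0 n := BMap (is_box_vertex e).

Definition vcat p q (u : vert p) (v : vert q) : vert (p + q) := [tuple of u ++ v].

Lemma vtake_size p q (e : vert (p + q)) : size (take p e) == p.
Proof. by rewrite size_takel // size_tuple leq_addr. Qed.
Lemma vdrop_size p q (e : vert (p + q)) : size (drop p e) == q.
Proof. by rewrite size_drop size_tuple addKn. Qed.
Definition vfst p q (e : vert (p + q)) : vert p := Tuple (vtake_size e).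
Definition vsnd p q (e : vert (p + q)) : vert q := Tuple (vdrop_size e).

Lemma vcatK p q (e : vert (p + q)) : vcat (vfst e) (vsnd e) = e.
Proof. by apply: val_inj; rewrite /= cat_take_drop. Qed.
Lemma vfst_cat p q (u : vert p) (v : vert q) : vfst (vcat u v) = u.
Proof. by apply: val_inj; rewrite /= take_size_cat // size_tuple. Qed.
Lemma vsnd_cat p q (u : vert p) (v : vert q) : vsnd (vcat u v) = v.
Proof. by apply: val_inj; rewrite /= drop_size_cat // size_tuple. Qed.

Definition vprod p q p' q' (f : vert p -> vert p') (g : vert q -> vert q')
  (e : vert (p + q)) : vert (p' + q') := vcat (f (vfst e)) (g (vsnd e)).

Lemma is_box_prodl p p' q (f : vert p -> vert p') :
  is_box f -> is_box (@vprod p q p' q f id).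
Proof.
elim=> {p p' f} [n|n i a|m n p f g _ fP _ gP].
- by apply: is_box_ext (is_box_id _) => e; rewrite /vprod vcatK.
- have lt_i : i < (n + q).+1.
    by apply: leq_trans (ltn_ord i) _; rewrite ltnS leq_addr.
  apply: is_box_ext (is_box_delta (Ordinal lt_i) a) => e; apply: val_inj => /=.
  rewrite -{1 2}(vcatK e) /= take_cat drop_cat size_take size_tuple.
  have le_in : i <= n by rewrite -ltnS.
  have -> : (if n < n + q then n else n + q) = n.
    by case: ltnP => // le_nq; apply/eqP; rewrite eqn_leq le_nq leq_addr.
  case: (ltnP i n) => [lt_in|le_ni]; first by rewrite -catA.
  have {le_in le_ni} -> : i = n :> nat by apply/eqP; rewrite eqn_leq le_in.
  rewrite subnn take0 drop0 cats0 take_takel // -catA /=.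
  by rewrite [drop n (take n _)]drop_oversize // (eqP (vtake_size e)).
- apply: is_box_ext (is_box_comp fP gP) => e.
  by rewrite /vprod /= vfst_cat vsnd_cat.
Qed.

Lemma is_box_cons q q' (g : vert q -> vert q') : is_box g ->
  @is_box q.+1 q'.+1 (fun e => vcons (thead e) (g [tuple of behead e])).
Proof.
elim=> {q q' g} [n|n i a|m n p f g _ fP _ gP].
- apply: is_box_ext (is_box_id _) => e; apply: val_inj => /=.
  by case/tupleP: e => b e; rewrite /= theadE.
- apply: is_box_ext (is_box_delta (lift ord0 i) a) => e; apply: val_inj.
  by case/tupleP: e => b e; rewrite /= theadE.
- apply: is_box_ext (is_box_comp fP gP) => e /=; apply: val_inj => /=.
  by rewrite theadE; congr (_ :: tval (f _)); apply: val_inj.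
Qed.

Lemma is_box_prodr p q q' (g : vert q -> vert q') :
  is_box g -> is_box (@vprod p q p q' id g).
Proof.
move=> gP; elim: p => [|p IHp].
  apply: is_box_ext gP => e; apply: val_inj; rewrite /= take0 /=.
  by congr (tval (g _)); apply: val_inj; rewrite /= drop0.
apply: is_box_ext (is_box_cons IHp) => e; apply: val_inj.
case/tupleP: e => b e /=; rewrite theadE; congr (_ :: _ ++ tval (g _)).
by apply: val_inj.
Qed.

Lemma is_box_prod p q p' q' (f : bmap p p') (g : bmap q q') :
  is_box (vprod f g).
Proof.
apply: is_box_ext (is_box_comp (is_box_prodl q' (bmapP f))
  (is_box_prodr p (bmapP g))) => e.
by rewrite /vprod /= vfst_cat vsnd_cat.
Qed.

Definition bprod p q p' q' (f : bmap p p') (g : bmap q q') :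
  bmap (p + q) (p' + q') := BMap (is_box_prod f g).

Definition copies m n (f : vert m -> vert n) (i : 'I_m) (j : 'I_n) : bool :=
  [forall e, tnth (f e) j == tnth e i].

Definition frozen m n (f : vert m -> vert n) (j : 'I_n) : Prop :=
  exists a, forall e, tnth (f e) j = a.

Lemma copiesP m n (f : vert m -> vert n) i j :
  reflect (forall e, tnth (f e) j = tnth e i) (copies f i j).
Proof. by apply: (iffP forallP) => h e; apply/eqP. Qed.

Lemma tnth_delta n (i : 'I_n.+1) a (e : vert n) : tnth (delta i a e) i = a.
Proof.
have szt : size (take i e) = i by rewrite size_takel // size_tuple -ltnS.
by rewrite (tnth_nth a) /= nth_cat szt ltnn subnn.
Qed.

Lemma tnth_delta_lift n (i : 'I_n.+1) a (e : vert n) k :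
  tnth (delta i a e) (lift i k) = tnth e k.
Proof.
have szt : size (take i e) = i by rewrite size_takel // size_tuple -ltnS.
rewrite !(tnth_nth a) /= nth_cat szt /bump; case: (leqP i k) => [le_ik|lt_ki].
  by rewrite ltnNge leqW //= subSn //= nth_drop subnKC.
by rewrite add0n lt_ki nth_take.
Qed.

Lemma copies_inj m n (f : vert m -> vert n) i i' j :
  copies f i j -> copies f i' j -> i = i'.
Proof.
move=> /copiesP fi /copiesP fi'.
pose e : vert m := [tuple k == i | k < m].
by move: (fi' e); rewrite fi !tnth_mktuple eqxx => /esym/eqP.
Qed.

Lemma frozenNcopies m n (f : vert m -> vert n) i j : frozen f j -> ~~ copies f i j.
Proof.
case=> a fa; apply/copiesP => fi.
pose e b : vert m := [tuple b | k < m].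
by move: (fa (e (~~ a))); rewrite fi tnth_mktuple; case: a {fa}.
Qed.

Lemma box_coords m n (f : vert m -> vert n) : is_box f ->
  (forall j, frozen f j \/ exists i, copies f i j)
  /\ (forall i, exists j, forall j', copies f i j' = (j' == j)).
Proof.
elim=> {m n f} [n|n i a|m n p f g _ [fc fd] _ [gc gd]].
- split=> [j|i]; first by right; exists j; apply/copiesP.
  exists i => j; apply/idP/eqP => [h|->]; last exact/copiesP.
  by apply/esym/(copies_inj h)/copiesP.
- have liftP k : copies (delta i a) k (lift i k).
    by apply/copiesP => e; rewrite tnth_delta_lift.
  have frz : frozen (delta i a) i by exists a => e; rewrite tnth_delta.
  split=> [j|k].
    by case: (unliftP i j) => [k ->|->]; [right; exists k|left].
  exists (lift i k) => j; apply/idP/eqP => [|-> //].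
  case: (unliftP i j) => [k' ->|->] h; first by rewrite (copies_inj h (liftP k')).
  by rewrite (negPf (frozenNcopies k frz)) in h.
- split=> [k|i].
    case: (fc k) => [[a fa]|[j /copiesP fj]]; first by left; exists a => e; apply: fa.
    case: (gc j) => [[a ga]|[i /copiesP gi]].
      by left; exists a => e; rewrite /= fj.
    by right; exists i; apply/copiesP => e; rewrite /= fj.
  case: (gd i) => j gj; case: (fd j) => k fk; exists k => k'.
  have /copiesP hj : copies g i j by rewrite gj.
  apply/idP/eqP => [/copiesP h|->].
    apply/eqP; rewrite -fk; case: (fc k') => [[a fa]|[j' fj']].
      suff : ~~ copies (f \o g) i k' by case/copiesP.
      by apply: frozenNcopies; exists a => e; apply: fa.
    suff /eqP <- : j' == j by [].
    rewrite -gj; apply/copiesP => e; rewrite -h /=.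
    by move/copiesP: fj' => ->.
  have /copiesP hk : copies f j k by rewrite fk.
  by apply/copiesP => e; rewrite /= hk.
Qed.

(* [dir f] sends a coordinate of the [m]-cube to the coordinate of the [n]-cube
   which [f] makes vary with it: [delta i a] gives [lift i]. *)
Definition dir m n (f : bmap m n) (i : 'I_m) : 'I_n :=
  xchoose (let: ex_intro j jP := (box_coords (bmapP f)).2 i in
           ex_intro (fun j => copies f i j) j (etrans (jP j) (eqxx j))).

Lemma dirP m n (f : bmap m n) i j : copies f i j = (j == dir f i).
Proof.
have fi : copies f i (dir f i) by exact: xchooseP.
have [j0 j0P] := (box_coords (bmapP f)).2 i.
by move: fi; rewrite !j0P => /eqP ->.
Qed.

Lemma dir_unique m n (f : bmap m n) i j :
  (forall e, tnth (f e) j = tnth e i) -> dir f i = j.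
Proof. by move=> h; apply/esym/eqP; rewrite -dirP; apply/copiesP. Qed.

Lemma tnth_dir m n (f : bmap m n) e i : tnth (f e) (dir f i) = tnth e i.
Proof. by have /copiesP -> : copies f i (dir f i) by rewrite dirP. Qed.

Lemma dir_id n i : dir (bid n) i = i. Proof. exact: dir_unique. Qed.

Lemma dir_comp m n p (f : bmap n p) (g : bmap m n) i :
  dir (bcomp f g) i = dir f (dir g i).
Proof. by apply: dir_unique => e; rewrite /= !tnth_dir. Qed.

Lemma dir_delta n (i : 'I_n.+1) a k : dir (bdelta i a) k = lift i k.
Proof. by apply: dir_unique => e; apply: tnth_delta_lift. Qed.

Local Open Scope quotient_scope.

Section Quotient.
Variables (T : Type) (R : T -> T -> Prop).

Let gen : rel {classic T} := fun x y => `[< clos_refl_sym_trans T R x y >].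

Fact gen_refl : reflexive gen.
Proof. by move=> x; apply/asboolP; apply: rst_refl. Qed.
Fact gen_sym : symmetric gen.
Proof. by move=> x y; apply/asboolP/asboolP; apply: rst_sym. Qed.
Fact gen_trans : transitive gen.
Proof.
by move=> y x z /asboolP xy /asboolP yz; apply/asboolP; apply: rst_trans xy yz.
Qed.

Definition gen_equiv : equiv_rel {classic T} := EquivRel gen gen_refl gen_sym gen_trans.

Definition quot : Type := {eq_quot gen_equiv}.
Definition qcl (x : T) : quot := \pi_({eq_quot gen_equiv}) (x : {classic T}).
Lemma qclP x y : qcl x = qcl y <-> clos_refl_sym_trans T R x y.
Proof.
split=> [xy|xy]; last by apply/eqmodP/asboolP.
by have /eqmodP/asboolP : x = y %[mod {eq_quot gen_equiv}] by [].
Qed.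

Lemma qcl_gen x y : R x y -> qcl x = qcl y.
Proof. by move=> Rxy; apply/qclP/rst_step. Qed.

Lemma qclW (P : quot -> Prop) : (forall x, P (qcl x)) -> forall c, P c.
Proof. by move=> h; apply: quotW. Qed.

End Quotient.

HB.lock Definition qlift (T : Type) (R : T -> T -> Prop) (U : Type) (f : T -> U)
  (c : quot R) : U := f (repr (c : {eq_quot gen_equiv R})).

Lemma qliftE T (R : T -> T -> Prop) U (f : T -> U) x :
  (forall y z, R y z -> f y = f z) -> qlift f (qcl R x) = f x.
Proof.
move=> fR; have fRst y z : clos_refl_sym_trans T R y z -> f y = f z.
  by elim=> {y z} // y z w _ -> _ ->.
by rewrite unlock; apply/fRst/qclP; rewrite /qcl reprK.
Qed.

Record pcset : Type := PCSet {
  cube :> nat -> Type;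
  act : forall m n, bmap m n -> cube n -> cube m;
  act_id : forall n (x : cube n), act (bid n) x = x;
  act_comp : forall m n p (f : bmap n p) (g : bmap m n) (x : cube p),
    act (bcomp f g) x = act g (act f x) }.
Arguments act K [m n] f x : rename.

Definition face (K : pcset) n (i : 'I_n.+1) (a : bool) (x : K n.+1) : K n :=
  act K (bdelta i a) x.

Record hom (K L : pcset) : Type := Hom {
  happ :> forall n, K n -> L n;
  hom_nat : forall m n (f : bmap m n) (x : K n),
    happ (act K f x) = act L f (happ x) }.
Arguments happ {K L} h [n] x.

Lemma hom_eq K L (h k : hom K L) : (forall n (x : K n), h n x = k n x) -> h = k.
Proof.
case: h k => [h hP] [k kP] /= hk.
have eq_hk : h = k by apply: functional_extensionality_dep => n; apply/funext/hk.
by case: _ / eq_hk in kP *; rewrite (Prop_irrelevance hP kP).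
Qed.

Definition hid K : hom K K := @Hom K K (fun _ => id) (fun _ _ _ _ => erefl).

Program Definition hcomp K L M (h : hom L M) (k : hom K L) : hom K M :=
  @Hom K M (fun n x => h n (k n x)) _.
Next Obligation. by rewrite !hom_nat. Qed.

Program Definition box (n : nat) : pcset :=
  @PCSet (fun m => bmap m n) (fun m k f g => bcomp g f) _ _.
Next Obligation. exact: bmap_eq. Qed.
Next Obligation. exact: bmap_eq. Qed.

Program Definition box_map m n (f : bmap m n) : hom (box m) (box n) :=
  @Hom (box m) (box n) (fun _ g => bcomp f g) _.
Next Obligation. exact: bmap_eq. Qed.

Program Definition char_map (K : pcset) n (c : K n) : hom (box n) K :=
  @Hom (box n) K (fun _ f => act K f c) _.
Next Obligation. exact: act_comp. Qed.

Program Definition below (n : nat) (K : pcset) : pcset :=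
  @PCSet (fun m => {x : K m | m < n})
    (fun m k f x => exist _ (act K f (sval x)) (leq_ltn_trans (bmap_le f) (svalP x)))
    _ _.
Next Obligation. by apply: val_inj; rewrite /= act_id. Qed.
Next Obligation. by apply: val_inj; rewrite /= act_comp. Qed.

Definition below_incl n K : hom (below n K) K :=
  @Hom (below n K) K (fun _ x => sval x) (fun _ _ _ _ => erefl).

Program Definition below_map n K L (h : hom K L) : hom (below n K) (below n L) :=
  @Hom (below n K) (below n L) (fun m x => exist _ (h m (sval x)) (svalP x)) _.
Next Obligation. by apply: val_inj; rewrite /= hom_nat. Qed.

Definition bd n := below n (box n).
Definition bd_incl n : hom (bd n) (box n) := below_incl n (box n).

Section Pullback.
Variables (K L M : pcset) (f : hom K M) (g : hom L M).

Definition pb_cube n : Type := {xy : K n * L n | f n xy.1 = g n xy.2}.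

Lemma pb_act_subproof m n (h : bmap m n) (z : pb_cube n) :
  f m (act K h (sval z).1) = g m (act L h (sval z).2).
Proof. by rewrite !hom_nat (svalP z). Qed.

Definition pb_act m n (h : bmap m n) (z : pb_cube n) : pb_cube m :=
  exist (fun xy : K m * L m => f m xy.1 = g m xy.2)
    (act K h (sval z).1, act L h (sval z).2) (pb_act_subproof h z).

Lemma pb_act_id n (z : pb_cube n) : pb_act (bid n) z = z.
Proof. by case: z => [[x y] e]; apply: eq_exist; rewrite /= !act_id. Qed.

Lemma pb_act_comp m n p (h : bmap n p) (k : bmap m n) (z : pb_cube p) :
  pb_act (bcomp h k) z = pb_act k (pb_act h z).
Proof. by case: z => [[x y] e]; apply: eq_exist; rewrite /= !act_comp. Qed.

Definition pullback : pcset := PCSet pb_act_id pb_act_comp.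

Definition pb_fst : hom pullback K :=
  @Hom pullback K (fun _ z => (sval z).1) (fun _ _ _ _ => erefl).
Definition pb_snd : hom pullback L :=
  @Hom pullback L (fun _ z => (sval z).2) (fun _ _ _ _ => erefl).
End Pullback.

Section Graph.
Variables (V E : Type) (bdr : bool -> E -> V).

Definition graph_cube (n : nat) : Type :=
  match n with 0 => V | 1 => E | _ => void end.

Lemma bmap_gt_False m n (f : bmap m n) : n < m -> False.
Proof. by rewrite ltnNge (bmap_le f). Qed.

Definition graph_act m n : bmap m n -> graph_cube n -> graph_cube m :=
  match n, m return bmap m n -> graph_cube n -> graph_cube m with
  | 0, 0 => fun _ v => v
  | 1, 0 => fun f e => bdr (thead (f [tuple])) e
  | 1, 1 => fun _ e => e
  | 0, m'.+1 => fun f _ => False_rect _ (bmap_gt_False f isT)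
  | 1, m'.+2 => fun f _ => False_rect _ (bmap_gt_False f isT)
  | _.+2, _ => fun _ => of_void _
  end.

Lemma graph_act_id n (x : graph_cube n) : graph_act (bid n) x = x.
Proof. by case: n x => [|[|n]]. Qed.

Lemma thead11 (f : bmap 1 1) e : thead (f e) = thead e.
Proof. by have := tnth_dir f e ord0; rewrite [dir _ _]ord1. Qed.

Lemma graph_act_comp m n p (f : bmap n p) (g : bmap m n) (x : graph_cube p) :
  graph_act (bcomp f g) x = graph_act g (graph_act f x).
Proof.
have le_np := bmap_le f; have le_mn := bmap_le g.
case: p f x le_np => [|[|p]] f x; last by case: (x : void).
  by case: n f g le_mn => // f g; case: m g.
case: n f g le_mn => [|[|n]] // f g; case: m g => [|[|m]] // g _ _ /=.
  by rewrite [g _]tuple0.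
by rewrite thead11.
Qed.

Definition graph : pcset := PCSet graph_act_id graph_act_comp.
End Graph.

Inductive actions (Sig : Type) : Type := Act of Sig | Zero | Bot.
Arguments Zero {Sig}.
Arguments Bot {Sig}.

Record sync_alg (Sig : Type) : Type := SyncAlg {
  sync :> actions Sig -> actions Sig -> actions Sig;
  syncC : forall u v, sync u v = sync v u;
  syncA : forall u v w, sync u (sync v w) = sync (sync u v) w;
  sync_bot : forall u, u <> Zero -> sync u Bot = Bot;
  sync_zero : forall u v, sync u v = Zero <-> u = Zero /\ v = Zero;
  sync_act0 : forall a, sync (Act a) Zero = Act a \/ sync (Act a) Zero = Bot }.

Program Definition bang (T : Type) : pcset :=
  @PCSet (fun n => n.-tuple T)
    (fun m n f w => [tuple tnth w (dir f i) | i < m]) _ _.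
Next Obligation. by apply: eq_from_tnth => i; rewrite tnth_mktuple dir_id. Qed.
Next Obligation.
by apply: eq_from_tnth => i; rewrite !tnth_mktuple dir_comp.
Qed.

Lemma face_bang T n (i : 'I_n.+1) a (w : bang T n.+1) :
  face i a w = take i w ++ drop i.+1 w :> seq T.
Proof.
have le_in : i <= n by rewrite -ltnS.
have szt : size (take i w) = i by rewrite size_takel // size_tuple ltnW.
apply: (@eq_from_nth _ (thead w)) => [|k].
  by rewrite size_tuple size_cat szt size_drop size_tuple subSS subnKC.
rewrite size_tuple => lt_kn; pose k' := Ordinal lt_kn.
rewrite -[k]/(val k') -tnth_nth tnth_mktuple dir_delta (tnth_nth (thead w)) /=.
rewrite /bump nth_cat szt; case: (leqP i k) => [le_ik|lt_ki].
  by rewrite nth_drop addSn subnKC.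
by rewrite nth_take.
Qed.

Program Definition bang_map T U (f : T -> U) : hom (bang T) (bang U) :=
  @Hom (bang T) (bang U) (fun _ w => map_tuple f w) _.
Next Obligation.
by apply: eq_from_tnth => i; rewrite !(tnth_map, tnth_mktuple).
Qed.

Section Labelled.
Variables (Sig : Type) (sg : sync_alg Sig).

(* A word on [lact] is the same as a word [a_1 .. a_n] on [Sig] with
   [sg a_i 0 = a_i] for all [i]. *)
Definition lact : Type := {a : Sig | sg (Act a) Zero = Act a}.
Definition sbang : pcset := bang lact.

Lemma lact_eq (a b : lact) : sval a = sval b -> a = b.
Proof. by case: a b => [a aP] [b bP] /=; apply: eq_exist. Qed.

Record lpc : Type := LPC { under :> pcset; lab : hom under sbang }.

Record lhom (K L : lpc) : Type := LHom {
  lhom_hom :> hom K L;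
  lhom_lab : hcomp (lab L) lhom_hom = lab K }.

Lemma lhom_eq K L (h k : lhom K L) : (forall n (x : K n), h n x = k n x) -> h = k.
Proof.
case: h k => [h hP] [k kP] /= /hom_eq hk; case: _ / hk in kP *.
by rewrite (Prop_irrelevance hP kP).
Qed.

Lemma lab_lhom K L (h : lhom K L) n (x : K n) : lab L n (h n x) = lab K n x.
Proof. by rewrite -(lhom_lab h). Qed.

Program Definition lid K : lhom K K := @LHom K K (hid K) _.
Next Obligation. exact: hom_eq. Qed.

Program Definition lcomp K L M (h : lhom L M) (k : lhom K L) : lhom K M :=
  @LHom K M (hcomp h k) _.
Next Obligation. by apply: hom_eq => n x /=; rewrite !lab_lhom. Qed.

Lemma lcompE K L M (h : lhom L M) (k : lhom K L) n (x : K n) :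
  lcomp h k n x = h n (k n x).
Proof. by []. Qed.

Record diagram : Type := Diagram {
  idx : Type;
  arr : idx -> idx -> Type;
  dobj : idx -> lpc;
  dmap : forall i j, arr i j -> lhom (dobj i) (dobj j) }.

Arguments dobj : clear implicits.

Section Colim.
Variable D : diagram.

Definition cpt n : Type := {i : idx D & dobj D i n}.

Inductive cgen n : cpt n -> cpt n -> Prop :=
| CGen i j (a : arr i j) (x : dobj D i n) :
    cgen (existT _ i x) (existT (fun i => dobj D i n) j (dmap a n x)).

Definition colim_cube n : Type := quot (@cgen n).
Definition cin n i (x : dobj D i n) : colim_cube n :=
  qcl (@cgen n) (existT _ i x).
Definition clift n U (F : forall i, dobj D i n -> U) (c : colim_cube n) : U :=
  qlift (fun t => F (projT1 t) (projT2 t)) c.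

Lemma cin_arr n i j (a : arr i j) (x : dobj D i n) : cin (dmap a n x) = cin x.
Proof. exact/esym/qcl_gen/CGen. Qed.

Lemma cinW n (P : colim_cube n -> Prop) :
  (forall i (x : dobj D i n), P (cin x)) -> forall c, P c.
Proof. move=> h; apply: (@qclW _ (@cgen n)) => -[i x]; exact: h. Qed.

Lemma cliftE n U (F : forall i, dobj D i n -> U) i (x : dobj D i n) :
  (forall i j (a : arr i j) (x : dobj D i n), F j (dmap a n x) = F i x) ->
  clift F (cin x) = F i x.
Proof. by move=> FP; rewrite /clift qliftE // => _ _ [j k a y] /=; rewrite FP. Qed.

Definition colim_act m n (f : bmap m n) : colim_cube n -> colim_cube m :=
  clift (fun i x => cin (act (dobj D i) f x)).

Lemma colim_actE m n (f : bmap m n) i (x : dobj D i n) :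
  colim_act f (cin x) = cin (act (dobj D i) f x).
Proof. by rewrite /colim_act cliftE // => j k a y; rewrite -hom_nat cin_arr. Qed.

Lemma colim_act_id n (c : colim_cube n) : colim_act (bid n) c = c.
Proof. by elim/cinW: c => i x; rewrite colim_actE act_id. Qed.

Lemma colim_act_comp m n p (f : bmap n p) (g : bmap m n) (c : colim_cube p) :
  colim_act (bcomp f g) c = colim_act g (colim_act f c).
Proof. by elim/cinW: c => i x; rewrite !colim_actE act_comp. Qed.

Definition colim_pcset : pcset := PCSet colim_act_id colim_act_comp.

Definition colim_labf n : colim_cube n -> sbang n :=
  clift (fun i => lab (dobj D i) n).

Lemma colim_labE n i (x : dobj D i n) : colim_labf (cin x) = lab (dobj D i) n x.
Proof. by rewrite /colim_labf cliftE // => j k a y; rewrite lab_lhom. Qed.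

Lemma colim_lab_nat m n (f : bmap m n) (c : colim_pcset n) :
  colim_labf (act colim_pcset f c) = act sbang f (colim_labf c).
Proof.
elim/cinW: c => i x; rewrite [act colim_pcset _ _]colim_actE !colim_labE.
by rewrite hom_nat.
Qed.

Definition colim : lpc := LPC (Hom colim_lab_nat).

Lemma cinj_nat i m n (f : bmap m n) (x : dobj D i n) :
  cin (act (dobj D i) f x) = act colim_pcset f (cin x).
Proof. by rewrite /= colim_actE. Qed.

Definition cinj_hom i : hom (dobj D i) colim :=
  @Hom (dobj D i) colim (fun n x => cin x) (@cinj_nat i).

Lemma cinj_lab i : hcomp (lab colim) (cinj_hom i) = lab (dobj D i).
Proof. by apply: hom_eq => n x; apply: colim_labE. Qed.

Definition cinj i : lhom (dobj D i) colim := LHom (cinj_lab i).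

Section Rec.
Variables (L : lpc) (legs : forall i, lhom (dobj D i) L).
Hypothesis legsP : forall i j (a : arr i j) n (x : dobj D i n),
  legs j n (dmap a n x) = legs i n x.

Definition crecf n : colim n -> L n := clift (fun i => legs i n).

Lemma crecfE n i (x : dobj D i n) : crecf (cinj i n x) = legs i n x.
Proof. by rewrite /crecf cliftE // => j k a y; apply: legsP. Qed.

Lemma crec_nat m n (f : bmap m n) (c : colim n) :
  crecf (act colim f c) = act L f (crecf c).
Proof.
by elim/cinW: c => i x; rewrite -[cin x]/(cinj i n x) -hom_nat !crecfE hom_nat.
Qed.

Lemma crec_lab : hcomp (lab L) (Hom crec_nat) = lab colim.
Proof.
apply: hom_eq => n c; elim/cinW: c => i x.
by rewrite -[cin x]/(cinj i n x) /= crecfE lab_lhom colim_labE.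
Qed.

Definition crec : lhom colim L := LHom crec_lab.

Lemma crecE i n (x : dobj D i n) : crec n (cinj i n x) = legs i n x.
Proof. exact: crecfE. Qed.
End Rec.

Lemma cinj_arr i j (a : arr i j) n (x : dobj D i n) :
  cinj j n (dmap a n x) = cinj i n x.
Proof. exact: cin_arr. Qed.

Lemma colimW n (P : colim n -> Prop) :
  (forall i (x : dobj D i n), P (cinj i n x)) -> forall c, P c.
Proof. exact: cinW. Qed.

Lemma colim_ext (L : lpc) (h k : lhom colim L) :
  (forall i n (x : dobj D i n), h n (cinj i n x) = k n (cinj i n x)) -> h = k.
Proof. by move=> hk; apply: lhom_eq => n c; elim/colimW: c. Qed.

End Colim.

Inductive span : Type := SpanM | SpanL | SpanR.
Inductive span_arr : span -> span -> Type :=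
| span_l : span_arr SpanM SpanL
| span_r : span_arr SpanM SpanR.

Section Pushout.
Variables (M K L : lpc) (f : lhom M K) (g : lhom M L).

Definition span_obj (s : span) : lpc :=
  match s with SpanM => M | SpanL => K | SpanR => L end.

Definition span_map s t (a : span_arr s t) : lhom (span_obj s) (span_obj t) :=
  match a in span_arr s t return lhom (span_obj s) (span_obj t) with
  | span_l => f
  | span_r => g
  end.

Definition span_diag : diagram := Diagram span_map.
Definition pushout : lpc := colim span_diag.
Definition po_l : lhom K pushout := cinj (D := span_diag) SpanL.
Definition po_r : lhom L pushout := cinj (D := span_diag) SpanR.

Lemma po_comm n (x : M n) : po_l n (f n x) = po_r n (g n x).
Proof.
by rewrite /po_l (cinj_arr (D := span_diag) span_l) -(cinj_arr (D := span_diag) span_r).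
Qed.

Lemma po_ext X (h k : lhom pushout X) :
  (forall n x, h n (po_l n x) = k n (po_l n x)) ->
  (forall n x, h n (po_r n x) = k n (po_r n x)) -> h = k.
Proof.
move=> hl hr; apply: colim_ext => -[] // n x.
by rewrite -(cinj_arr (D := span_diag) span_l); apply: hl.
Qed.

Section Rec.
Variables (X : lpc) (u : lhom K X) (v : lhom L X).
Hypothesis uvP : forall n (x : M n), u n (f n x) = v n (g n x).

Definition po_legs s : lhom (span_obj s) X :=
  match s return lhom (span_obj s) X with
  | SpanM => lcomp u f | SpanL => u | SpanR => v
  end.

Lemma po_legsP i j (a : span_arr i j) n (x : span_obj i n) :
  po_legs j n (span_map a n x) = po_legs i n x.
Proof. by case: i j / a x => x //=; rewrite uvP. Qed.

Definition po_rec : lhom pushout X := crec (D := span_diag) po_legsP.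

Lemma po_recl n x : po_rec n (po_l n x) = u n x.
Proof. exact: (crecE (D := span_diag)). Qed.
Lemma po_recr n x : po_rec n (po_r n x) = v n x.
Proof. exact: (crecE (D := span_diag)). Qed.
End Rec.
End Pushout.

Inductive seq_arr : nat -> nat -> Type := seq_step n : seq_arr n n.+1.

Section Seq.
Variables (X : nat -> lpc) (t : forall n, lhom (X n) (X n.+1)).

Definition seq_map i j (a : seq_arr i j) : lhom (X i) (X j) :=
  match a in seq_arr i j return lhom (X i) (X j) with seq_step n => t n end.

Definition seq_diag : diagram := Diagram seq_map.
Definition seqlim : lpc := colim seq_diag.
Definition seq_in n : lhom (X n) seqlim := cinj (D := seq_diag) n.

Lemma seq_in_step n m (x : X n m) : seq_in n.+1 m (t n m x) = seq_in n m x.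
Proof. exact: (cinj_arr (D := seq_diag) (seq_step n)). Qed.

Lemma seq_ext Y (h k : lhom seqlim Y) :
  (forall i n x, h n (seq_in i n x) = k n (seq_in i n x)) -> h = k.
Proof. exact: (@colim_ext seq_diag). Qed.
End Seq.

Section SeqMap.
Variables (X Y : nat -> lpc).
Variables (t : forall n, lhom (X n) (X n.+1)) (u : forall n, lhom (Y n) (Y n.+1)).
Variable h : forall n, lhom (X n) (Y n).
Hypothesis hP : forall n m (x : X n m), h n.+1 m (t n m x) = u n m (h n m x).

Lemma seq_lim_mapP i j (a : seq_arr i j) n (x : X i n) :
  lcomp (seq_in u j) (h j) n (seq_map t a n x) = lcomp (seq_in u i) (h i) n x.
Proof. by case: i j / a x => i x; rewrite !lcompE hP seq_in_step. Qed.

Definition seq_lim_map : lhom (seqlim t) (seqlim u) :=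
  crec (D := seq_diag t) seq_lim_mapP.

Lemma seq_lim_mapE i n x : seq_lim_map n (seq_in t i n x) = seq_in u i n (h i n x).
Proof. exact: (crecE (D := seq_diag t)). Qed.
End SeqMap.

(* [f] is the composite of the map of cubes [psi] and of the map
   [e |-> (e_(i_1), .., e_(i_q))], where [s] lists the indices [i_k]: each index
   occurs in [s] and the first occurrences are in increasing order. *)
Definition non_twisted m p (f : vert m -> vert p) : Prop :=
  exists q (s : q.-tuple 'I_m) (psi : bmap q p),
    [/\ forall i, i \in s,
        forall i j : 'I_m, j = i.+1 :> nat -> index i s < index j s
      & forall e, f e = psi [tuple tnth e (tnth s k) | k < q]].

(* [vtx] names the vertices by those of the [r]-cube. In [cosk] it stands for the
   identification of the set of vertices with [vert r]. *)
Record vlpc (r : nat) : Type := VLPC {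
  vl :> lpc;
  vtx : vl 0 -> vert r }.
Arguments vtx {r} K x : rename.

Definition bd_vertex n (e : vert n.+1) : bd n.+1 0 :=
  exist _ (bvertex e) (ltn0Sn n).

Record shell r (n : nat) (K : vlpc r) : Type := Shell {
  sx : hom (bd n.+1) K;
  sy : hom (box n.+1) sbang;
  scomm : hcomp (lab K) sx = hcomp sy (bd_incl n.+1);
  snt : non_twisted (fun e => vtx K (sx 0 (bd_vertex e))) }.

Lemma shell_eq r n (K : vlpc r) (s t : shell n K) : sx s = sx t -> sy s = sy t -> s = t.
Proof.
case: s t => [x y c w] [x' y' c' w'] /= ex ey.
case: _ / ex in c' w' *; case: _ / ey in c' *.
by rewrite (Prop_irrelevance c c') (Prop_irrelevance w w').
Qed.

Section Attach.
Variables (r n : nat) (K : vlpc r).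

Inductive att : Type := ABase | ABd of shell n K | ACell of shell n K.
Inductive att_arr : att -> att -> Type :=
| att_base s : att_arr (ABd s) ABase
| att_cell s : att_arr (ABd s) (ACell s).

Definition att_obj (a : att) : lpc :=
  match a with
  | ABase => K
  | ABd s => LPC (hcomp (sy s) (bd_incl n.+1))
  | ACell s => LPC (sy s)
  end.

Definition att_map a b (h : att_arr a b) : lhom (att_obj a) (att_obj b) :=
  match h in att_arr a b return lhom (att_obj a) (att_obj b) with
  | att_base s => @LHom (att_obj (ABd s)) (att_obj ABase) (sx s) (scomm s)
  | att_cell s => @LHom (att_obj (ABd s)) (att_obj (ACell s)) (bd_incl n.+1) erefl
  end.

Definition att_diag : diagram := Diagram att_map.

Definition att_vtx (a : att) : att_obj a 0 -> vert r :=
  match a return att_obj a 0 -> vert r with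
  | ABase => vtx K
  | ABd s => fun u => vtx K (sx s 0 u)
  | ACell s => fun u => vtx K (sx s 0 (exist _ u (ltn0Sn n)))
  end.

(* The pushout attaching an [n.+1]-cube along each non-twisted [n]-shell is the
   colimit of [att_diag]. *)
Definition attach : vlpc r :=
  @VLPC r (colim att_diag) (clift (D := att_diag) att_vtx).

Definition att_in : lhom K attach := cinj (D := att_diag) ABase.
Definition att_in_cell (s : shell n K) m (u : box n.+1 m) : attach m :=
  cinj (D := att_diag) (ACell s) m u.

Lemma att_comm (s : shell n K) m (u : bd n.+1 m) :
  att_in m (sx s m u) = att_in_cell s (sval u).
Proof.
exact: etrans (cinj_arr (D := att_diag) (att_base s) u)
  (esym (cinj_arr (D := att_diag) (att_cell s) u)).
Qed.

Lemma att_vtxP i j (a : att_arr i j) (x : att_obj i 0) :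
  att_vtx (att_map a 0 x) = att_vtx x.
Proof.
case: i j / a x => s x //=; congr (vtx K (sx s 0 _)).
by apply: val_inj.
Qed.

Lemma att_vtx_in (x : K 0) : vtx attach (att_in 0 x) = vtx K x.
Proof. by rewrite /= (cliftE (D := att_diag)) //; apply: att_vtxP. Qed.

Lemma att_vtx_cell s (u : box n.+1 0) :
  vtx attach (att_in_cell s u) = vtx K (sx s 0 (exist _ u (ltn0Sn n))).
Proof. by rewrite /= (cliftE (D := att_diag)) //; apply: att_vtxP. Qed.

Lemma attW m (P : attach m -> Prop) :
  (forall x, P (att_in m x)) -> (forall s u, P (@att_in_cell s m u)) ->
  forall c, P c.
Proof.
move=> hb hc; apply: (@colimW att_diag) => -[|s|s] x //=.
- exact: hb.
- exact: (eq_ind _ P (hb (sx s m x)) _ (cinj_arr (D := att_diag) (att_base s) x)).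
- exact: hc.
Qed.

End Attach.

(* With the cubes of dimension 0 and 1 as first stage, [stage K k] is obtained
   after attaching the shells of dimension 1, .., [k]. *)
Fixpoint stage r (K : vlpc r) (k : nat) : vlpc r :=
  if k is k'.+1 then attach k (stage K k') else K.

Definition cosk_step r (K : vlpc r) k : lhom (stage K k) (stage K k.+1) :=
  att_in k.+1 (stage K k).

Definition cosk r (K : vlpc r) : lpc := seqlim (cosk_step K).

Record vhom r r' (K : vlpc r) (L : vlpc r') : Type := VHom {
  vh :> lhom K L;
  vhP : exists h : bmap r r', forall x, vtx L (vh 0 x) = h (vtx K x) }.

Lemma vhom_eq r r' (K : vlpc r) (L : vlpc r') (h k : vhom K L) :
  (forall n (x : K n), h n x = k n x) -> h = k.
Proof.
case: h k => [h hP] [k kP] /= /lhom_eq hk; case: _ / hk in kP *.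
by rewrite (Prop_irrelevance hP kP).
Qed.

Program Definition vid r (K : vlpc r) : vhom K K := @VHom _ _ K K (lid K) _.
Next Obligation. by exists (bid r). Qed.

Lemma vcomp_subproof r r' r'' (K : vlpc r) (L : vlpc r') (M : vlpc r'')
  (h : vhom L M) (k : vhom K L) :
  exists g : bmap r r'', forall x, vtx M (lcomp h k 0 x) = g (vtx K x).
Proof.
have [f fP] := vhP h; have [g gP] := vhP k.
by exists (bcomp f g) => x; rewrite lcompE fP gP.
Qed.

Definition vcomp r r' r'' (K : vlpc r) (L : vlpc r') (M : vlpc r'')
  (h : vhom L M) (k : vhom K L) : vhom K M := VHom (vcomp_subproof h k).

Lemma non_twisted_comp m p p' (f : vert m -> vert p) (g : bmap p p') :
  non_twisted f -> non_twisted (g \o f).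
Proof.
case=> q [s [psi [s_all s_ord fE]]].
by exists q, s, (bcomp g psi); split=> // e; rewrite /= fE.
Qed.

Section ShellMap.
Variables (r r' n : nat) (K : vlpc r) (L : vlpc r') (h : vhom K L).

Lemma shell_map_comm (s : shell n K) :
  hcomp (lab L) (hcomp h (sx s)) = hcomp (sy s) (bd_incl n.+1).
Proof. by rewrite -(scomm s); apply: hom_eq => m x; rewrite /= lab_lhom. Qed.

Lemma shell_map_nt (s : shell n K) :
  non_twisted (fun e => vtx L (hcomp h (sx s) 0 (bd_vertex e))).
Proof.
have [f fP] := vhP h; have [q [t [psi [t_all t_ord tE]]]] :=
  non_twisted_comp f (snt s).
by exists q, t, psi; split=> // e; rewrite -tE /= fP.
Qed.

Definition shell_map (s : shell n K) : shell n L :=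
  Shell (shell_map_comm s) (shell_map_nt s).
End ShellMap.

Section AttachMap.
Variables (r r' n : nat) (K : vlpc r) (L : vlpc r') (h : vhom K L).

Definition att_legs (a : att n K) : lhom (att_obj a) (attach n L) :=
  match a return lhom (att_obj a) (attach n L) with
  | ABase => lcomp (att_in n L) h
  | ABd s => cinj (D := att_diag n L) (ABd (shell_map h s))
  | ACell s => cinj (D := att_diag n L) (ACell (shell_map h s))
  end.

Lemma att_legsP i j (a : att_arr i j) m (x : att_obj i m) :
  att_legs j m (att_map a m x) = att_legs i m x.
Proof.
case: i j / a x => s x.
  exact: (cinj_arr (D := att_diag n L) (att_base (shell_map h s))).
exact: (cinj_arr (D := att_diag n L) (att_cell (shell_map h s))).
Qed.

Definition attach_lmap : lhom (attach n K) (attach n L) :=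
  crec (D := att_diag n K) att_legsP.

Lemma attach_lmap_in m (x : K m) : attach_lmap m (att_in n K m x) = att_in n L m (h m x).
Proof. exact: (crecE (D := att_diag n K)). Qed.

Lemma attach_lmap_cell s m (u : box n.+1 m) :
  attach_lmap m (att_in_cell s u) = att_in_cell (shell_map h s) u.
Proof. exact: (crecE (D := att_diag n K)). Qed.

Lemma attach_map_vtx : exists g : bmap r r',
  forall x, vtx (attach n L) (attach_lmap 0 x) = g (vtx (attach n K) x).
Proof.
have [g gP] := vhP h; exists g; apply: attW => [x|s u].
  by rewrite attach_lmap_in !att_vtx_in gP.
by rewrite attach_lmap_cell !att_vtx_cell gP.
Qed.

Definition attach_map : vhom (attach n K) (attach n L) := VHom attach_map_vtx.
End AttachMap.

Lemma attach_map_id r n (K : vlpc r) : attach_map n (vid K) = vid (attach n K).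
Proof.
apply: vhom_eq => m; apply: attW => [x|s u]; first exact: attach_lmap_in.
rewrite [LHS]attach_lmap_cell (_ : shell_map (vid K) s = s) //.
by apply: shell_eq => //; apply: hom_eq.
Qed.

Lemma attach_map_comp r r' r'' n (K : vlpc r) (L : vlpc r') (M : vlpc r'')
  (h : vhom L M) (k : vhom K L) :
  attach_map n (vcomp h k) = vcomp (attach_map n h) (attach_map n k).
Proof.
apply: vhom_eq => m; apply: attW => [x|s u]; rewrite [RHS]lcompE.
  by rewrite !attach_lmap_in.
rewrite !attach_lmap_cell (_ : shell_map (vcomp h k) s = shell_map h (shell_map k s)) //.
by apply: shell_eq => //; apply: hom_eq.
Qed.

Fixpoint stage_map r r' (K : vlpc r) (L : vlpc r') (h : vhom K L) k :
  vhom (stage K k) (stage L k) :=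
  match k return vhom (stage K k) (stage L k) with
  | 0 => h
  | k'.+1 => attach_map k'.+1 (stage_map h k')
  end.

Lemma stage_map_id r (K : vlpc r) k : stage_map (vid K) k = vid (stage K k).
Proof. by elim: k => //= k ->; apply: attach_map_id. Qed.

Lemma stage_map_comp r r' r'' (K : vlpc r) (L : vlpc r') (M : vlpc r'')
  (h : vhom L M) (k : vhom K L) n :
  stage_map (vcomp h k) n = vcomp (stage_map h n) (stage_map k n).
Proof. by elim: n => //= n ->; apply: attach_map_comp. Qed.

Section CoskMap.
Variables (r r' : nat) (K : vlpc r) (L : vlpc r') (h : vhom K L).

Lemma stage_map_step k m (x : stage K k m) :
  stage_map h k.+1 m (cosk_step K k m x) = cosk_step L k m (stage_map h k m x).
Proof. exact: attach_lmap_in. Qed.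

Definition cosk_map : lhom (cosk K) (cosk L) :=
  seq_lim_map (h := fun k => stage_map h k) stage_map_step.

Lemma cosk_mapE k m (x : stage K k m) :
  cosk_map m (seq_in (cosk_step K) k m x)
  = seq_in (cosk_step L) k m (stage_map h k m x).
Proof. exact: seq_lim_mapE. Qed.
End CoskMap.

Lemma cosk_map_id r (K : vlpc r) : cosk_map (vid K) = lid (cosk K).
Proof. by apply: seq_ext => i n x; rewrite cosk_mapE stage_map_id. Qed.

Lemma cosk_map_comp r r' r'' (K : vlpc r) (L : vlpc r') (M : vlpc r'')
  (h : vhom L M) (k : vhom K L) :
  cosk_map (vcomp h k) = lcomp (cosk_map h) (cosk_map k).
Proof.
by apply: seq_ext => i n x; rewrite [RHS]lcompE !cosk_mapE stage_map_comp.
Qed.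

Lemma bmap_diag n (f : bmap n n) : n < 2 -> f = bid n.
Proof.
move=> lt_n2; apply: bmap_eq => e; case: n lt_n2 f e => [|[|]] // _ f e.
  by rewrite [f e]tuple0 [e]tuple0.
apply: eq_from_tnth => i; rewrite [i]ord1 /=.
by have := tnth_dir f e ord0; rewrite [dir _ _]ord1.
Qed.

Lemma bmap01 (f : bmap 0 1) : f = bdelta ord0 (thead (f [tuple])).
Proof.
apply: bmap_eq => e; rewrite [e]tuple0; apply: val_inj => /=.
by case/tupleP: (f _) => b u; rewrite theadE [u]tuple0.
Qed.

Section GraphHom.
Variables (V E : Type) (bdr : bool -> E -> V) (K : pcset).
Variables (fV : V -> K 0) (fE : E -> K 1).
Hypothesis fP : forall a e, face ord0 a (fE e) = fV (bdr a e).

Definition graph_homf n : graph bdr n -> K n :=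
  match n return graph bdr n -> K n with
  | 0 => fV
  | 1 => fE
  | _.+2 => of_void _
  end.

Lemma graph_hom_nat m n (f : bmap m n) (x : graph bdr n) :
  graph_homf (act (graph bdr) f x) = act K f (graph_homf x).
Proof.
have le_mn := bmap_le f; case: n f x le_mn => [|[|n]] f x; last by case: (x : void).
  by case: m f => // f _; rewrite (bmap_diag f) // !act_id.
case: m f => [|[|m]] // f _; last by rewrite (bmap_diag f) // !act_id.
by rewrite [in RHS](bmap01 f) -[RHS]/(face _ _ (fE x)) fP.
Qed.

Definition graph_hom : hom (graph bdr) K := Hom graph_hom_nat.
End GraphHom.

Lemma sync_lact_subproof (a b : lact) :
  sg (Act (sval a)) (Act (sval b)) <> Bot ->
  exists c : lact, sg (Act (sval a)) (Act (sval b)) = Act (sval c).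
Proof.
case: a b => [a aP] [b bP] /= nbot; case E : (sg _ _) nbot => [c||] // _.
  have cP : sg (Act c) Zero = Act c by rewrite -E -syncA bP.
  by exists (exist _ c cP).
by have [/(_ E) []] := sync_zero sg (Act a) (Act b).
Qed.

Definition sync_lact (a b : lact) (h : sg (Act (sval a)) (Act (sval b)) <> Bot) : lact :=
  sval (cid (sync_lact_subproof h)).

Lemma sync_lactE (a b : lact) (h : sg (Act (sval a)) (Act (sval b)) <> Bot) :
  Act (sval (sync_lact h)) = sg (Act (sval a)) (Act (sval b)).
Proof. by rewrite /sync_lact; case: cid. Qed.

Definition lab1 (K : lpc) (x : K 1) : lact := thead (lab K 1 x).

Section SyncProduct.
Variables K L : lpc.

Definition syncs (xy : K 1 * L 1) : Prop :=
  sg (Act (sval (lab1 xy.1))) (Act (sval (lab1 xy.2))) <> Bot.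

Definition sp_vertex : Type := (K 0 * L 0)%type.
Definition sp_edge : Type :=
  ((K 1 * L 0) + (K 0 * L 1) + {xy : K 1 * L 1 | syncs xy})%type.

Definition sp_bdr (a : bool) (e : sp_edge) : sp_vertex :=
  match e with
  | inl (inl (x, w)) => (face ord0 a x, w)
  | inl (inr (v, y)) => (v, face ord0 a y)
  | inr xy => (face ord0 a (sval xy).1, face ord0 a (sval xy).2)
  end.

Definition sp_lab (e : sp_edge) : lact :=
  match e with
  | inl (inl (x, _)) => lab1 x
  | inl (inr (_, y)) => lab1 y
  | inr xy => sync_lact (svalP xy)
  end.

Lemma sp_labP a e :
  face ord0 a ([tuple sp_lab e] : sbang 1) = ([tuple] : sbang 0).
Proof. exact: tuple0. Qed.

(* Defined for all [K] and [L], but depends on their 1-skeleta only *)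
Definition sync_prod : lpc :=
  @LPC (graph sp_bdr) (@graph_hom _ _ sp_bdr sbang
    (fun=> [tuple]) (fun e => [tuple sp_lab e]) sp_labP).
End SyncProduct.

Section SyncProductMap.
Variables (K L K' L' : lpc) (h : lhom K K') (k : lhom L L').

Lemma lab1_lhom (M M' : lpc) (g : lhom M M') (x : M 1) : lab1 (g 1 x) = lab1 x.
Proof. by rewrite /lab1 lab_lhom. Qed.

Lemma syncs_map (xy : K 1 * L 1) : syncs xy -> syncs (h 1 xy.1, k 1 xy.2).
Proof. by rewrite /syncs /= !lab1_lhom. Qed.

Definition sp_mapV (v : sp_vertex K L) : sp_vertex K' L' := (h 0 v.1, k 0 v.2).

Definition sp_mapE (e : sp_edge K L) : sp_edge K' L' :=
  match e with
  | inl (inl (x, w)) => inl (inl (h 1 x, k 0 w))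
  | inl (inr (v, y)) => inl (inr (h 0 v, k 1 y))
  | inr xy => inr (exist _ (h 1 (sval xy).1, k 1 (sval xy).2) (syncs_map (svalP xy)))
  end.

Lemma sp_map_bdr a e : @face (sync_prod K' L') 0 ord0 a (sp_mapE e) = sp_mapV (sp_bdr a e).
Proof.
by case: e => [[[x w]|[v y]]|[[x y] xyP]]; rewrite /sp_mapV /= /face !hom_nat.
Qed.

Lemma sp_map_lab e : sp_lab (sp_mapE e) = sp_lab e.
Proof.
case: e => [[[x w]|[v y]]|[[x y] xyP]] /=; rewrite ?lab1_lhom //.
have ActI (a b : Sig) : Act a = Act b -> a = b by case.
by apply/lact_eq/ActI; rewrite !sync_lactE /= !lab1_lhom.
Qed.

Definition sp_hom : hom (sync_prod K L) (sync_prod K' L') :=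
  @graph_hom _ _ _ (sync_prod K' L') sp_mapV sp_mapE sp_map_bdr.

Lemma sp_hom_lab : hcomp (lab (sync_prod K' L')) sp_hom = lab (sync_prod K L).
Proof.
apply: hom_eq => -[|[|n]] x; last by case: (x : void).
  by [].
by apply: val_inj; rewrite /= sp_map_lab.
Qed.

Definition sync_prod_map : lhom (sync_prod K L) (sync_prod K' L') := @LHom (sync_prod K L) (sync_prod K' L') sp_hom sp_hom_lab.
End SyncProductMap.

Lemma sync_prod_map_id K L : sync_prod_map (lid K) (lid L) = lid (sync_prod K L).
Proof.
apply: lhom_eq => -[|[|n]] x; last by case: (x : void).
  by case: x.
by case: x => [[[]|[]]|[[x y] xyP]] //=; congr inr; apply: eq_exist.
Qed.

Lemma sync_prod_map_comp K L K' L' K'' L'' (h : lhom K K') (k : lhom L L')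
  (h' : lhom K' K'') (k' : lhom L' L'') :
  sync_prod_map (lcomp h' h) (lcomp k' k)
  = lcomp (sync_prod_map h' k') (sync_prod_map h k).
Proof.
apply: lhom_eq => -[|[|n]] x; last by case: (x : void).
  by [].
by case: x => [[[]|[]]|[[x y] xyP]] //=; congr inr; apply: eq_exist.
Qed.

Definition lskel n (K : lpc) : lpc := LPC (hcomp (lab K) (below_incl n.+1 K)).

Section CubeTensor.
Variables (p q : nat) (y : hom (box p) sbang) (z : hom (box q) sbang).

Definition ct1_vtx (vw : sync_prod (lskel 1 (LPC y)) (lskel 1 (LPC z)) 0) :
    vert (p + q) :=
  vcat ((sval vw.1 : bmap 0 p) [tuple]) ((sval vw.2 : bmap 0 q) [tuple]).

Definition ct1 : vlpc (p + q) := VLPC ct1_vtx.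
Definition cube_tensor : lpc := cosk ct1.
End CubeTensor.

Section CubeTensorMap.
Variables (p q p' q' : nat).
Variables (y : hom (box p) sbang) (z : hom (box q) sbang).
Variables (y' : hom (box p') sbang) (z' : hom (box q') sbang).
Variables (f : bmap p p') (g : bmap q q').
Hypotheses (fP : hcomp y' (box_map f) = y) (gP : hcomp z' (box_map g) = z).

Definition lbox_map n n' (w : hom (box n) sbang) (w' : hom (box n') sbang)
  (k : bmap n n') (kP : hcomp w' (box_map k) = w) : lhom (LPC w) (LPC w') :=
  @LHom (LPC w) (LPC w') (box_map k) kP.

Lemma lskel_map_subproof n (K L : lpc) (k : lhom K L) :
  hcomp (lab (lskel n L)) (below_map n.+1 k) = lab (lskel n K).
Proof. by apply: hom_eq => m x; rewrite /= lab_lhom. Qed.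

Definition lskel_map n (K L : lpc) (k : lhom K L) : lhom (lskel n K) (lskel n L) :=
  @LHom (lskel n K) (lskel n L) (below_map n.+1 k) (lskel_map_subproof n k).

Definition ct1_lmap : lhom (ct1 y z) (ct1 y' z') :=
  sync_prod_map (lskel_map 1 (lbox_map fP)) (lskel_map 1 (lbox_map gP)).

Lemma ct1_map_vtx : exists h : bmap (p + q) (p' + q'),
  forall x, vtx (ct1 y' z') (ct1_lmap 0 x) = h (vtx (ct1 y z) x).
Proof.
exists (bprod f g) => -[u v]; rewrite /= /ct1_vtx /vprod /=.
by rewrite vfst_cat vsnd_cat.
Qed.

Definition ct1_map : vhom (ct1 y z) (ct1 y' z') := VHom ct1_map_vtx.
Definition cube_tensor_map : lhom (cube_tensor y z) (cube_tensor y' z') :=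
  cosk_map ct1_map.
End CubeTensorMap.

Lemma cube_tensor_map_id p q (y : hom (box p) sbang) (z : hom (box q) sbang)
  (yP : hcomp y (box_map (bid p)) = y) (zP : hcomp z (box_map (bid q)) = z) n (c : cube_tensor y z n) :
  cube_tensor_map yP zP n c = c.
Proof.
rewrite /cube_tensor_map (_ : ct1_map yP zP = vid _) ?cosk_map_id //.
apply: vhom_eq => m x; rewrite -[LHS]/(ct1_lmap yP zP m x) /ct1_lmap.
rewrite (_ : lskel_map 1 (lbox_map yP) = lid _); last first.
  by apply: lhom_eq => k [u ku]; apply: val_inj; apply: bmap_eq.
rewrite (_ : lskel_map 1 (lbox_map zP) = lid _) ?sync_prod_map_id //.
by apply: lhom_eq => k [u ku]; apply: val_inj; apply: bmap_eq.
Qed.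

Lemma cube_tensor_map_eq p q p' q' (y : hom (box p) sbang) (z : hom (box q) sbang)
  (y' : hom (box p') sbang) (z' : hom (box q') sbang) (f h : bmap p p') (g k : bmap q q')
  (fP : hcomp y' (box_map f) = y) (gP : hcomp z' (box_map g) = z)
  (hP : hcomp y' (box_map h) = y) (kP : hcomp z' (box_map k) = z) :
  f = h -> g = k -> forall n c, cube_tensor_map fP gP n c = cube_tensor_map hP kP n c.
Proof.
move=> eq_fh eq_gk; case: _ / eq_fh in hP *; case: _ / eq_gk in kP *.
by rewrite (Prop_irrelevance fP hP) (Prop_irrelevance gP kP).
Qed.

Lemma cube_tensor_map_comp p q p' q' p'' q''
  (y : hom (box p) sbang) (z : hom (box q) sbang)
  (y' : hom (box p') sbang) (z' : hom (box q') sbang)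
  (y'' : hom (box p'') sbang) (z'' : hom (box q'') sbang)
  (f : bmap p p') (g : bmap q q') (f' : bmap p' p'') (g' : bmap q' q'')
  (h : bmap p p'') (k : bmap q q'')
  (fP : hcomp y' (box_map f) = y) (gP : hcomp z' (box_map g) = z)
  (fP' : hcomp y'' (box_map f') = y') (gP' : hcomp z'' (box_map g') = z')
  (hP : hcomp y'' (box_map h) = y) (kP : hcomp z'' (box_map k) = z) :
  h = bcomp f' f -> k = bcomp g' g -> forall n c,
  cube_tensor_map fP' gP' n (cube_tensor_map fP gP n c) = cube_tensor_map hP kP n c.
Proof.
move=> hE kE n c; rewrite /cube_tensor_map -[LHS]lcompE -cosk_map_comp.
rewrite (_ : vcomp _ _ = ct1_map hP kP) //; apply: vhom_eq => m x.
rewrite -[LHS]/(lcomp (ct1_lmap fP' gP') (ct1_lmap fP gP) m x).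
rewrite /ct1_lmap -sync_prod_map_comp -[RHS]/(ct1_lmap hP kP m x) /ct1_lmap.
by congr (sync_prod_map _ _ m x); apply: lhom_eq => l [u lu]; apply: val_inj;
  apply: bmap_eq => e /=; rewrite ?hE ?kE.
Qed.

Record elt (K : lpc) : Type := Elt { edim : nat; emap : hom (box edim) K }.

Definition elab (K : lpc) (x : elt K) : hom (box (edim x)) sbang :=
  hcomp (lab K) (emap x).

Definition elt_arr (K : lpc) (x x' : elt K) : Type :=
  {f : bmap (edim x) (edim x') | hcomp (emap x') (box_map f) = emap x}.

Lemma elt_arr_lab K (x x' : elt K) (f : elt_arr x x') :
  hcomp (elab x') (box_map (sval f)) = elab x.
Proof. by case: f => f fP; rewrite /elab /= -fP; apply: hom_eq. Qed.

Definition elt_map K L (h : lhom K L) (x : elt K) : elt L :=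
  Elt (hcomp h (emap x)).

Lemma box_map_id p T (y : hom (box p) T) : hcomp y (box_map (bid p)) = y.
Proof.
apply: hom_eq => n c /=; congr (y n _); exact: bmap_eq.
Qed.

Lemma elt_map_lab K L (h : lhom K L) (x : elt K) :
  hcomp (elab (elt_map h x)) (box_map (bid (edim x))) = elab x.
Proof. by rewrite box_map_id; apply: hom_eq => n c; rewrite /= lab_lhom. Qed.

Lemma elt_map_arr K L (h : lhom K L) (x x' : elt K) (f : elt_arr x x') :
  hcomp (emap (elt_map h x')) (box_map (sval f)) = emap (elt_map h x).
Proof. by case: f => f fP; rewrite /= -fP; apply: hom_eq. Qed.

Definition elt_amap K L (h : lhom K L) (x x' : elt K) (f : elt_arr x x') :
  elt_arr (elt_map h x) (elt_map h x') := exist _ (sval f) (elt_map_arr h f).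

Section TensorLeft.
Variables (p : nat) (y : hom (box p) sbang) (L : lpc).

Definition tl_obj (z : elt L) : lpc := cube_tensor y (elab z).
Definition tl_arr (z z' : elt L) (g : elt_arr z z') : lhom (tl_obj z) (tl_obj z') :=
  cube_tensor_map (box_map_id y) (elt_arr_lab g).

Definition tl_diag : diagram := Diagram tl_arr.
Definition tensor_left : lpc := colim tl_diag.
Definition tl_in (z : elt L) : lhom (cube_tensor y (elab z)) tensor_left :=
  cinj (D := tl_diag) z.

Lemma tl_inE (z z' : elt L) (g : elt_arr z z') n c :
  tl_in z' n (cube_tensor_map (box_map_id y) (elt_arr_lab g) n c) = tl_in z n c.
Proof. exact: (cinj_arr (D := tl_diag) g). Qed.
End TensorLeft.

Section TensorLeftMap.
Variables (p p' : nat) (y : hom (box p) sbang) (y' : hom (box p') sbang).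
Variables (f : bmap p p') (fP : hcomp y' (box_map f) = y).
Variables (L L' : lpc) (k : lhom L L').

Definition tl_leg (z : elt L) : lhom (tl_obj y z) (tensor_left y' L') :=
  lcomp (@tl_in _ y' _ (elt_map k z)) (cube_tensor_map fP (elt_map_lab k z)).

Lemma tl_legP z z' (g : elt_arr z z') n c :
  tl_leg z' n (tl_arr y g n c) = tl_leg z n c.
Proof.
rewrite !lcompE -(tl_inE (y := y') (elt_amap k g)); congr (tl_in _ _ _ _).
pose h : hcomp (elab (elt_map k z')) (box_map (sval g)) = elab z :=
  etrans (elt_arr_lab (elt_amap k g)) (etrans (esym (box_map_id _)) (elt_map_lab k z)).
rewrite (cube_tensor_map_comp _ _ _ _ fP h) //; try exact: bmap_eq.
by rewrite (cube_tensor_map_comp _ _ _ _ fP h) //; exact: bmap_eq.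
Qed.

Definition tensor_left_map : lhom (tensor_left y L) (tensor_left y' L') :=
  crec (D := tl_diag y L) tl_legP.

Lemma tensor_left_mapE z n c :
  tensor_left_map n (@tl_in _ y _ z n c)
  = @tl_in _ y' _ (elt_map k z) n (cube_tensor_map fP (elt_map_lab k z) n c).
Proof. exact: (crecE (D := tl_diag y L)). Qed.
End TensorLeftMap.

Lemma tensor_left_map_eq p p' (y : hom (box p) sbang) (y' : hom (box p') sbang)
  (f h : bmap p p') (fP : hcomp y' (box_map f) = y) (hP : hcomp y' (box_map h) = y)
  (L L' : lpc) (k : lhom L L') :
  f = h -> forall n c, tensor_left_map fP k n c = tensor_left_map hP k n c.
Proof.
by move=> eq_fh; case: _ / eq_fh in hP *; rewrite (Prop_irrelevance fP hP).
Qed.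

Lemma tensor_left_map_id p (y : hom (box p) sbang) (L : lpc)
  (yP : hcomp y (box_map (bid p)) = y) n (c : tensor_left y L n) :
  tensor_left_map yP (lid L) n c = c.
Proof.
move: c; apply: (@colimW (tl_diag y L)) => z c.
rewrite [LHS]tensor_left_mapE.
have e : hcomp (emap (elt_map (lid L) z)) (box_map (bid (edim z))) = emap z.
  by rewrite box_map_id; apply: hom_eq.
have := @tl_inE _ y L z (elt_map (lid L) z) (exist _ (bid (edim z)) e) n c.
move=> E; rewrite -[RHS]E; congr (tl_in _ _ _).
exact: cube_tensor_map_eq.
Qed.

Lemma tensor_left_map_comp p p' p'' (y : hom (box p) sbang)
  (y' : hom (box p') sbang) (y'' : hom (box p'') sbang)
  (f : bmap p p') (f' : bmap p' p'') (h : bmap p p'')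
  (fP : hcomp y' (box_map f) = y) (fP' : hcomp y'' (box_map f') = y')
  (hP : hcomp y'' (box_map h) = y) (L L' L'' : lpc)
  (k : lhom L L') (k' : lhom L' L'') (l : lhom L L'') n (c : tensor_left y L n) :
  h = bcomp f' f -> l = lcomp k' k ->
  tensor_left_map fP' k' n (tensor_left_map fP k n c) = tensor_left_map hP l n c.
Proof.
move=> hE ->; move: c; apply: (@colimW (tl_diag y L)) => z c.
rewrite -[cinj _ _ _]/(@tl_in _ y _ z n c) !tensor_left_mapE.
have kP : hcomp (elab (elt_map k' (elt_map k z))) (box_map (bid (edim z))) = elab z.
  by rewrite box_map_id; apply: hom_eq => m b; rewrite /= !lab_lhom.
rewrite (cube_tensor_map_comp _ _ _ _ hP kP) //; last exact: bmap_eq.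
have e : hcomp (emap (elt_map k' (elt_map k z))) (box_map (bid (edim z)))
    = emap (elt_map (lcomp k' k) z).
  by rewrite box_map_id; apply: hom_eq.
have <- := @tl_inE _ y'' L'' (elt_map (lcomp k' k) z) (elt_map k' (elt_map k z))
  (exist _ (bid (edim z)) e) n _.
congr (tl_in _ _ _); rewrite (cube_tensor_map_comp _ _ _ _ hP kP) //; exact: bmap_eq.
Qed.

Section Tensor.
Variables K L : lpc.

(* The iterated colimit: first over the cubes of [L], then over those of [K] *)
Definition tensor_obj (x : elt K) : lpc := tensor_left (elab x) L.
Definition tensor_arr (x x' : elt K) (f : elt_arr x x') :
  lhom (tensor_obj x) (tensor_obj x') := tensor_left_map (elt_arr_lab f) (lid L).

Definition tensor_diag : diagram := Diagram tensor_arr.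
Definition tensor : lpc := colim tensor_diag.
Definition tensor_in (x : elt K) : lhom (tensor_left (elab x) L) tensor :=
  cinj (D := tensor_diag) x.

Lemma tensor_inE (x x' : elt K) (f : elt_arr x x') n c :
  tensor_in x' n (tensor_left_map (elt_arr_lab f) (lid L) n c) = tensor_in x n c.
Proof. exact: (cinj_arr (D := tensor_diag) f). Qed.
End Tensor.

Section TensorMap.
Variables (K K' L L' : lpc) (h : lhom K K') (k : lhom L L').

Definition tensor_leg (x : elt K) : lhom (tensor_obj L x) (tensor K' L') :=
  lcomp (tensor_in L' (elt_map h x)) (tensor_left_map (elt_map_lab h x) k).

Lemma tensor_legP x x' (f : elt_arr x x') n c :
  tensor_leg x' n (tensor_arr L f n c) = tensor_leg x n c.
Proof.
rewrite !lcompE -(tensor_inE (elt_amap h f)); congr (tensor_in _ _ _ _).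
pose g : hcomp (elab (elt_map h x')) (box_map (sval f)) = elab x :=
  etrans (elt_arr_lab (elt_amap h f)) (etrans (esym (box_map_id _)) (elt_map_lab h x)).
rewrite (tensor_left_map_comp _ _ g (l := k)) //; try exact: bmap_eq; last exact: lhom_eq.
rewrite (tensor_left_map_comp _ _ g (l := k)) //; [exact: bmap_eq|exact: lhom_eq].
Qed.

Definition tensor_map : lhom (tensor K L) (tensor K' L') :=
  crec (D := tensor_diag K L) tensor_legP.

Lemma tensor_mapE x n c :
  tensor_map n (tensor_in L x n c)
  = tensor_in L' (elt_map h x) n (tensor_left_map (elt_map_lab h x) k n c).
Proof. exact: (crecE (D := tensor_diag K L)). Qed.
End TensorMap.

Lemma tensor_map_id K L : tensor_map (lid K) (lid L) = lid (tensor K L).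
Proof.
apply: colim_ext => x n c; rewrite [LHS]tensor_mapE.
have e : hcomp (emap (elt_map (lid K) x)) (box_map (bid (edim x))) = emap x.
  by rewrite box_map_id; apply: hom_eq.
have := @tensor_inE K L x (elt_map (lid K) x) (exist _ (bid (edim x)) e) n c.
move=> E; rewrite -[RHS]E; congr (tensor_in _ _ _ _).
exact: tensor_left_map_eq.
Qed.

Lemma tensor_map_comp K L K' L' K'' L'' (h : lhom K K') (k : lhom L L')
  (h' : lhom K' K'') (k' : lhom L' L'') :
  tensor_map (lcomp h' h) (lcomp k' k) = lcomp (tensor_map h' k') (tensor_map h k).
Proof.
apply: colim_ext => x n c; rewrite -[cinj _ _ _]/(tensor_in L x n c) lcompE.
rewrite !tensor_mapE.
have hP : hcomp (elab (elt_map h' (elt_map h x))) (box_map (bid (edim x))) = elab x.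
  by rewrite box_map_id; apply: hom_eq => m b; rewrite /= !lab_lhom.
rewrite (tensor_left_map_comp _ _ hP (l := lcomp k' k)) //; last exact: bmap_eq.
have e : hcomp (emap (elt_map h' (elt_map h x))) (box_map (bid (edim x)))
    = emap (elt_map (lcomp h' h) x).
  by rewrite box_map_id; apply: hom_eq.
have <- := @tensor_inE K'' L'' (elt_map (lcomp h' h) x) (elt_map h' (elt_map h x))
  (exist _ (bid (edim x)) e) n _.
congr (tensor_in _ _ _ _); rewrite (tensor_left_map_comp _ _ hP (l := lcomp k' k)) //.
  exact: bmap_eq.
exact: lhom_eq.
Qed.

Record cobj : Type := CObj { cl :> lpc; base : cl 0 }.

Record chom (K L : cobj) : Type := CHom {
  ch :> lhom K L;
  ch_base : ch 0 (base K) = base L }.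

Lemma chom_eq K L (h k : chom K L) : (forall n (x : K n), h n x = k n x) -> h = k.
Proof.
case: h k => [h hP] [k kP] /= /lhom_eq hk; case: _ / hk in kP *.
by rewrite (Prop_irrelevance hP kP).
Qed.

Lemma chom_lhom K L (h k : chom K L) : ch h = ch k -> h = k.
Proof. by move=> hk; apply: chom_eq => n x; rewrite hk. Qed.

Definition cid_hom K : chom K K := @CHom K K (lid K) erefl.

Lemma ccomp_subproof K L M (h : chom L M) (k : chom K L) :
  lcomp h k 0 (base K) = base M.
Proof. by rewrite lcompE !ch_base. Qed.

Definition ccomp K L M (h : chom L M) (k : chom K L) : chom K M :=
  CHom (ccomp_subproof h k).

Definition lcube n (w : sbang n) : lpc := LPC (char_map w).

Definition point : lpc := @lcube 0 [tuple].

Lemma pt_lab (K : lpc) (v : K 0) : hcomp (lab K) (char_map v) = lab point.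
Proof.
by apply: hom_eq => n f; rewrite /= hom_nat [lab K 0 v]tuple0.
Qed.

Definition pt (K : lpc) (v : K 0) : lhom point K := @LHom point K (char_map v) (pt_lab v).

Lemma pt_bid (K : lpc) (v : K 0) : pt v 0 (bid 0 : point 0) = v.
Proof. exact: act_id. Qed.

Lemma pt_lhom (K L : lpc) (h : lhom K L) (v : K 0) n (x : point n) :
  h n (pt v n x) = pt (h 0 v) n x.
Proof. exact: hom_nat. Qed.

Definition cnil : cobj := @CObj point (bid 0).

Definition cinit (K : cobj) : chom cnil K :=
  @CHom cnil K (pt (base K)) (pt_bid (base K)).

Section Prefix.
Variable a : lact.

Definition pre_cube : lpc := @lcube 1 [tuple a].
Definition pre_src : pre_cube 0 := bvertex [tuple false].
Definition pre_tgt : pre_cube 0 := bvertex [tuple true].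

Definition cpre (K : cobj) : cobj :=
  CObj (po_l (pt pre_tgt) (pt (base K)) 0 pre_src).

Section Map.
Variables (K L : cobj) (h : chom K L).

Lemma cpre_mapP n (x : point n) :
  po_l (pt pre_tgt) (pt (base L)) n (pt pre_tgt n x)
  = lcomp (po_r (pt pre_tgt) (pt (base L))) h n (pt (base K) n x).
Proof. by rewrite lcompE po_comm (pt_lhom h) ch_base. Qed.

Definition cpre_lmap : lhom (cpre K) (cpre L) := po_rec cpre_mapP.

Lemma cpre_lmap_base : cpre_lmap 0 (base (cpre K)) = base (cpre L).
Proof. exact: po_recl. Qed.

Definition cpre_map : chom (cpre K) (cpre L) := CHom cpre_lmap_base.
End Map.

Lemma cpre_map_id K : cpre_map (cid_hom K) = cid_hom (cpre K).
Proof.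
apply: chom_lhom; apply: po_ext => n x; first exact: po_recl.
exact: po_recr.
Qed.

Lemma cpre_map_comp K L M (h : chom L M) (k : chom K L) :
  cpre_map (ccomp h k) = ccomp (cpre_map h) (cpre_map k).
Proof.
apply: chom_lhom; apply: po_ext => n x; rewrite [RHS]lcompE.
  by rewrite !po_recl.
by rewrite !po_recr ?lcompE ?po_recr.
Qed.
End Prefix.

Section Sum.

(* In the category of objects with an initial state, the binary coproduct
   identifies the two initial states. *)
Definition csum (K L : cobj) : cobj :=
  CObj (po_l (pt (base K)) (pt (base L)) 0 (base K)).

Section Map.
Variables (K L K' L' : cobj) (h : chom K K') (k : chom L L').

Lemma csum_mapP n (x : point n) :
  lcomp (po_l (pt (base K')) (pt (base L'))) h n (pt (base K) n x)
  = lcomp (po_r (pt (base K')) (pt (base L'))) k n (pt (base L) n x).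
Proof. by rewrite !lcompE (pt_lhom h) (pt_lhom k) !ch_base po_comm. Qed.

Definition csum_lmap : lhom (csum K L) (csum K' L') := po_rec csum_mapP.

Lemma csum_lmap_base : csum_lmap 0 (base (csum K L)) = base (csum K' L').
Proof.
rewrite [LHS]po_recl -[LHS]/(po_l (pt (base K')) (pt (base L')) 0 (h 0 (base K))).
by rewrite ch_base.
Qed.

Definition csum_map : chom (csum K L) (csum K' L') := CHom csum_lmap_base.
End Map.

Lemma csum_map_id K L : csum_map (cid_hom K) (cid_hom L) = cid_hom (csum K L).
Proof.
apply: chom_lhom; apply: po_ext => n x; first exact: po_recl.
exact: po_recr.
Qed.

Lemma csum_map_comp K L K' L' K'' L'' (h : chom K K') (k : chom L L')
  (h' : chom K' K'') (k' : chom L' L'') :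
  csum_map (ccomp h' h) (ccomp k' k) = ccomp (csum_map h' k') (csum_map h k).
Proof.
apply: chom_lhom; apply: po_ext => n x; rewrite [RHS]lcompE.
  by rewrite !po_recl ?lcompE ?po_recl.
by rewrite !po_recr ?lcompE ?po_recr.
Qed.
End Sum.

Section Restriction.
Variable a : Sig.

Definition hidden (b : lact) : Prop :=
  sval b = a \/ sg (Act a) (Act (sval b)) <> Bot.

Definition nu_incl : hom (bang {b : lact | ~ hidden b}) sbang := bang_map sval.

Section Obj.
Variable K : cobj.

Definition nu_pcset : pcset := pullback (lab K) nu_incl.

Definition nu_lpc : lpc := @LPC nu_pcset (hcomp (lab K) (pb_fst (lab K) nu_incl)).

Lemma nu_base_subproof : lab K 0 (base K) = nu_incl 0 [tuple].
Proof. by rewrite [LHS]tuple0 [RHS]tuple0. Qed.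

Definition cnu : cobj :=
  @CObj nu_lpc (exist (fun xy : K 0 * _ => lab K 0 xy.1 = nu_incl 0 xy.2)
    (base K, [tuple]) nu_base_subproof).
End Obj.

Section Map.
Variables (K L : cobj) (h : chom K L).

Lemma nu_map_subproof n (x : nu_pcset K n) :
  lab L n (h n (sval x).1) = nu_incl n (sval x).2.
Proof. by rewrite lab_lhom (svalP x). Qed.

Definition nu_mapf n (x : nu_pcset K n) : nu_pcset L n :=
  exist (fun xy : L n * bang {b : lact | ~ hidden b} n =>
           lab L n xy.1 = nu_incl n xy.2)
    (h n (sval x).1, (sval x).2) (nu_map_subproof x).

Lemma nu_map_nat m n (f : bmap m n) (x : nu_pcset K n) :
  nu_mapf (act (nu_pcset K) f x) = act (nu_pcset L) f (nu_mapf x).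
Proof. by apply: eq_exist; rewrite /= hom_nat. Qed.

Lemma nu_map_lab : hcomp (lab (nu_lpc L)) (Hom nu_map_nat) = lab (nu_lpc K).
Proof. by apply: hom_eq => n x; rewrite /= lab_lhom. Qed.

Definition nu_lmap : lhom (cnu K) (cnu L) :=
  @LHom (nu_lpc K) (nu_lpc L) (Hom nu_map_nat) nu_map_lab.

Lemma nu_lmap_base : nu_lmap 0 (base (cnu K)) = base (cnu L).
Proof. by apply: eq_exist; rewrite /= ch_base. Qed.

Definition cnu_map : chom (cnu K) (cnu L) := CHom nu_lmap_base.
End Map.

Lemma cnu_map_id K : cnu_map (cid_hom K) = cid_hom (cnu K).
Proof. by apply: chom_eq => n [[x w] e]; apply: eq_exist. Qed.

Lemma cnu_map_comp K L M (h : chom L M) (k : chom K L) :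
  cnu_map (ccomp h k) = ccomp (cnu_map h) (cnu_map k).
Proof. by apply: chom_eq => n [[x w] e]; apply: eq_exist. Qed.
End Restriction.

Section Par.

Definition pair_in (K L : lpc) (x : hom (box 0) K) (z : hom (box 0) L) : tensor K L 0 :=
  tensor_in L (Elt x) 0
    (tl_in (elab (Elt x)) (Elt z) 0
      (seq_in (cosk_step (ct1 (elab (Elt x)) (elab (Elt z)))) 0 0
        (exist _ (bid 0) isT, exist _ (bid 0) isT))).

Lemma tensor_map_pair (K L K' L' : lpc) (h : lhom K K') (k : lhom L L')
  (x : hom (box 0) K) (z : hom (box 0) L) :
  tensor_map h k 0 (pair_in x z) = pair_in (hcomp h x) (hcomp k z).
Proof.
rewrite [LHS]tensor_mapE tensor_left_mapE cosk_mapE.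
congr (tensor_in _ _ _ (tl_in _ _ _ (seq_in _ _ _ _))).
by congr pair; apply: val_inj; apply: bmap_eq.
Qed.

Definition cpar (K L : cobj) : cobj := CObj (pair_in (pt (base K)) (pt (base L))).

Lemma pair_in_base (K L K' L' : cobj) (h : chom K K') (k : chom L L') :
  tensor_map h k 0 (base (cpar K L)) = base (cpar K' L').
Proof.
rewrite [LHS]tensor_map_pair; congr (pair_in _ _).
  by apply: hom_eq => n x; rewrite -(ch_base h) -pt_lhom.
by apply: hom_eq => n x; rewrite -(ch_base k) -pt_lhom.
Qed.

Definition cpar_map (K L K' L' : cobj) (h : chom K K') (k : chom L L') :
  chom (cpar K L) (cpar K' L') := @CHom (cpar K L) (cpar K' L') _ (pair_in_base h k).

Lemma cpar_map_id K L : cpar_map (cid_hom K) (cid_hom L) = cid_hom (cpar K L).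
Proof. by apply: chom_lhom; apply: tensor_map_id. Qed.

Lemma cpar_map_comp K L K' L' K'' L'' (h : chom K K') (k : chom L L')
  (h' : chom K' K'') (k' : chom L' L'') :
  cpar_map (ccomp h' h) (ccomp k' k) = ccomp (cpar_map h' k') (cpar_map h k).
Proof. by apply: chom_lhom; apply: tensor_map_comp. Qed.
End Par.

(* Process names with at most [n] free variables; [Rec] binds the variable
   [ord0] of its body, and the process names properly speaking are the closed
   terms, see [well_guarded]. The prefixes are restricted to the actions
   [a] with [sg a 0 = a]: [(a)] is a 1-cube of [sbang] only in this case. *)
Inductive proc (n : nat) : Type :=
| Nil
| Var of 'I_n
| Pre of lact & proc n
| Nu of Sig & proc n
| Sum of proc n & proc n
| Par of proc n & proc n
| Rec of proc n.+1.
Arguments Nil {n}.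

(* All the occurrences of [i] in [P] lie in a prefix term. *)
Fixpoint guarded n (P : proc n) : 'I_n -> bool :=
  match P with
  | Nil => fun=> true
  | Var j => fun i => i != j
  | Pre _ _ => fun=> true
  | Nu _ Q => guarded Q
  | Sum Q Q' | Par Q Q' => fun i => guarded Q i && guarded Q' i
  | Rec Q => fun i => guarded Q (lift ord0 i)
  end.

Fixpoint well_guarded n (P : proc n) : bool :=
  match P with
  | Nil | Var _ => true
  | Pre _ Q | Nu _ Q => well_guarded Q
  | Sum Q Q' | Par Q Q' => well_guarded Q && well_guarded Q'
  | Rec Q => guarded Q ord0 && well_guarded Q
  end.

Definition env (n : nat) : Type := 'I_n -> cobj.
Definition envhom n (r s : env n) : Type := forall i, chom (r i) (s i).
Definition env_id n (r : env n) : envhom r r := fun i => cid_hom (r i).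
Definition env_comp n (r s t : env n) (h : envhom s t) (k : envhom r s) :
  envhom r t := fun i => ccomp (h i) (k i).

Definition env_cons n (K : cobj) (r : env n) : env n.+1 :=
  fun i => if unlift ord0 i is Some j then r j else K.

Definition envhom_cons n (K L : cobj) (r s : env n) (h : chom K L) (k : envhom r s) :
    envhom (env_cons K r) (env_cons L s) :=
  fun i => match unlift ord0 i as o return
      chom (if o is Some j then r j else K) (if o is Some j then s j else L) with
    | Some j => k j
    | None => h
    end.

Lemma envhom_cons_id n (K : cobj) (r : env n) :
  envhom_cons (cid_hom K) (env_id r) = env_id (env_cons K r).
Proof.
apply: functional_extensionality_dep => i; rewrite /envhom_cons /env_id /env_cons.
by case: unlift.
Qed.

Lemma envhom_cons_comp n (K L M : cobj) (r s t : env n) (h : chom L M) (k : chom K L)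
  (u : envhom s t) (v : envhom r s) :
  envhom_cons (ccomp h k) (env_comp u v)
  = env_comp (envhom_cons h u) (envhom_cons k v).
Proof.
apply: functional_extensionality_dep => i; rewrite /envhom_cons /env_comp /env_cons.
by case: unlift.
Qed.

Record functor (n : nat) : Type := Functor {
  fobj :> env n -> cobj;
  fmap : forall r s, envhom r s -> chom (fobj r) (fobj s);
  fmap_id : forall r, fmap (env_id r) = cid_hom (fobj r);
  fmap_comp : forall r s t (h : envhom s t) (k : envhom r s),
    fmap (env_comp h k) = ccomp (fmap h) (fmap k) }.
Arguments fmap {n} F {r s} h : rename.

Program Definition Fnil n : functor n :=
  @Functor n (fun=> cnil) (fun _ _ _ => cid_hom cnil) _ _.
Next Obligation. exact: chom_eq. Qed.

Program Definition Fvar n (i : 'I_n) : functor n :=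
  @Functor n (fun r => r i) (fun _ _ h => h i) _ _.

Program Definition Fpre n (a : lact) (F : functor n) : functor n :=
  @Functor n (fun r => cpre a (F r)) (fun _ _ h => cpre_map a (fmap F h)) _ _.
Next Obligation. by rewrite fmap_id cpre_map_id. Qed.
Next Obligation. by rewrite fmap_comp cpre_map_comp. Qed.

Program Definition Fnu n (a : Sig) (F : functor n) : functor n :=
  @Functor n (fun r => cnu a (F r)) (fun _ _ h => cnu_map a (fmap F h)) _ _.
Next Obligation. by rewrite fmap_id cnu_map_id. Qed.
Next Obligation. by rewrite fmap_comp cnu_map_comp. Qed.

Program Definition Fsum n (F G : functor n) : functor n :=
  @Functor n (fun r => csum (F r) (G r))
    (fun _ _ h => csum_map (fmap F h) (fmap G h)) _ _.
Next Obligation. by rewrite !fmap_id csum_map_id. Qed.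
Next Obligation. by rewrite !fmap_comp csum_map_comp. Qed.

Program Definition Fpar n (F G : functor n) : functor n :=
  @Functor n (fun r => cpar (F r) (G r))
    (fun _ _ h => cpar_map (fmap F h) (fmap G h)) _ _.
Next Obligation. by rewrite !fmap_id cpar_map_id. Qed.
Next Obligation. by rewrite !fmap_comp cpar_map_comp. Qed.

Section Rec.
Variables (n : nat) (F : functor n.+1).

Section Obj.
Variable r : env n.

Definition rec_fun (K : cobj) : cobj := F (env_cons K r).
Definition rec_fmap (K L : cobj) (h : chom K L) : chom (rec_fun K) (rec_fun L) :=
  fmap F (envhom_cons h (env_id r)).

Definition rec_obj (k : nat) : cobj := iter k rec_fun cnil.

Fixpoint rec_step (k : nat) : chom (rec_obj k) (rec_obj k.+1) :=
  match k return chom (rec_obj k) (rec_obj k.+1) with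
  | 0 => cinit (rec_obj 1)
  | k'.+1 => rec_fmap (rec_step k')
  end.

Definition crecur : cobj :=
  CObj (seq_in (X := fun k => rec_obj k) (fun k => rec_step k) 0 0 (base cnil)).
End Obj.

Section Map.
Variables (r s : env n) (h : envhom r s).

Fixpoint rec_objm (k : nat) : chom (rec_obj r k) (rec_obj s k) :=
  match k return chom (rec_obj r k) (rec_obj s k) with
  | 0 => cid_hom cnil
  | k'.+1 => fmap F (envhom_cons (rec_objm k') h)
  end.

Lemma env_comp_idl (t u : env n) (g : envhom t u) : env_comp (env_id u) g = g.
Proof. by apply: functional_extensionality_dep => i; apply: chom_eq. Qed.
Lemma env_comp_idr (t u : env n) (g : envhom t u) : env_comp g (env_id t) = g.
Proof. by apply: functional_extensionality_dep => i; apply: chom_eq. Qed.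

Lemma rec_objm_step k :
  ccomp (rec_objm k.+1) (rec_step r k) = ccomp (rec_step s k) (rec_objm k).
Proof.
elim: k => [|k IHk].
  apply: chom_eq => m x; rewrite /= /cinit.
  exact: etrans (pt_lhom _ _ _) (congr1 (fun v => pt v m x) (ch_base _)).
rewrite -[rec_step r k.+1]/(rec_fmap r (rec_step r k)).
rewrite -[rec_step s k.+1]/(rec_fmap s (rec_step s k)).
rewrite /rec_fmap -[LHS]fmap_comp -[RHS]fmap_comp -!envhom_cons_comp IHk.
by rewrite env_comp_idl env_comp_idr.
Qed.

Lemma rec_objm_stepE k m (x : rec_obj r k m) :
  rec_objm k.+1 m (rec_step r k m x) = rec_step s k m (rec_objm k m x).
Proof. exact: (congr1 (fun g : chom _ _ => g m x) (rec_objm_step k)). Qed.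

Definition crecur_lmap : lhom (crecur r) (crecur s) :=
  seq_lim_map (h := fun k => rec_objm k) rec_objm_stepE.

Lemma crecur_lmap_base : crecur_lmap 0 (base (crecur r)) = base (crecur s).
Proof. exact: (seq_lim_mapE rec_objm_stepE (i := 0)). Qed.

Definition crecur_map : chom (crecur r) (crecur s) := CHom crecur_lmap_base.
End Map.

Lemma rec_objm_id r k : rec_objm (env_id r) k = cid_hom (rec_obj r k).
Proof. by elim: k => //= k ->; rewrite envhom_cons_id fmap_id. Qed.

Lemma rec_objm_comp r s t (h : envhom s t) (g : envhom r s) k :
  rec_objm (env_comp h g) k = ccomp (rec_objm h k) (rec_objm g k).
Proof.
elim: k => [|k /= ->]; first exact: chom_eq.
by rewrite envhom_cons_comp fmap_comp.
Qed.

Lemma crecur_map_id r : crecur_map (env_id r) = cid_hom (crecur r).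
Proof.
apply: chom_lhom; apply: seq_ext => i m x.
by rewrite [LHS](seq_lim_mapE (rec_objm_stepE (env_id r))) rec_objm_id.
Qed.

Lemma crecur_map_comp r s t (h : envhom s t) (g : envhom r s) :
  crecur_map (env_comp h g) = ccomp (crecur_map h) (crecur_map g).
Proof.
apply: chom_lhom; apply: seq_ext => i m x; rewrite [RHS]lcompE.
rewrite [LHS](seq_lim_mapE (rec_objm_stepE (env_comp h g))).
rewrite (seq_lim_mapE (rec_objm_stepE g)) (seq_lim_mapE (rec_objm_stepE h)).
by rewrite rec_objm_comp.
Qed.

Definition Frec : functor n := Functor crecur_map_id crecur_map_comp.
End Rec.

Fixpoint interp n (P : proc n) : functor n :=
  match P with
  | Nil => Fnil n
  | Var i => Fvar i
  | Pre a Q => Fpre a (interp Q)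
  | Nu a Q => Fnu a (interp Q)
  | Sum Q Q' => Fsum (interp Q) (interp Q')
  | Par Q Q' => Fpar (interp Q) (interp Q')
  | Rec Q => Frec (interp Q)
  end.

(* A closed term does not depend on the environment. *)
Definition interp0 (P : proc 0) : cobj := interp P (fun=> cnil).

End Labelled.

(* Main.v *)
Require Import Defs.
From Stdlib Require Import Eqdep_dec Relation_Operators.
From mathcomp Require Import all_boot.
From mathcomp Require Import boolp.

(** A map from [box n.+2] is a cube of dimension [n.+2], and the restriction of
    the map to the boundary gives the faces of the cube. So the theorem says that
    in the interpretation of a process a cube of dimension at least 2 is
    determined by its faces: the interpretation is [separated].

    The proof is by induction on the process, but separation alone is not
    inductive. If [L] has squares [y] and [y'] such that the boundary of [y'] is
    the transpose of the boundary of [y], and if [x] is an edge of [K] that can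
    synchronize with the edges of [y] in one direction, then [x] can synchronize
    with that direction of [y] or with the corresponding direction of [y']. Both
    squares of the tensor product are non-twisted, they have the same faces, and
    they are distinct. The induction hypothesis therefore says also that there
    are no such squares: the interpretation is [asymmetric]. Non-twistedness is
    what makes asymmetry pass to tensor products, since it puts the
    directions in which the left factor moves before all the others.

    Tensor products. A cube of the coskeleton that defines the product of two
    labelled cubes is determined by its vertices ([cube_tensor_vseparated]), and
    it comes from the product of two faces as soon as its vertices do
    ([cube_tensor_lift]). On the other hand, a map between sets of vertices
    factors in at most one way as a map of cubes after a map none of whose
    coordinates is constant ([factor_unique]). Hence each [n]-cube of [tensor K L]
    has a unique normal form ([nf], [nf_inj]): a cube [x] of [K], a cube [z] of
    [L], and two maps that select coordinates of [vert n], which tell in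
    which of the [n] directions [x] and [z] move. The faces of a cube can be read
    on its normal form, and it remains to compare selections of coordinates
    ([pcube_separated], [pcube_asymmetric]).

    The other operations. Prefixing and sums glue two precubical sets at one
    vertex, which adds no cube of positive dimension; a restriction is a part of
    the given precubical set. Recursion is a sequential colimit, and the two
    properties pass to it when the transition maps are injective. So one also
    needs that all the operations preserve injective maps ([interp_inj]); for
    tensor products this can be read again on normal forms. *)

Set Implicit Arguments.
Unset Strict Implicit.
Unset Printing Implicit Defensive.

(** * Maps of cubes *)

Definition vtail n (e : vert n.+1) : vert n := [tuple of behead e].

Lemma vtail_cons n b (e : vert n) : vtail (vcons b e) = e.
Proof. exact: val_inj. Qed.

Lemma vcons_eta n (e : vert n.+1) : e = vcons (thead e) (vtail e).
Proof. exact: tuple_eta. Qed.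

Lemma vcons_inj n a b (u v : vert n) : vcons a u = vcons b v -> a = b /\ u = v.
Proof. by move=> E; have := congr1 val E => -[-> /val_inj->]. Qed.

Lemma tnth_thead n (e : vert n.+1) : tnth e ord0 = thead e.
Proof. by []. Qed.

Lemma tnth_vtail n (e : vert n.+1) i : tnth (vtail e) i = tnth e (lift ord0 i).
Proof. by rewrite !(tnth_nth false) /= nth_behead. Qed.

Lemma vcat_cons p q a (u : vert p) (v : vert q) :
  vcat (vcons a u) v = vcons a (vcat u v) :> vert (p + q).+1.
Proof. exact: val_inj. Qed.

Lemma vcat_inj p q (u u' : vert p) (v v' : vert q) :
  vcat u v = vcat u' v' -> u = u' /\ v = v'.
Proof.
by move=> E; split; [rewrite -(vfst_cat u v)|rewrite -(vsnd_cat u v)];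
  rewrite E ?vfst_cat ?vsnd_cat.
Qed.

Definition bfix m n b (g : bmap m n) : bmap m n.+1 := bcomp (bdelta ord0 b) g.
Lemma bfixE m n b (g : bmap m n) e : bfix b g e = vcons b (g e).
Proof. by apply: val_inj; rewrite /= take0 drop0. Qed.

Definition bfree m n (g : bmap m n) : bmap m.+1 n.+1 := BMap (is_box_cons (bmapP g)).
Lemma bfreeE m n (g : bmap m n) e : bfree g e = vcons (thead e) (g (vtail e)).
Proof. by []. Qed.

(** A map of cubes is a word that tells, for each coordinate of the target, whether
    it is fixed or free; the next two predicates give the first letter of this
    word, and [box_head] allows inductions on the target. *)
Definition head_fixed m n (f : vert m -> vert n.+1) : Prop :=
  exists a (g : bmap m n), forall e, f e = vcons a (g e).

Definition head_free m n : (vert m -> vert n.+1) -> Prop :=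
  match m with
  | 0 => fun=> False
  | m'.+1 => fun f => exists g : bmap m' n, forall e, f e = vcons (thead e) (g (vtail e))
  end.

Lemma box_head m n (f : bmap m n.+1) : head_fixed f \/ head_free f.
Proof.
suff H m' n' (g : vert m' -> vert n') : is_box g ->
    match n' return (vert m' -> vert n') -> Prop with
    | 0 => fun=> True
    | n0.+1 => fun g => head_fixed g \/ head_free g
    end g by exact: (H _ _ _ (bmapP f)).
elim=> {m n f m' n' g} [[|n]|n i a|m n [|p] f g fP IHf gP IHg] //.
- by right; exists (bid n) => e; exact: vcons_eta.
- case: (unliftP ord0 i) => [k ->|->].
    case: n i k => [|n] i k; first by case: k.
    right; exists (bdelta k a) => e; apply: val_inj.
    by case/tupleP: e => b e; rewrite /= theadE.
  by left; exists a, (bid n) => e; apply: val_inj; rewrite /= take0 drop0.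
- case: IHf => [[a [f' fE]]|].
    by left; exists a, (bcomp f' (BMap gP)) => e; rewrite /= fE.
  case: n f fP g gP IHg => [|n] f fP g gP //= IHg [f' fE].
  case: IHg => [[a [g' gE]]|].
    by left; exists a, (bcomp f' g') => e; rewrite /= fE gE theadE vtail_cons.
  case: m g gP => [|m] g gP //= [g' gE]; right; exists (bcomp f' g') => e.
  by rewrite /= fE gE theadE vtail_cons.
Qed.

Lemma bmap_endo n (f : bmap n n) : f = bid n.
Proof.
apply: bmap_eq => e; elim: n f e => [|n IHn] f e; first by rewrite [LHS]tuple0 [RHS]tuple0.
case: (box_head f) => [[a [g _]]|[g fE]]; first by have := bmap_le g; rewrite ltnn.
by rewrite fE IHn /= -vcons_eta.
Qed.

Lemma bmap_inj m n (f : bmap m n) : injective f.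
Proof. by move=> e e' E; apply: eq_from_tnth => i; rewrite -!(tnth_dir f) E. Qed.

(** The coordinates of [h] may copy one another, but none is constant; this is what
    makes the factorizations through maps of cubes below unique. *)
Definition varying m n (h : vert m -> vert n) : Prop :=
  forall j b, exists e, tnth (h e) j = b.

Lemma varying_tail m n (h : vert m -> vert n.+1) :
  varying h -> varying (fun e => vtail (h e)).
Proof. by move=> hv j b; have [e <-] := hv (lift ord0 j) b; exists e; rewrite tnth_vtail. Qed.

(** A coordinate fixed by [F] is constant along [psi \o s], so that [psi] fixes it
    too, because [s] is varying. Hence [psi] factors through [F]. *)
Lemma box_lift m p' p r (F : bmap p' p) (psi : bmap r p) (s : vert m -> vert r)
    (h : vert m -> vert p') :
  varying s -> (forall e, F (h e) = psi (s e)) ->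
  exists g : bmap r p', psi = bcomp F g /\ forall e, h e = g (s e).
Proof.
elim: p p' r F psi s h => [|p IHp] p' r F psi s h sv E.
  have := bmap_le F; have := bmap_le psi; rewrite !leqn0 => /eqP r0 /eqP p0.
  move: F psi s h sv E; rewrite r0 p0 => F psi s h _ _; exists (bid 0); split=> [|e].
    by apply: bmap_eq => e; rewrite [LHS]tuple0 [RHS]tuple0.
  by rewrite [LHS]tuple0 [RHS]tuple0.
pose e0 : vert m := [tuple false | _ < m].
case: (box_head F) (box_head psi) => [[a [F' FE]]|HF] [[b [psi' pE]]|Hp].
- have [|g [gE hE]] := IHp _ _ F' psi' s h sv.
    by move=> e; have := E e; rewrite FE pE => /vcons_inj[].
  exists g; split=> //; apply: bmap_eq => e /=; rewrite pE gE FE.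
  by have := E e0; rewrite FE pE => /vcons_inj[->].
- case: r psi s sv E Hp => [|r] psi s sv E //= [psi' pE].
  have [e eE] := sv ord0 (~~ a).
  by have := E e; rewrite FE pE => /vcons_inj[aE]; move: eE; rewrite tnth_thead -aE; case: (a).
- case: p' F h E HF => [|p'] F h E //= [F' FE].
  have [|g [gE hE]] := IHp _ _ F' psi' s (fun e => vtail (h e)) sv.
    by move=> e; have := E e; rewrite FE pE => /vcons_inj[].
  exists (bfix b g); split=> [|e].
    apply: bmap_eq => e; rewrite pE gE -[RHS]/(F (bfix b g e)) FE bfixE.
    by rewrite theadE vtail_cons.
  rewrite bfixE -hE [LHS]vcons_eta; congr vcons.
  by have := E e; rewrite FE pE => /vcons_inj[].
- case: p' F h E HF => [|p'] F h E //= [F' FE].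
  case: r psi s sv E Hp => [|r] psi s sv E //= [psi' pE].
  have [|g [gE hE]] := IHp _ _ F' psi' _ (fun e => vtail (h e)) (varying_tail sv).
    by move=> e; have := E e; rewrite FE pE => /vcons_inj[].
  exists (bfree g); split=> [|e].
    by apply: bmap_eq => e; rewrite /= pE gE FE theadE vtail_cons.
  rewrite bfreeE -hE [LHS]vcons_eta; congr vcons.
  by have := E e; rewrite FE pE => /vcons_inj[].
Qed.

(** By [box_lift] each of [f] and [f'] factors through the other, and the only map
    from a cube to itself is the identity. The function [G] avoids the statement
    of an equality between maps whose types differ. *)
Lemma factor_unique m p (Z : Type)
    (G : forall a, bmap a p -> (vert m -> vert a) -> Z)
    a b (f : bmap a p) (f' : bmap b p) (s : vert m -> vert a) (s' : vert m -> vert b) :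
  varying s -> varying s' -> (forall e, f (s e) = f' (s' e)) -> G a f s = G b f' s'.
Proof.
move=> sv sv' E; have [g [f'E sE]] := box_lift sv' E.
have [g' _] := box_lift sv (fun e => esym (E e)).
have eab : a = b by apply/eqP; rewrite eqn_leq !bmap_le.
case: _ / eab in f' s' sv' E g f'E sE *.
have -> : f' = f by rewrite f'E (bmap_endo g); apply: bmap_eq.
by congr G; apply: funext => e; rewrite sE (bmap_endo g).
Qed.

(** The coordinates of [psi] are cut in two at [p], and the free ones are numbered
    again on each side. *)
Lemma box_split m p q r (psi : bmap r (p + q)) (s : vert m -> vert r) : varying s ->
  exists r1 r2 (f : bmap r1 p) (g : bmap r2 q) (s1 : vert m -> vert r1) (s2 : vert m -> vert r2),
  [/\ varying s1, varying s2 & forall e, psi (s e) = vcat (f (s1 e)) (g (s2 e))].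
Proof.
elim: p r psi s => [|p IHp] r psi s sv.
  exists 0, r, (bid 0), psi, (fun=> [tuple]), s; split=> // [[]|e] //.
  exact: val_inj.
case: (box_head psi) => [[a [psi' pE]]|Hp].
  have [r1 [r2 [f [g [s1 [s2 [s1v s2v E]]]]]]] := IHp _ psi' s sv.
  exists r1, r2, (bfix a f), g, s1, s2; split=> // e.
  by rewrite pE E bfixE vcat_cons.
case: r psi s sv Hp => [|r] psi s sv //= [psi' pE].
have [r1 [r2 [f [g [s1 [s2 [s1v s2v E]]]]]]] := IHp _ psi' _ (varying_tail sv).
exists r1.+1, r2, (bfree f), g, (fun e => vcons (thead (s e)) (s1 e)), s2; split=> //.
  move=> j b; case: (unliftP ord0 j) => [k ->|->].
    by have [e <-] := s1v k b; exists e; rewrite -tnth_vtail vtail_cons.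
  by have [e <-] := sv ord0 b; exists e.
by move=> e; rewrite pE E -vcat_cons bfreeE theadE vtail_cons.
Qed.

Definition sel m n (w : 'I_n -> 'I_m) (e : vert m) : vert n := [tuple tnth e (w k) | k < n].

Lemma sel_varying m n (w : 'I_n -> 'I_m) : varying (sel w).
Proof. by move=> j b; exists [tuple b | _ < m]; rewrite !tnth_mktuple. Qed.

Lemma sel_inj m n (w w' : 'I_n -> 'I_m) : sel w = sel w' -> w = w'.
Proof.
move=> E; apply: funext => j.
have := congr1 (fun f => tnth (f [tuple i == w j | i < m]) j) E.
by rewrite !tnth_mktuple eqxx => /esym/eqP.
Qed.

Lemma varying_id n : varying (fun e : vert n => e).
Proof. by move=> j b; exists [tuple b | _ < n]; rewrite tnth_mktuple. Qed.

(** The first [m] entries of the list are distinct, so each of them is a first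
    occurrence. As the first occurrences of 0, 1, 2, .. come in this order, these
    entries can only be 0, .., [m.-1]. *)
Lemma first_occurrences n m (w : 'I_m -> 'I_n) (t : seq 'I_n) :
  injective w ->
  (forall i j : 'I_n, j = i.+1 :> nat ->
     index i (map w (enum 'I_m) ++ t) < index j (map w (enum 'I_m) ++ t)) ->
  forall k, w k = k :> nat.
Proof.
move=> w_inj s_ord; set s := _ ++ t in s_ord *.
have mono (i j : 'I_n) : i < j -> index i s < index j s.
  move=> lt_ij; have [d] : exists d, i.+1 + d = j by exists (j - i.+1); rewrite subnKC.
  elim: d j {lt_ij} => [|d IHd] j jE.
    by apply: s_ord; rewrite -jE addn0.
  have lt_n : i.+1 + d < n by rewrite -addnS jE ltnW.
  apply: (ltn_trans (IHd (Ordinal lt_n) erefl)); apply: s_ord.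
  by rewrite -jE addnS.
have index_w k : index (w k) s = k.
  by rewrite index_cat map_f ?mem_enum // index_map // index_enum_ord.
move=> k; have [N] := ubnP k; elim: N k => // N IHN k le_kN.
case: (ltngtP (w k) k) => // [lt_wk|lt_kw].
  have lt_wm := ltn_trans lt_wk (ltn_ord k).
  have wE : w (Ordinal lt_wm) = w k by apply: val_inj; apply: IHN; exact: leq_trans lt_wk le_kN.
  by have := congr1 val (w_inj _ _ wE) => /= E; rewrite E ltnn in lt_wk.
pose k' := Ordinal (ltn_trans lt_kw (ltn_ord (w k))).
have lt_i : index k' s < k by rewrite -[X in _ < X]index_w; apply: mono.
have lt_im := ltn_trans lt_i (ltn_ord k).
have wE : w (Ordinal lt_im) = k'.
  have kin : k' \in s.
    by rewrite -index_mem (leq_trans lt_im) // /s size_cat size_map size_enum_ord leq_addr.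
  rewrite -[RHS](nth_index k' kin) /s nth_cat size_map size_enum_ord lt_im.
  by rewrite (nth_map k) ?size_enum_ord //; congr w; apply: val_inj; rewrite /= nth_enum_ord.
have := IHN (Ordinal lt_im) (leq_trans lt_i le_kN).
by rewrite wE /= => E; move: lt_i; rewrite -E ltnn.
Qed.

Lemma line_ex n (i : 'I_n) : exists u : bmap 1 n, forall e, tnth (u e) i = thead e.
Proof.
elim: n i => [[]|n IHn] // i; case: (unliftP ord0 i) => [k ->|->].
  by have [u uE] := IHn k; exists (bfix false u) => e; rewrite bfixE -tnth_vtail vtail_cons.
by exists (bfree (bvertex [tuple false | _ < n])) => e; rewrite bfreeE tnth_thead theadE.
Qed.

Lemma varying_vcat n p q (s1 : vert n -> vert p) (s2 : vert n -> vert q) :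
  varying s1 -> varying s2 -> varying (fun e => vcat (s1 e) (s2 e)).
Proof.
move=> v1 v2 j b; case: (split_ordP j) => k ->.
  by have [e <-] := v1 k b; exists e; apply: tnth_lshift.
by have [e <-] := v2 k b; exists e; apply: tnth_rshift.
Qed.

Lemma bmap1_nonconst n (f : bmap 1 n) u : ~ (forall e, f e = u).
Proof.
move=> H; have := H [tuple false]; rewrite -(H [tuple true]) => /bmap_inj E.
by have := congr1 (fun t : vert 1 => thead t) E; rewrite !theadE.
Qed.

Definition thin n (h : vert 1 -> vert n) : Prop := forall j j',
  tnth (h [tuple false]) j != tnth (h [tuple true]) j ->
  tnth (h [tuple false]) j' != tnth (h [tuple true]) j' -> j = j'.

Lemma thin_bmap n (f : bmap 1 n) : thin f.
Proof.
have H j : tnth (f [tuple false]) j != tnth (f [tuple true]) j -> j = dir f ord0.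
  case: ((box_coords (bmapP f)).1 j) => [[a fa]|[i]]; first by rewrite !fa eqxx.
  by rewrite dirP [i]ord1 => /eqP.
by move=> j j' /H-> /H->.
Qed.

Lemma thin_const n (u : vert n) : thin (fun=> u).
Proof. by move=> j j'; rewrite eqxx. Qed.

(** * Cubes determined by their faces *)

Definition separated (K : pcset) : Prop := forall n (x x' : K n.+2),
  (forall i a, face i a x = face i a x') -> x = x'.

(** The case [x' = x] counts: a square whose boundary is its own transpose is
    excluded as well. *)
Definition asymmetric (K : pcset) : Prop := forall x x' : K 2,
  ~ (forall a, face ord0 a x = face ord_max a x' /\ face ord_max a x = face ord0 a x').

Lemma hom_face K L (h : hom K L) n (i : 'I_n.+1) a (x : K n.+1) :
  h n (face i a x) = face i a (h n.+1 x).
Proof. exact: hom_nat. Qed.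

Lemma hom_box n K (h : hom (box n) K) m (f : box n m) : h m f = act K f (h n (bid n)).
Proof. by rewrite -hom_nat; congr (h m _); apply: bmap_eq. Qed.

Lemma hom_box_ext n K (h k : hom (box n) K) : h n (bid n) = k n (bid n) -> h = k.
Proof. by move=> E; apply: hom_eq => m f; rewrite (hom_box h) (hom_box k) E. Qed.

Lemma hom_box_separated n K (h k : hom (box n.+2) K) : separated K ->
  hcomp h (bd_incl n.+2) = hcomp k (bd_incl n.+2) -> h = k.
Proof.
move=> sK E; apply/hom_box_ext/sK => i a; rewrite -!hom_face.
pose b : bd n.+2 n.+1 := exist _ (face i a (bid n.+2 : box n.+2 n.+2)) (ltnSn _).
exact: (congr1 (fun g : hom (bd n.+2) K => g n.+1 b) E).
Qed.

(** A word of length at least 2 can be recovered from the words obtained by deletion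
    of one letter. *)
Lemma bang_separated T : separated (bang T).
Proof.
move=> n w w' E; apply: eq_from_tnth => j.
have [i ij] : exists i : 'I_n.+2, i != j.
  case: (eqVneq j ord0) => [->|]; first by exists ord_max.
  by rewrite eq_sym; exists ord0.
have [k ->] := unlift_some ij.
by have := congr1 (fun u : n.+1.-tuple T => tnth u k) (E i false); rewrite !tnth_mktuple !dir_delta.
Qed.

(** * Sequential colimits *)

Definition injective_hom (K L : pcset) (h : hom K L) : Prop :=
  forall n, injective (fun x => h n x).

Lemma existT_nat_inj (X : nat -> Type) n (x x' : X n) :
  existT X n x = existT X n x' -> x = x'.
Proof. exact: (inj_pair2_eq_dec nat (@eq_comparable nat)). Qed.

Section Chain.
Variables (X : nat -> Type) (t : forall n, X n -> X n.+1).
Hypothesis t_inj : forall n, injective (@t n).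

Definition chain_step (a : {n & X n}) : {n & X n} := existT X (projT1 a).+1 (t (projT2 a)).

Lemma chain_step_inj : injective chain_step.
Proof.
move=> [i x] [j y] E; have eij : i = j := succn_inj (congr1 (@projT1 _ _) E).
by case: _ / eij in y E *; have [/= /(existT_nat_inj (X := X))/t_inj->] := E.
Qed.

Lemma iter_chain_step d a : projT1 (iter d chain_step a) = projT1 a + d.
Proof. by elim: d => [|d IHd]; rewrite ?addn0 // iterS addnS -IHd. Qed.

(** Equal elements of the colimit become equal after finitely many steps, possibly
    in different numbers; the index counts the steps, so these numbers agree. *)
Lemma chain_meet_inj i (x x' : X i) d d' :
  iter d chain_step (existT X i x) = iter d' chain_step (existT X i x') -> x = x'.
Proof.
move=> E; have := congr1 (@projT1 _ _) E; rewrite !iter_chain_step => /addnI ed.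
rewrite -ed in E; apply: (existT_nat_inj (X := X)); elim: d E {ed} => // d IHd.
by rewrite !iterS => /chain_step_inj.
Qed.
End Chain.

Section Seqlim.
Variables (Sig : Type) (sg : sync_alg Sig).
Variables (X : nat -> lpc sg) (t : forall n, lhom (X n) (X n.+1)).

Lemma seq_in_lift i d n (x : X i n) :
  exists y : X (i + d) n, seq_in t (i + d) n y = seq_in t i n x.
Proof.
elim: d => [|d [y yE]]; first by rewrite addn0; exists x.
by rewrite addnS; exists (t (i + d) n y); rewrite seq_in_step.
Qed.

Lemma seq_in_lift_le i k n (x : X i n) :
  i <= k -> exists y : X k n, seq_in t k n y = seq_in t i n x.
Proof. by move=> le_ik; rewrite -(subnKC le_ik); apply: seq_in_lift. Qed.

Lemma seq_common n (c c' : seqlim t n) :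
  exists k (x x' : X k n), c = seq_in t k n x /\ c' = seq_in t k n x'.
Proof.
move: c c'; apply: (@colimW _ _ (seq_diag t)) => i x; apply: (@colimW _ _ (seq_diag t)) => j x'.
have [y yE] := seq_in_lift_le x (leq_maxl i j).
have [y' yE'] := seq_in_lift_le x' (leq_maxr i j).
by exists (maxn i j), y, y'; split; [rewrite yE | rewrite yE'].
Qed.

Hypothesis t_inj : forall n, injective_hom (t n).

(** The steps form a function, so that its zigzags reduce to two forward paths that
    meet. *)
Lemma seq_in_inj i : injective_hom (seq_in t i).
Proof.
move=> n x x'; pose st := @chain_step (fun i => X i n) (fun i => t i n).
suff meet a b : clos_refl_sym_trans _ (@cgen _ _ (seq_diag t) n) a b ->
    exists d d', iter d st a = iter d' st b.
  move=> /qclP/meet[d [d']]; apply: chain_meet_inj => j.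
  exact: t_inj.
elim=> {a b} [a b [j k [l] y]|a|a b _ [d [d' E]]|a b c _ [d1 [d1' E1]] _ [d2 [d2' E2]]].
- by exists 1, 0.
- by exists 0, 0.
- by exists d', d.
- exists (d2 + d1), (d1' + d2').
  by rewrite iterD E1 -iterD addnC iterD E2 -iterD.
Qed.

Lemma seqlim_separated : (forall i, separated (X i)) -> separated (seqlim t).
Proof.
move=> sX n c c'; have [k [x [x' [-> ->]]]] := seq_common c c' => H.
congr (seq_in _ _ _ _); apply: sX => i a; apply: (@seq_in_inj k).
by rewrite !hom_face H.
Qed.

Lemma seqlim_asymmetric : (forall i, asymmetric (X i)) -> asymmetric (seqlim t).
Proof.
move=> aX c c'; have [k [x [x' [-> ->]]]] := seq_common c c' => H.
apply: (aX k x x') => a; split; apply: (@seq_in_inj k); rewrite !hom_face.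
  exact: (H a).1.
exact: (H a).2.
Qed.
End Seqlim.

Lemma seq_lim_map_inj (Sig : Type) (sg : sync_alg Sig) (X Y : nat -> lpc sg)
    (t : forall n, lhom (X n) (X n.+1)) (u : forall n, lhom (Y n) (Y n.+1))
    (h : forall n, lhom (X n) (Y n))
    (hP : forall n m (x : X n m), h n.+1 m (t n m x) = u n m (h n m x)) :
  (forall n, injective_hom (u n)) -> (forall n, injective_hom (h n)) ->
  injective_hom (seq_lim_map hP).
Proof.
move=> ui hi n c c'; have [k [x [x' [-> ->]]]] := seq_common c c'.
by rewrite !(seq_lim_mapE hP) => /(seq_in_inj ui)/hi->.
Qed.

(** * Vertices of the cubes of a coskeleton *)

Arguments vtx {Sig sg r} v _.

Section VertexMaps.
Variables (Sig : Type) (sg : sync_alg Sig).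
Implicit Types r p q : nat.

(** The action of a cube on the vertices, as a map between vertices of standard
    cubes. In the coskeletons used below it determines the cube. *)
Definition vmap r (K : vlpc sg r) n (c : K n) : vert n -> vert r :=
  fun e => vtx K (act K (bvertex e) c).
Arguments vmap {r} K {n} c e.

Lemma vmap_act r (K : vlpc sg r) m n (f : bmap m n) (c : K n) e :
  vmap K (act K f c) e = vmap K c (f e).
Proof. by rewrite /vmap -act_comp; congr (vtx K (act K _ c)); apply: bmap_eq. Qed.

Definition vseparated r (K : vlpc sg r) : Prop :=
  forall m (c c' : K m), vmap K c =1 vmap K c' -> c = c'.

Definition dim_le (K : pcset) d : Prop := forall m (c : K m), m <= d.

Section Attach.
Variables (r n : nat) (K : vlpc sg r).

(** A proper face of a cell lies on its boundary, so that it comes from [K]. *)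
Lemma att_split m (c : attach n K m) :
  (exists x, c = att_in n K m x)
  \/ (exists (s : shell n K) (u : box n.+1 m), m = n.+1 /\ c = att_in_cell s u).
Proof.
move: c; apply: attW => [x|s u]; first by left; exists x.
have := bmap_le u; rewrite leq_eqVlt => /orP[/eqP mn|lt_mn]; first by right; exists s, u.
by left; exists (sx s m (exist _ u lt_mn)); rewrite att_comm.
Qed.

Lemma vmap_att_in m (x : K m) : vmap (attach n K) (att_in n K m x) =1 vmap K x.
Proof. by move=> e; rewrite /vmap -hom_nat att_vtx_in. Qed.

Lemma vmap_att_cell (s : shell n K) m (u : box n.+1 m) e :
  vmap (attach n K) (att_in_cell s u) e = vtx K (sx s 0 (bd_vertex (u e))).
Proof.
rewrite /vmap -[act (attach n K) _ _](hom_nat (cinj (D := att_diag n K) (ACell s))).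
rewrite -[cinj _ _ _]/(att_in_cell s _) att_vtx_cell.
by congr (vtx K (sx s 0 _)); apply: val_inj; apply: bmap_eq.
Qed.

Lemma attach_dim_le : dim_le K n -> dim_le (attach n K) n.+1.
Proof.
move=> dK m c; case: (att_split c) => [[x _]|[s [u [mE _]]]]; first exact/leqW/dK.
by rewrite mE.
Qed.
End Attach.

Lemma vmap_shell r n (K : vlpc sg r) (s : shell n K) m (b : bd n.+1 m) :
  vmap K (sx s m b) =1 fun e => vtx K (sx s 0 (bd_vertex (sval b e))).
Proof.
move=> e; rewrite /vmap -hom_nat; congr (vtx K (sx s 0 _)).
by apply: val_inj; apply: bmap_eq.
Qed.

(** The vertices of a cell determine its boundary by the hypothesis on [K], hence the
    shell to which the cell is attached; the labels of the shell are determined by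
    the boundary as its dimension is at least 2. There is one cell for each shell,
    and the bound on the dimension keeps cells apart from cubes of [K]. *)
Lemma attach_vseparated r n (K : vlpc sg r) :
  dim_le K n.+1 -> vseparated K -> vseparated (attach n.+1 K).
Proof.
move=> dK sK m c c' E.
case: (att_split c) (att_split c')
  => [[x cE]|[s [u [mn cE]]]] [[x' cE']|[s' [u' [mn' cE']]]].
- rewrite cE cE'; congr (att_in _ _ _ _); apply: sK => e.
  by rewrite -(vmap_att_in n.+1 x) -(vmap_att_in n.+1 x') -cE -cE' E.
- by exfalso; have := dK _ x; rewrite mn' ltnn.
- by exfalso; have := dK _ x'; rewrite mn ltnn.
clear mn'; move: c c' E u cE u' cE'; case: _ / (esym mn) => c c' E u cE u' cE'.
rewrite cE cE' (bmap_endo u) (bmap_endo u').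
suff -> : s = s' by [].
have Ex : sx s = sx s'.
  apply: hom_eq => k b; apply: sK => e; rewrite !vmap_shell.
  by have := E (sval b e); rewrite cE cE' !vmap_att_cell (bmap_endo u) (bmap_endo u').
apply: shell_eq => //; apply: hom_box_separated; first exact: bang_separated.
by rewrite -!scomm Ex.
Qed.

Lemma stage_dim_le r (K : vlpc sg r) k : dim_le K 1 -> dim_le (stage K k) k.+1.
Proof. by move=> dK; elim: k => //= k IHk; apply: attach_dim_le. Qed.

Lemma stage_vseparated r (K : vlpc sg r) k :
  dim_le K 1 -> vseparated K -> vseparated (stage K k).
Proof.
move=> dK sK; elim: k => //= k IHk; apply: attach_vseparated => //.
exact: stage_dim_le.
Qed.

Lemma attach_map_in r r' n (K : vlpc sg r) (L : vlpc sg r') (h : vhom K L) m (x : K m) :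
  attach_map n h m (att_in n K m x) = att_in n L m (h m x).
Proof. exact: attach_lmap_in. Qed.

Lemma attach_map_cell r r' n (K : vlpc sg r) (L : vlpc sg r') (h : vhom K L)
    (s : shell n K) m (u : box n.+1 m) :
  attach_map n h m (att_in_cell s u) = att_in_cell (shell_map h s) u.
Proof. exact: attach_lmap_cell. Qed.

Lemma attach_map_vtxE r r' n (K : vlpc sg r) (L : vlpc sg r') (h : vhom K L) (F : bmap r r') :
  (forall x, vtx L (h 0 x) = F (vtx K x)) ->
  forall x, vtx (attach n L) (attach_map n h 0 x) = F (vtx (attach n K) x).
Proof.
move=> hF; apply: attW => [x|s u].
  by rewrite attach_map_in !att_vtx_in hF.
by rewrite attach_map_cell !att_vtx_cell hF.
Qed.

Lemma stage_map_vtx r r' (K : vlpc sg r) (L : vlpc sg r') (h : vhom K L) (F : bmap r r') k :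
  (forall x, vtx L (h 0 x) = F (vtx K x)) ->
  forall x, vtx (stage L k) (stage_map h k 0 x) = F (vtx (stage K k) x).
Proof. by move=> hF; elim: k => // k IHk; apply: attach_map_vtxE. Qed.

Lemma stage_map_vmap r r' (K : vlpc sg r) (L : vlpc sg r') (h : vhom K L) (F : bmap r r') k :
  (forall x, vtx L (h 0 x) = F (vtx K x)) ->
  forall n (x : stage K k n) e, vmap (stage L k) (stage_map h k n x) e = F (vmap (stage K k) x e).
Proof. by move=> hF n x e; rewrite /vmap -hom_nat (stage_map_vtx hF). Qed.

Definition lifting r r' (K : vlpc sg r) (L : vlpc sg r') (h : vhom K L) (F : bmap r r') : Prop :=
  forall n (c : L n) (t : vert n -> vert r), (forall e, vmap L c e = F (t e)) ->
  exists c' : K n, h n c' = c.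

(** A list of coordinates is varying even with repetitions, so that [box_lift]
    applies: in a witness for the composite, the map of cubes factors through [F],
    and what remains is a witness for [t]. *)
Lemma non_twisted_factor m r r' (F : bmap r r') (t : vert m -> vert r) :
  non_twisted (fun e => F (t e)) -> non_twisted t.
Proof.
case=> q [s [psi [s_all s_ord E]]].
have sv : varying (fun e : vert m => [tuple tnth e (tnth s k) | k < q]) by exact: sel_varying.
have [g [_ tE]] := box_lift sv E.
by exists q, s, g; split.
Qed.

(** To lift a cell, lift its boundary. The lifts of the boundary cubes exist by
    hypothesis, and they are compatible because cubes of [K] are determined by
    their vertices. *)
Lemma attach_lifting r r' n (K : vlpc sg r) (L : vlpc sg r') (h : vhom K L) (F : bmap r r') :
  (forall m (x : K m) e, vmap L (h m x) e = F (vmap K x e)) ->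
  vseparated K -> lifting h F -> lifting (attach_map n h) F.
Proof.
move=> hF sK lh m c t; case: (att_split c) => [[x ->]|[s [u [mn ->]]]] ct.
  have [|x' <-] := lh _ x t; first by move=> e; rewrite -ct vmap_att_in.
  by exists (att_in n K m x'); rewrite attach_map_in.
case: _ / (esym mn) in u c t ct *; rewrite (bmap_endo u) in ct *.
have sE e : vtx L (sx s 0 (bd_vertex e)) = F (t e) by rewrite -ct vmap_att_cell.
have lift_ex k (b : bd n.+1 k) : exists c', h k c' = sx s k b.
  by apply: (lh _ _ (fun e => t (sval b e))) => e; rewrite vmap_shell sE.
pose lf k b := sval (cid (lift_ex k b)).
have lfE k b : h k (lf k b) = sx s k b by rewrite /lf; case: cid.
have lfV k b e : vmap K (lf k b) e = t (sval b e).
  by apply: (bmap_inj (f := F)); rewrite -hF lfE vmap_shell sE.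
have lf_nat k l (f : bmap k l) (b : bd n.+1 l) : lf k (act (bd n.+1) f b) = act K f (lf l b).
  by apply: sK => e; rewrite vmap_act !lfV.
pose x' : hom (bd n.+1) K := Hom lf_nat.
have comm' : hcomp (lab K) x' = hcomp (sy s) (bd_incl n.+1).
  by rewrite -scomm; apply: hom_eq => k b; rewrite /= -lfE lab_lhom.
have nt' : non_twisted (fun e => vtx K (x' 0 (bd_vertex e))).
  apply: (non_twisted_factor (F := F)).
  have -> : (fun e => F (vtx K (x' 0 (bd_vertex e)))) = (fun e => vtx L (sx s 0 (bd_vertex e))).
    apply: funext => e; rewrite sE -[t e](lfV _ (bd_vertex e) [tuple]) /vmap /=.
    by rewrite (bmap_endo (bvertex _)) act_id.
  exact: snt.
exists (att_in_cell (Shell comm' nt') (bid n.+1)).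
rewrite attach_map_cell (_ : shell_map _ _ = s) //.
by apply: shell_eq => //; apply: hom_eq.
Qed.

Lemma stage_lifting r r' (K : vlpc sg r) (L : vlpc sg r') (h : vhom K L) (F : bmap r r') k :
  (forall x, vtx L (h 0 x) = F (vtx K x)) -> dim_le K 1 ->
  vseparated K -> lifting h F -> lifting (stage_map h k) F.
Proof.
move=> hF dK sK lh; elim: k => //= k IHk; apply: attach_lifting => //.
  exact: stage_map_vmap.
exact: stage_vseparated.
Qed.

Lemma stage_non_twisted r (K : vlpc sg r) k :
  (forall n (c : K n), non_twisted (vmap K c)) ->
  forall n (c : stage K k n), non_twisted (vmap (stage K k) c).
Proof.
move=> ntK; elim: k => //= k IHk n c; case: (att_split c) => [[x ->]|[s [u [nk ->]]]].
  by rewrite (_ : vmap _ _ = vmap _ x); [exact: IHk|apply: funext; exact: vmap_att_in].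
case: _ / (esym nk) in u c *; rewrite (bmap_endo u).
have := snt s; congr non_twisted; apply: funext => e.
by rewrite vmap_att_cell.
Qed.

(** Shells of dimension at least 1 add no edges. *)
Lemma stage_edge r (K : vlpc sg r) k (Pr : (vert 1 -> vert r) -> Prop) :
  (forall c : K 1, Pr (vmap K c)) ->
  forall c : stage K k 1, Pr (vmap (stage K k) c).
Proof.
move=> PK; elim: k => //= k IHk c; case: (att_split c) => [[x ->]|[s [u [//]]]].
by rewrite (_ : vmap _ _ = vmap _ x); [exact: IHk|apply: funext; exact: vmap_att_in].
Qed.

End VertexMaps.
Arguments vmap {Sig sg r} K {n} c e.

(** * Tensor product of two labelled cubes *)

Section CubeTensor.
Variables (Sig : Type) (sg : sync_alg Sig).

Section Cosk.
Variables (r : nat) (K : vlpc sg r).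

Definition cosk_vmap n : cosk K n -> vert n -> vert r :=
  clift (D := seq_diag (cosk_step K)) (fun k (c : stage K k n) => vmap (stage K k) c).

Lemma cosk_vmap_in k n (c : stage K k n) :
  cosk_vmap (seq_in (cosk_step K) k n c) = vmap (stage K k) c.
Proof.
apply: (cliftE (D := seq_diag (cosk_step K))) => i j [k'] x.
by apply: funext => e; apply: vmap_att_in.
Qed.

Lemma coskW n (P : cosk K n -> Prop) :
  (forall k (x : stage K k n), P (seq_in (cosk_step K) k n x)) -> forall c, P c.
Proof. exact: (@colimW _ _ (seq_diag (cosk_step K))). Qed.

Lemma cosk_vmap_act m n (f : bmap m n) (c : cosk K n) e :
  cosk_vmap (act (cosk K) f c) e = cosk_vmap c (f e).
Proof. by elim/coskW: c => k x; rewrite -hom_nat !cosk_vmap_in vmap_act. Qed.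

Lemma cosk_vseparated n (c c' : cosk K n) : dim_le K 1 -> vseparated K ->
  cosk_vmap c = cosk_vmap c' -> c = c'.
Proof.
move=> dK sK; have [k [x [x' [-> ->]]]] := seq_common c c'; rewrite !cosk_vmap_in => E.
congr (seq_in _ _ _ _); apply: (stage_vseparated (k := k) dK sK) => e.
by rewrite E.
Qed.

Lemma cosk_non_twisted n (c : cosk K n) :
  (forall n (c : K n), non_twisted (vmap K c)) -> non_twisted (cosk_vmap c).
Proof. by move=> ntK; elim/coskW: c => k x; rewrite cosk_vmap_in; apply: stage_non_twisted. Qed.

Lemma cosk_edge (Pr : (vert 1 -> vert r) -> Prop) (c : cosk K 1) :
  (forall c : K 1, Pr (vmap K c)) -> Pr (cosk_vmap c).
Proof. by move=> PK; elim/coskW: c => k x; rewrite cosk_vmap_in; apply: stage_edge. Qed.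
End Cosk.

Section CoskMap.
Variables (r r' : nat) (K : vlpc sg r) (L : vlpc sg r') (h : vhom K L) (F : bmap r r').
Hypothesis hF : forall x, vtx L (h 0 x) = F (vtx K x).

Lemma cosk_vmap_map n (c : cosk K n) e : cosk_vmap (cosk_map h n c) e = F (cosk_vmap c e).
Proof. by elim/coskW: c => k x; rewrite cosk_mapE !cosk_vmap_in (stage_map_vmap hF). Qed.

Lemma cosk_lifting n (c : cosk L n) (t : vert n -> vert r) :
  dim_le K 1 -> vseparated K -> lifting h F ->
  (forall e, cosk_vmap c e = F (t e)) ->
  exists2 c' : cosk K n, cosk_map h n c' = c & cosk_vmap c' = t.
Proof.
move=> dK sK lh; elim/coskW: c => k x; rewrite cosk_vmap_in => E.
have [x' x'E] := stage_lifting hF dK sK lh E.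
exists (seq_in (cosk_step K) k n x'); first by rewrite cosk_mapE x'E.
apply: funext => e; apply: (bmap_inj (f := F)).
by rewrite cosk_vmap_in -(stage_map_vmap hF) x'E E.
Qed.
End CoskMap.

Section Edges.
Variables (p q : nat) (y : hom (box p) (sbang sg)) (z : hom (box q) (sbang sg)).
Let K := lskel 1 (LPC y).
Let L := lskel 1 (LPC z).

Definition edge_l (x : K 1) (w : L 0) : ct1 y z 1 := inl (inl (x, w)).
Definition edge_r (v : K 0) (x : L 1) : ct1 y z 1 := inl (inr (v, x)).
Definition edge_s (x : K 1) (x' : L 1) (s : syncs (x, x')) : ct1 y z 1 :=
  inr (exist _ (x, x') s).

Lemma ct1_edgeP (P : ct1 y z 1 -> Prop) :
  (forall x w, P (edge_l x w)) -> (forall v x, P (edge_r v x)) ->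
  (forall x x' s, P (@edge_s x x' s)) -> forall c, P c.
Proof. by move=> Pl Pr Ps [[[x w]|[v x]]|[[x x'] s]]; [apply: Pl|apply: Pr|apply: Ps]. Qed.

Lemma delta_thead (e : vert 1) : delta ord0 (thead e) [tuple] = e.
Proof. by case/tupleP: e => b e; apply: val_inj; rewrite /= theadE [e]tuple0. Qed.

Lemma vmap_ct1_vertex (v : ct1 y z 0) e :
  vmap (ct1 y z) v e = vcat ((sval v.1 : bmap 0 p) [tuple]) ((sval v.2 : bmap 0 q) [tuple]).
Proof. by []. Qed.
Lemma vmap_edge_l x w e :
  vmap (ct1 y z) (edge_l x w) e = vcat ((sval x : bmap 1 p) e) ((sval w : bmap 0 q) [tuple]).
Proof. by rewrite -{2}[e]delta_thead. Qed.
Lemma vmap_edge_r v x e :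
  vmap (ct1 y z) (edge_r v x) e = vcat ((sval v : bmap 0 p) [tuple]) ((sval x : bmap 1 q) e).
Proof. by rewrite -{2}[e]delta_thead. Qed.
Lemma vmap_edge_s x x' s e :
  vmap (ct1 y z) (@edge_s x x' s) e = vcat ((sval x : bmap 1 p) e) ((sval x' : bmap 1 q) e).
Proof. by rewrite -{2 3}[e]delta_thead. Qed.

Lemma ct1_dim_le : dim_le (ct1 y z) 1.
Proof. by move=> [|[|m]] // []. Qed.

Lemma below_eq n (M : pcset) m (x x' : below n M m) : sval x = sval x' -> x = x'.
Proof. exact: val_inj. Qed.

Lemma skel0_eq n (x x' : below 2 (box n) 0) :
  (sval x : bmap 0 n) [tuple] = (sval x' : bmap 0 n) [tuple] -> x = x'.
Proof. by move=> E; apply: below_eq; apply: bmap_eq => e; rewrite [e]tuple0. Qed.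

Lemma skel1_eq n (x x' : below 2 (box n) 1) :
  (forall e, (sval x : bmap 1 n) e = (sval x' : bmap 1 n) e) -> x = x'.
Proof. by move=> E; apply: below_eq; apply: bmap_eq. Qed.

(** An edge moves in the left factor, in the right one or in both; which case
    occurs can be seen on its end points, since an edge of a cube has distinct end
    points. *)
Lemma ct1_vseparated : vseparated (ct1 y z).
Proof.
move=> [|[|m]]; last by move=> [].
  move=> [v w] [v' w'] /(_ [tuple]); rewrite !vmap_ct1_vertex /= => /vcat_inj[ev ew].
  by rewrite (skel0_eq ev) (skel0_eq ew).
apply: ct1_edgeP => [x w|v x|x1 x2 s]; apply: ct1_edgeP => [x' w'|v' x'|x1' x2' s'] E.
- have El e := vcat_inj (etrans (esym (vmap_edge_l x w e)) (etrans (E e) (vmap_edge_l x' w' e))).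
  rewrite (skel1_eq (fun e => (El e).1)) (skel0_eq (El [tuple false]).2) //.
- have El e := vcat_inj (etrans (esym (vmap_edge_l x w e)) (etrans (E e) (vmap_edge_r v' x' e))).
  by case: (bmap1_nonconst (fun e => (El e).1)).
- have El e := vcat_inj (etrans (esym (vmap_edge_l x w e)) (etrans (E e) (vmap_edge_s s' e))).
  by case: (bmap1_nonconst (fun e => esym (El e).2)).
- have El e := vcat_inj (etrans (esym (vmap_edge_r v x e)) (etrans (E e) (vmap_edge_l x' w' e))).
  by case: (bmap1_nonconst (fun e => (El e).2)).
- have El e := vcat_inj (etrans (esym (vmap_edge_r v x e)) (etrans (E e) (vmap_edge_r v' x' e))).
  rewrite (skel1_eq (fun e => (El e).2)) (skel0_eq (El [tuple false]).1) //.
- have El e := vcat_inj (etrans (esym (vmap_edge_r v x e)) (etrans (E e) (vmap_edge_s s' e))).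
  by case: (bmap1_nonconst (fun e => esym (El e).1)).
- have El e := vcat_inj (etrans (esym (vmap_edge_s s e)) (etrans (E e) (vmap_edge_l x' w' e))).
  by case: (bmap1_nonconst (fun e => (El e).2)).
- have El e := vcat_inj (etrans (esym (vmap_edge_s s e)) (etrans (E e) (vmap_edge_r v' x' e))).
  by case: (bmap1_nonconst (fun e => (El e).1)).
- have El e := vcat_inj (etrans (esym (vmap_edge_s s e)) (etrans (E e) (vmap_edge_s s' e))).
  move: s s' {E El} (skel1_eq (fun e => (El e).1)) (skel1_eq (fun e => (El e).2)).
  move=> s s' ex1 ex2; case: _ / ex1 in s' *; case: _ / ex2 in s' *.
  by rewrite (Prop_irrelevance s s').
Qed.

Lemma ct1_non_twisted n (c : ct1 y z n) : non_twisted (vmap (ct1 y z) c).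
Proof.
have tupE k N (f : 'I_N -> 'I_1) (e : vert 1) : k < N ->
    nth false [tuple tnth e (f i) | i < N] k = nth false e 0.
  move=> lt_kN; rewrite -(tnth_nth false _ (Ordinal lt_kN)) tnth_mktuple.
  by rewrite [f _]ord1 (tnth_nth false).
case: n c => [|[|n]]; last by case.
  move=> v; exists 0, [tuple], (bvertex (vmap (ct1 y z) v [tuple])); split=> [[]|[]|e] //.
apply: ct1_edgeP => [x w|v x|x x' s].
- exists (1 + 0), [tuple ord0], (bprod (sval x) (sval w)); split=> [i|i j|e].
  + by rewrite [i]ord1.
  + by rewrite [i]ord1 [j]ord1.
  + rewrite vmap_edge_l /= /vprod; congr (vcat (sval x _) (sval w _)).
    * by apply: eq_from_tnth => i; rewrite [i]ord1 !(tnth_nth false) /= ?nth_take ?nth_drop // tupE.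
    * exact: esym (tuple0 _).
- exists (0 + 1), [tuple ord0], (bprod (sval v) (sval x)); split=> [i|i j|e].
  + by rewrite [i]ord1.
  + by rewrite [i]ord1 [j]ord1.
  + rewrite vmap_edge_r /= /vprod; congr (vcat (sval v _) (sval x _)).
    * exact: esym (tuple0 _).
    * by apply: eq_from_tnth => i; rewrite [i]ord1 !(tnth_nth false) /= ?nth_take ?nth_drop // tupE.
- exists (1 + 1), [tuple ord0; ord0], (bprod (sval x) (sval x')); split=> [i|i j|e].
  + by rewrite [i]ord1.
  + by rewrite [i]ord1 [j]ord1.
  + rewrite vmap_edge_s /= /vprod; congr (vcat (sval x _) (sval x' _)).
    * by apply: eq_from_tnth => i; rewrite [i]ord1 !(tnth_nth false) /= ?nth_take ?nth_drop // tupE.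
    * by apply: eq_from_tnth => i; rewrite [i]ord1 !(tnth_nth false) /= ?nth_take ?nth_drop // tupE.
Qed.

(** A synchronized edge changes one coordinate on each side, so that the two sides
    have to be taken separately. *)
Lemma ct1_thin (c : ct1 y z 1) :
  thin (fun e => vfst (vmap (ct1 y z) c e)) /\ thin (fun e => vsnd (vmap (ct1 y z) c e)).
Proof.
move: c; apply: ct1_edgeP => [x w|v x|x x' s].
- under eq_fun do rewrite vmap_edge_l vfst_cat.
  under [X in _ /\ thin X]eq_fun do rewrite vmap_edge_l vsnd_cat.
  by split; [exact: thin_bmap|exact: thin_const].
- under eq_fun do rewrite vmap_edge_r vfst_cat.
  under [X in _ /\ thin X]eq_fun do rewrite vmap_edge_r vsnd_cat.
  by split; [exact: thin_const|exact: thin_bmap].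
- under eq_fun do rewrite vmap_edge_s vfst_cat.
  under [X in _ /\ thin X]eq_fun do rewrite vmap_edge_s vsnd_cat.
  by split; exact: thin_bmap.
Qed.
End Edges.

Section EdgeLift.
Variables (p q p' q' : nat).
Variables (y : hom (box p) (sbang sg)) (z : hom (box q) (sbang sg)).
Variables (y' : hom (box p') (sbang sg)) (z' : hom (box q') (sbang sg)).
Variables (f : bmap p p') (g : bmap q q').
Hypotheses (fP : hcomp y' (box_map f) = y) (gP : hcomp z' (box_map g) = z).

Lemma ct1_map_vtxE x :
  vtx (ct1 y' z') (ct1_map fP gP 0 x) = bprod f g (vtx (ct1 y z) x).
Proof. by case: x => u v; rewrite /= /ct1_vtx /vprod /= vfst_cat vsnd_cat. Qed.

Lemma skel0_lift n n' (k : bmap n n') (x : below 2 (box n') 0) (t : vert n) :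
  (sval x : bmap 0 n') [tuple] = k t ->
  exists x' : below 2 (box n) 0, below_map 2 (box_map k) 0 x' = x.
Proof.
move=> E; exists (exist (fun _ : box n 0 => 0 < 2) (bvertex t) isT).
by apply: below_eq; apply: bmap_eq => e; rewrite [e]tuple0 E.
Qed.

Lemma skel1_lift n n' (k : bmap n n') (x : below 2 (box n') 1) (t : vert 1 -> vert n) :
  (forall e, (sval x : bmap 1 n') e = k (t e)) ->
  exists x' : below 2 (box n) 1, below_map 2 (box_map k) 1 x' = x.
Proof.
move=> E; have [u [uE _]] := box_lift (@varying_id 1) (fun e => esym (E e)).
by exists (exist (fun _ : box n 1 => 1 < 2) u isT); apply: below_eq.
Qed.

Lemma ct1_lifting : lifting (ct1_map fP gP) (bprod f g).
Proof.
move=> [|[|n]]; last by case.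
  move=> [v w] t /(_ [tuple]); rewrite vmap_ct1_vertex => /vcat_inj[ev ew].
  have [v' vE] := skel0_lift (x := v) ev; have [w' wE] := skel0_lift (x := w) ew.
  by exists (v', w'); rewrite -vE -wE.
apply: ct1_edgeP => [x w|v x|x x' s] t E.
- have El e := vcat_inj (etrans (esym (vmap_edge_l x w e)) (E e)).
  have [x1 xE] := skel1_lift (fun e => (El e).1).
  have [w1 wE] := skel0_lift (El [tuple false]).2.
  by exists (edge_l x1 w1); rewrite -xE -wE.
- have El e := vcat_inj (etrans (esym (vmap_edge_r v x e)) (E e)).
  have [x1 xE] := skel1_lift (fun e => (El e).2).
  have [v1 vE] := skel0_lift (El [tuple false]).1.
  by exists (edge_r v1 x1); rewrite -xE -vE.
- have El e := vcat_inj (etrans (esym (vmap_edge_s s e)) (E e)).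
  have [x1 xE] := skel1_lift (fun e => (El e).1).
  have [x2 xE'] := skel1_lift (fun e => (El e).2).
  have s1 : @syncs _ sg (lskel 1 (LPC y)) (lskel 1 (LPC z)) (x1, x2).
    rewrite /syncs /= -(lab1_lhom (lskel_map 1 (lbox_map fP)) x1).
    rewrite -(lab1_lhom (lskel_map 1 (lbox_map gP)) x2).
    have -> : lskel_map 1 (lbox_map fP) 1 x1 = x by rewrite -xE.
    by have -> : lskel_map 1 (lbox_map gP) 1 x2 = x' by rewrite -xE'.
  by exists (edge_s s1); congr inr; apply: eq_exist; rewrite /= -xE -xE'.
Qed.

Lemma cube_tensor_map_vmap n (c : cube_tensor y z n) e :
  cosk_vmap (cube_tensor_map fP gP n c) e = bprod f g (cosk_vmap c e).
Proof. exact: (cosk_vmap_map ct1_map_vtxE). Qed.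

Lemma cube_tensor_lift n (c : cube_tensor y' z' n) (t : vert n -> vert (p + q)) :
  (forall e, cosk_vmap c e = bprod f g (t e)) ->
  exists2 c' : cube_tensor y z n, cube_tensor_map fP gP n c' = c & cosk_vmap c' = t.
Proof.
apply: (cosk_lifting ct1_map_vtxE); [exact: ct1_dim_le|exact: ct1_vseparated|exact: ct1_lifting].
Qed.
End EdgeLift.

Lemma cube_tensor_vseparated p q (y : hom (box p) (sbang sg)) (z : hom (box q) (sbang sg)) n
  (c c' : cube_tensor y z n) : cosk_vmap c = cosk_vmap c' -> c = c'.
Proof. by apply: cosk_vseparated; [exact: ct1_dim_le|exact: ct1_vseparated]. Qed.

End CubeTensor.

(** * Normal forms in tensor products *)

(** A cube [pbase] of dimension [pdim] seen as a degenerate cube of dimension [n] by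
    means of [pproj]. In normal forms [pproj] selects distinct coordinates, see
    [nf_shape]. *)
Record pcube (K : pcset) (n : nat) : Type := PCube {
  pdim : nat;
  pbase : K pdim;
  pproj : vert n -> vert pdim }.
Arguments PCube K [n pdim] pbase pproj.

Lemma PCube_inj (K : pcset) n p (x x' : K p) (s s' : vert n -> vert p) :
  PCube K x s = PCube K x' s' -> x = x' /\ s = s'.
Proof.
by case=> /(existT_nat_inj (X := K))-> /(existT_nat_inj (X := fun p => vert n -> vert p))->.
Qed.

Definition factorable n p (h : vert n -> vert p) : Prop :=
  exists a (f : bmap a p) (s : vert n -> vert a), varying s /\ forall e, h e = f (s e).

Section NormalForm.
Variables (K : pcset) (n p : nat) (x : hom (box p) K) (h : vert n -> vert p).

Definition is_reduction (d : pcube K n) : Prop :=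
  exists f : bmap (pdim d) p,
    [/\ varying (pproj d), forall e, h e = f (pproj d e) & pbase d = x _ f].

(** The face of [x] spanned by the image of [h], with [h] corestricted to it. The
    default value is never met in normal forms, by [left_factorable] and
    [right_factorable]. *)
Definition reduce : pcube K n :=
  if pselect (exists d, is_reduction d) is left e then sval (cid e) else PCube K (x p (bid p)) h.

Lemma reduceE a (f : bmap a p) (s : vert n -> vert a) :
  varying s -> (forall e, h e = f (s e)) -> reduce = PCube K (x a f) s.
Proof.
move=> sv hE; rewrite /reduce; case: pselect => [e|[]]; last by exists (PCube K (x a f) s), f.
case: cid => /= -[b c t] [/= g [tv hE' ->]].
by apply: (factor_unique (fun b g t => PCube K (x b g) t)) => // e'; rewrite -hE.
Qed.
End NormalForm.

(** The reason why reductions are compatible with the colimits over the cubes of [K]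
    and [L]: replacing a face by a larger cube that contains it changes nothing. *)
Lemma reduce_comp (K : pcset) n p p' (x : hom (box p') K) (f : bmap p p') (h : vert n -> vert p) :
  factorable h -> reduce x (fun e => f (h e)) = reduce (hcomp x (box_map f)) h.
Proof.
case=> a [g [s [sv hE]]]; rewrite (reduceE _ sv hE) (reduceE (f := bcomp f g) _ sv) // => e.
by rewrite hE.
Qed.

Definition pcube_map K L (h : hom K L) n (d : pcube K n) : pcube L n :=
  PCube L (h _ (pbase d)) (pproj d).

Lemma reduce_hom K L (k : hom K L) n p (x : hom (box p) K) (h : vert n -> vert p) :
  factorable h -> reduce (hcomp k x) h = pcube_map k (reduce x h).
Proof. by case=> a [g [s [sv hE]]]; rewrite !(reduceE _ sv hE). Qed.

Section TensorNF.
Variables (Sig : Type) (sg : sync_alg Sig).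

Section Cube.
Variables (p q n : nat) (y : hom (box p) (sbang sg)) (z : hom (box q) (sbang sg)).
Variable c : cube_tensor y z n.

Definition left_map : vert n -> vert p := fun e => vfst (cosk_vmap c e).
Definition right_map : vert n -> vert q := fun e => vsnd (cosk_vmap c e).

Lemma cube_factor : exists a b (f : bmap a p) (g : bmap b q)
  (s : vert n -> vert a) (t : vert n -> vert b),
  [/\ varying s, varying t & forall e, cosk_vmap c e = vcat (f (s e)) (g (t e))].
Proof.
have [r [s [psi [_ _ E]]]] := cosk_non_twisted c (@ct1_non_twisted _ _ _ _ y z).
have [a [b [f [g [s1 [s2 [v1 v2 E']]]]]]] := box_split psi (@sel_varying n r (tnth s)).
by exists a, b, f, g, s1, s2; split=> // e; rewrite E; apply: E'.
Qed.

Lemma left_factorable : factorable left_map.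
Proof.
have [a [b [f [g [s [t [sv tv E]]]]]]] := cube_factor.
by exists a, f, s; split=> // e; rewrite /left_map E vfst_cat.
Qed.

Lemma right_factorable : factorable right_map.
Proof.
have [a [b [f [g [s [t [sv tv E]]]]]]] := cube_factor.
by exists b, g, t; split=> // e; rewrite /right_map E vsnd_cat.
Qed.

(** In a normal form the two lists of coordinates [v] and [w] make up the list that
    witnesses non-twistedness. Each of them has distinct entries because an edge
    changes at most one coordinate on each side ([ct1_thin]); so the entries of the
    first list are first occurrences, and [v] is the inclusion of 0, .., [p.-1]. If
    [p = 0], the same applies to [w]. *)
Lemma cube_shape (s : vert n -> vert p) (t : vert n -> vert q) :
  varying s -> varying t -> (forall e, cosk_vmap c e = vcat (s e) (t e)) ->
  exists (v : 'I_p -> 'I_n) (w : 'I_q -> 'I_n),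
    [/\ s = sel v /\ t = sel w, injective v, injective w, forall k, v k = k :> nat
      & p = 0 -> q = n /\ forall k, w k = k :> nat].
Proof.
move=> sv tv cE.
have [u [u_all u_ord uE]] : exists u : (p + q).-tuple 'I_n, [/\ forall i, i \in u,
    forall i j : 'I_n, j = i.+1 :> nat -> index i u < index j u
    & forall e, cosk_vmap c e = sel (tnth u) e].
  have [r [u [psi [u_all u_ord uE]]]] := cosk_non_twisted c (@ct1_non_twisted _ _ _ _ y z).
  pose G a (_ : bmap a (p + q)) (h : vert n -> vert a) :=
    exists u : a.-tuple 'I_n, [/\ forall i, i \in u,
      forall i j : 'I_n, j = i.+1 :> nat -> index i u < index j u
      & forall e, h e = sel (tnth u) e].
  have cv : varying (cosk_vmap c).
    rewrite (_ : cosk_vmap c = fun e => vcat (s e) (t e)); first exact: varying_vcat.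
    exact: funext.
  suff : G _ (bid (p + q)) (cosk_vmap c) by [].
  rewrite (factor_unique G (f' := psi) (s' := sel (tnth u)) cv) //; first by exists u.
  exact: sel_varying.
pose v k := tnth u (lshift q k); pose w k := tnth u (rshift p k).
have sE : s = sel v.
  apply: funext => e; apply: eq_from_tnth => k; rewrite tnth_mktuple.
  have := congr1 (fun x => tnth x (lshift q k)) (etrans (esym (cE e)) (uE e)).
  by rewrite tnth_mktuple => <-; rewrite [RHS]tnth_lshift.
have tE : t = sel w.
  apply: funext => e; apply: eq_from_tnth => k; rewrite tnth_mktuple.
  have := congr1 (fun x => tnth x (rshift p k)) (etrans (esym (cE e)) (uE e)).
  by rewrite tnth_mktuple => <-; rewrite [RHS]tnth_rshift.
have thin_uc (d : cube_tensor y z 1) :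
    thin (fun e => vfst (cosk_vmap d e)) /\ thin (fun e => vsnd (cosk_vmap d e)).
  pose Pr h := thin (fun e => @vfst p q (h e)) /\ thin (fun e => @vsnd p q (h e)).
  exact: (cosk_edge (Pr := Pr) d (@ct1_thin _ _ _ _ y z)).
have v_inj : injective v.
  move=> k k' vk; have [f fE] := line_ex (v k).
  have [th _] := thin_uc (act (cube_tensor y z) f c).
  by apply: th; rewrite !cosk_vmap_act !cE !vfst_cat sE !tnth_mktuple -?vk !fE.
have w_inj : injective w.
  move=> k k' vk; have [f fE] := line_ex (w k).
  have [_ th] := thin_uc (act (cube_tensor y z) f c).
  by apply: th; rewrite !cosk_vmap_act !cE !vsnd_cat tE !tnth_mktuple -?vk !fE.
have usplit : u = map v (enum 'I_p) ++ map w (enum 'I_q) :> seq 'I_n.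
  have -> : u = cat_tuple (mktuple v) (mktuple w).
    apply: eq_from_tnth => j; case: (split_ordP j) => k ->.
      by rewrite tnth_lshift tnth_mktuple.
    by rewrite tnth_rshift tnth_mktuple.
  by [].
rewrite usplit in u_ord; exists v, w; split=> //; first exact: first_occurrences u_ord.
move=> p0; have v0 : map v (enum 'I_p) = [::].
  by apply/nilP; rewrite /nilp size_map size_enum_ord p0.
rewrite v0 cat0s -[map w _]cats0 in u_ord.
have wE := first_occurrences w_inj u_ord; split=> //.
apply/eqP; rewrite eqn_leq; apply/andP; split.
  case: leqP => // lt_nq; have := ltn_ord (w (Ordinal lt_nq)).
  by rewrite wE /= ltnn.
case: leqP => // lt_qn; have := u_all (Ordinal lt_qn).
rewrite -[_ \in _]/(_ \in tval u) usplit v0 /= => /mapP[k _] /(congr1 val) /=.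
by rewrite wE => E; have := ltn_ord k; rewrite -E ltnn.
Qed.
End Cube.

Section Tensor.
Variables K L : lpc sg.

Definition nf_rep n (x : elt K) (z : elt L) (c : cube_tensor (elab x) (elab z) n) :
    pcube K n * pcube L n :=
  (reduce (emap x) (left_map c), reduce (emap z) (right_map c)).

(** The nested [clift] follow the two colimits in the definition of the tensor
    product: over the cubes of [K], then over those of [L]. *)
Definition nf n : tensor K L n -> pcube K n * pcube L n :=
  clift (D := tensor_diag K L) (fun x =>
    clift (D := tl_diag (elab x) L) (fun z c => @nf_rep n x z c)).

Definition tensor_cube n (x : elt K) (z : elt L) (c : cube_tensor (elab x) (elab z) n) :
    tensor K L n := tensor_in L x n (tl_in (elab x) z n c).

Lemma tensor_cube_act m n (f : bmap m n) x z (c : cube_tensor (elab x) (elab z) n) :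
  act (tensor K L) f (tensor_cube c) = tensor_cube (act (cube_tensor (elab x) (elab z)) f c).
Proof. by rewrite /tensor_cube !hom_nat. Qed.

Lemma tensorW n (P : tensor K L n -> Prop) :
  (forall x z c, P (@tensor_cube n x z c)) -> forall c, P c.
Proof.
move=> H; apply: (@colimW _ _ (tensor_diag K L)) => x.
by apply: (@colimW _ _ (tl_diag (elab x) L)) => z c; apply: H.
Qed.

Lemma nf_left n x z (c : cube_tensor (elab x) (elab z) n) :
  clift (D := tl_diag (elab x) L) (fun z c => @nf_rep n x z c) (tl_in (elab x) z n c)
  = nf_rep c.
Proof.
apply: (cliftE (D := tl_diag (elab x) L)) => z1 z2 g c1.
have E := cube_tensor_map_vmap (box_map_id (elab x)) (elt_arr_lab g) c1.
congr pair; first by congr reduce; apply: funext => e; rewrite /left_map E vfst_cat.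
rewrite -(svalP g) -reduce_comp; last exact: right_factorable.
by congr reduce; apply: funext => e; rewrite /right_map E vsnd_cat.
Qed.

Lemma nf_cube n x z (c : cube_tensor (elab x) (elab z) n) : nf (tensor_cube c) = nf_rep c.
Proof.
rewrite -nf_left; apply: (cliftE (D := tensor_diag K L)) => x1 x2 f.
apply: (@colimW _ _ (tl_diag (elab x1) L)) => z1 c1.
rewrite [tensor_arr L f _ _](tensor_left_mapE (elt_arr_lab f) (lid L)) !nf_left.
have E := cube_tensor_map_vmap (elt_arr_lab f) (elt_map_lab (lid L) z1) c1.
congr pair; last by congr reduce; apply: funext => e; rewrite /right_map E vsnd_cat.
rewrite -[X in _ = reduce X _](svalP f) -reduce_comp; last exact: left_factorable.
by congr reduce; apply: funext => e; rewrite /left_map E vfst_cat.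
Qed.

Definition cell (M : lpc sg) n (x : M n) : elt M := Elt (char_map x).

Definition represents n (d : pcube K n * pcube L n) (c : tensor K L n) : Prop :=
  exists c1 : cube_tensor (elab (cell (pbase d.1))) (elab (cell (pbase d.2))) n,
  [/\ c = tensor_cube c1, varying (pproj d.1), varying (pproj d.2)
    & forall e, cosk_vmap c1 e = vcat (pproj d.1 e) (pproj d.2 e)].

Lemma cell_arr_subproof (M : lpc sg) (x : elt M) a (f : bmap a (edim x)) :
  hcomp (emap x) (box_map f) = emap (cell (emap x a f)).
Proof. by apply: hom_eq => m g; rewrite /= -hom_nat. Qed.

Definition cell_arr (M : lpc sg) (x : elt M) a (f : bmap a (edim x)) :
    elt_arr (cell (emap x a f)) x := exist _ f (cell_arr_subproof f).

(** The vertices of a cube lie in the product of the faces to which the two sides are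
    reduced, so that the cube comes from this product by [cube_tensor_lift]; the two
    identifications that follow are those of the two colimits. *)
Lemma nf_represents n (c : tensor K L n) : represents (nf c) c.
Proof.
elim/tensorW: c => x z c; rewrite nf_cube.
have [a [b [f [g [s [t [sv tv E]]]]]]] := cube_factor c.
have -> : nf_rep c = (PCube K (emap x a f) s, PCube L (emap z b g) t).
  by congr pair; apply: reduceE => // e; rewrite /left_map /right_map E ?vfst_cat ?vsnd_cat.
have [|c1 c1E c1v] := @cube_tensor_lift _ _ _ _ _ _ _ _ _ _ _ _
    (elt_arr_lab (cell_arr f)) (elt_arr_lab (cell_arr g)) n c (fun e => vcat (s e) (t e)).
  by move=> e; rewrite E /= /vprod vfst_cat vsnd_cat.
exists c1; split=> //; last by move=> e; rewrite c1v.
rewrite -c1E /tensor_cube -(tensor_inE (cell_arr f)) tensor_left_mapE.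
have e1 : hcomp (emap z) (box_map g) = emap (elt_map (lid L) (cell (emap z b g))).
  by rewrite cell_arr_subproof; apply: hom_eq.
have <- := tl_inE (z := elt_map (lid L) (cell (emap z b g))) (z' := z) (exist _ g e1).
congr (tensor_in _ _ _ (tl_in _ _ _ _)); apply/esym.
by apply: cube_tensor_map_comp; exact: bmap_eq.
Qed.

(** Two cubes with the same normal form come from cubes of one coskeleton that have
    the same vertices. *)
Lemma nf_inj n (c c' : tensor K L n) : nf c = nf c' -> c = c'.
Proof.
move=> E; have := nf_represents c; have := nf_represents c'; rewrite -E.
case: (nf c) => x z [c2 [-> _ _ E2]] [c1 [-> _ _ E1]].
congr tensor_cube; apply: cube_tensor_vseparated; apply: funext => e.
by rewrite E1 E2.
Qed.

Lemma nf_act m n (f : bmap m n) (c : tensor K L n) p q (x : K p) (z : L q) s t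
    a (g : bmap a p) s' b (k : bmap b q) t' :
  nf c = (PCube K x s, PCube L z t) ->
  varying s' -> (forall e, s (f e) = g (s' e)) ->
  varying t' -> (forall e, t (f e) = k (t' e)) ->
  nf (act (tensor K L) f c) = (PCube K (act K g x) s', PCube L (act L k z) t').
Proof.
move=> nfc sv sE tv tE; have := nf_represents c; rewrite nfc => -[c1 [-> _ _ E]].
rewrite tensor_cube_act nf_cube; congr pair; apply: reduceE => // e.
  by rewrite /left_map cosk_vmap_act E vfst_cat.
by rewrite /right_map cosk_vmap_act E vsnd_cat.
Qed.

Lemma nf_shape n (c : tensor K L n) :
  exists p q (x : K p) (z : L q) (v : 'I_p -> 'I_n) (w : 'I_q -> 'I_n),
    [/\ nf c = (PCube K x (sel v), PCube L z (sel w)),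
        injective v, injective w, forall k, v k = k :> nat
      & p = 0 -> q = n /\ forall k, w k = k :> nat].
Proof.
have := nf_represents c; case: (nf c) => -[p x s] [q z t] [c1 /= [_ sv tv E]].
have [v [w [[-> ->] vi wi vE wE]]] := cube_shape sv tv E.
by exists p, q, x, z, v, w.
Qed.
End Tensor.

Lemma nf_map K L K' L' (h : lhom K K') (k : lhom L L') n (c : tensor K L n) :
  nf (tensor_map h k n c) = (pcube_map h (nf c).1, pcube_map k (nf c).2).
Proof.
elim/tensorW: c => x z c; rewrite nf_cube /tensor_cube tensor_mapE tensor_left_mapE.
rewrite -[LHS]/(nf (tensor_cube (x := elt_map h x) (z := elt_map k z) _)) nf_cube.
have E := cube_tensor_map_vmap (elt_map_lab h x) (elt_map_lab k z) c.
have -> : nf_rep (x := elt_map h x) (z := elt_map k z)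
    (cube_tensor_map (elt_map_lab h x) (elt_map_lab k z) n c)
  = (reduce (hcomp h (emap x)) (left_map c), reduce (hcomp k (emap z)) (right_map c)).
  by congr pair; congr reduce; apply: funext => e;
    rewrite /left_map /right_map E ?vfst_cat ?vsnd_cat.
by rewrite !reduce_hom //; [exact: right_factorable|exact: left_factorable].
Qed.

Lemma pcube_map_inj K L (h : hom K L) n : injective_hom h -> injective (@pcube_map K L h n).
Proof.
move=> hi [p x s] [p' x' s'] E.
have ep : p = p' := congr1 (@pdim L n) E.
case: _ / ep in x' s' E *; have [/= ex es] := PCube_inj E.
by rewrite (hi _ _ _ ex) es.
Qed.

Lemma tensor_map_inj (K L K' L' : lpc sg) (h : lhom K K') (k : lhom L L') :
  injective_hom h -> injective_hom k -> injective_hom (tensor_map h k).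
Proof.
move=> hi ki n c c' E; apply: nf_inj.
have nfE := congr1 (fun u => nf u) E; rewrite !nf_map in nfE.
have /= /(pcube_map_inj hi) e1 := congr1 fst nfE.
have /= /(pcube_map_inj ki) e2 := congr1 snd nfE.
by rewrite [nf c]surjective_pairing e1 e2 -surjective_pairing.
Qed.
End TensorNF.

(** * Comparison of cubes through their faces *)

Section ProjectedFaces.
Variable K : pcset.

(** The faces of cubes in normal form. They form a relation and not a function
    because the dimension of the base depends on whether the direction [i] is
    selected. *)
Inductive pface n (i : 'I_n.+1) (a : bool) : pcube K n.+1 -> pcube K n -> Prop :=
| pface_out p (x : K p) (w : 'I_p -> 'I_n.+1) (u : 'I_p -> 'I_n) :
    (forall k, w k = lift i (u k)) -> pface i a (PCube K x (sel w)) (PCube K x (sel u))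
| pface_in p (x : K p.+1) (w : 'I_p.+1 -> 'I_n.+1) k (u : 'I_p -> 'I_n) :
    w k = i -> (forall l, w (lift k l) = lift i (u l)) ->
    pface i a (PCube K x (sel w)) (PCube K (face k a x) (sel u)).

Lemma lift_out n p (w : 'I_p -> 'I_n.+1) i :
  i \notin codom w -> exists u : 'I_p -> 'I_n, forall k, w k = lift i (u k).
Proof.
move=> iw; apply: (fin_all_exists (P := fun k (j : 'I_n) => w k = lift i j)) => k.
have [|j -> _] := @unlift_some _ i (w k); last by exists j.
by apply: contraNneq iw => ->; apply: codom_f.
Qed.

Lemma lift_in n p (w : 'I_p.+1 -> 'I_n.+1) k : injective w ->
  exists u : 'I_p -> 'I_n, forall l, w (lift k l) = lift (w k) (u l).
Proof.
move=> wi.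
apply: (fin_all_exists (P := fun l (j : 'I_n) => w (lift k l) = lift (w k) j)) => l.
have [|j -> _] := @unlift_some _ (w k) (w (lift k l)); last by exists j.
by rewrite (inj_eq wi) neq_lift.
Qed.

Lemma pface_ex n (i : 'I_n.+1) a p (x : K p) (w : 'I_p -> 'I_n.+1) : injective w ->
  exists2 d, pface i a (PCube K x (sel w)) d & pdim d + (i \in codom w) = p.
Proof.
move=> wi; case: (boolP (i \in codom w)) => [/codomP[k ->]|iw].
  case: p x w wi k => [|p] x w wi k; first by case: k.
  have [u uE] := lift_in k wi; exists (PCube K (face k a x) (sel u)); first exact: pface_in.
  by rewrite addn1.
have [u uE] := lift_out iw; exists (PCube K x (sel u)); first exact: pface_out.
by rewrite addn0.
Qed.

Lemma pface_factor n (i : 'I_n.+1) a p (x : K p) (s : vert n.+1 -> vert p) d :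
  pface i a (PCube K x s) d ->
  exists g : bmap (pdim d) p, [/\ pbase d = act K g x, varying (pproj d)
    & forall e, s (delta i a e) = g (pproj d e)].
Proof.
move: {-2}(PCube K x s) (erefl (PCube K x s)) => D DE H.
case: D d / H DE => [p' x' w u wE|p' x' w k u wk wE] DE.
  have ep : p = p' := esym (congr1 (@pdim K _) DE).
  case: _ / ep in x' w u wE DE *; have [/= -> <-] := PCube_inj DE.
  exists (bid p); split; [by rewrite act_id|exact: sel_varying|move=> e].
  by apply: eq_from_tnth => k; rewrite !tnth_mktuple wE tnth_delta_lift.
have ep : p'.+1 = p := congr1 (@pdim K _) DE.
case: _ / ep in x s DE *; have [/= <- <-] := PCube_inj DE.
exists (bdelta k a); split=> //; first exact: sel_varying.
move=> e; apply: eq_from_tnth => l; rewrite tnth_mktuple /=.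
case: (unliftP k l) => [m ->|->]; last by rewrite wk !tnth_delta.
by rewrite wE !tnth_delta_lift tnth_mktuple.
Qed.

Section Compare.
Variables (n p p' : nat) (x : K p) (x' : K p').
Variables (w : 'I_p -> 'I_n.+2) (w' : 'I_p' -> 'I_n.+2).
Hypotheses (wi : injective w) (wi' : injective w').
Hypothesis faces : forall i a d d',
  pface i a (PCube K x (sel w)) d -> pface i a (PCube K x' (sel w')) d' -> d = d'.

(** The boolean [i \in codom w] counts as the dimension lost by the base cube in the
    direction [i]. *)
Lemma pface_dims i : p + (i \in codom w') = p' + (i \in codom w).
Proof.
have [d dF dE] := pface_ex i false x wi; have [d' dF' dE'] := pface_ex i false x' wi'.
by rewrite -{1}dE -[in RHS]dE' (faces dF dF') addnAC.
Qed.

(** If [p < p'], then each direction moves the second cube and none the first one,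
    so that [p = 0] and [p' = 1]; but there are at least two directions. *)
Lemma pface_dim_le : p' <= p.
Proof.
case: leqP => // lt_pp'.
have codw i : (i \in codom w') && (i \notin codom w).
  have := pface_dims i; move: lt_pp'.
  case: (i \in codom w) (i \in codom w') => [] [] //=; rewrite ?addn0 ?addn1 => lt_pp' E.
  - by case: E => E; rewrite E ltnn in lt_pp'.
  - by rewrite E ltnNge leqnSn in lt_pp'.
  - by rewrite E ltnn in lt_pp'.
have p0 : p = 0.
  case: (p) w codw => // q v /(_ (v ord0)) /andP[_].
  by rewrite codom_f.
have p1 : p' = 1 by have := pface_dims ord0; have /andP[-> /negPf->] := codw ord0; rewrite p0 addn0.
have /andP[/codomP[k kE] _] := codw ord0; have /andP[/codomP[k' kE'] _] := codw ord_max.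
have ekk' : k = k' by move: (k) (k'); rewrite p1 => j j'; rewrite [j]ord1 [j']ord1.
by have := congr1 val kE; rewrite ekk' -kE'.
Qed.
End Compare.

(** A direction that moves neither cube gives the result at once, since the faces in
    this direction have the same bases as the cubes. If all directions are
    selected, deleting a direction different from [w 0] and [w' 0] shows that
    [w 0 = w' 0], then deleting this direction shows [w = w'], and [separated K]
    applies to the bases. In dimension 2 there may be no third direction: then [w]
    and [w'] may be exchanged, but in this case the bases are squares with
    transposed boundaries. *)
Lemma pcube_separated n p p' (x : K p) (x' : K p')
    (w : 'I_p -> 'I_n.+2) (w' : 'I_p' -> 'I_n.+2) :
  separated K -> asymmetric K -> injective w -> injective w' ->
  (forall i a d d', pface i a (PCube K x (sel w)) d ->
     pface i a (PCube K x' (sel w')) d' -> d = d') ->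
  PCube K x (sel w) = PCube K x' (sel w').
Proof.
move=> sK aK wi wi' H.
have ep : p = p'.
  apply/eqP; rewrite eqn_leq (pface_dim_le wi wi' H) andbT.
  exact: (pface_dim_le wi' wi (fun i a d d' F F' => esym (H i a d' d F' F))).
case: _ / ep in x' w' wi' H *.
have codE i : (i \in codom w) = (i \in codom w').
  have /addnI := pface_dims wi wi' H i.
  by case: (_ \in _) (_ \in _) => [] [].
have [[i iw]|all_w] := pselect (exists i, i \notin codom w).
  have [u uE] := lift_out iw; have [u' uE'] := lift_out (etrans (congr1 negb (esym (codE i))) iw).
  have [-> /sel_inj eu] := PCube_inj (H _ false _ _ (pface_out _ x uE) (pface_out _ x' uE')).
  by congr (PCube K _ (sel _)); apply: funext => k; rewrite uE uE' eu.
have {}all_w i : i \in codom w by case: (boolP (i \in codom w)) => // iw; case: all_w; exists i.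
have all_w' i : i \in codom w' by rewrite -codE.
case: p x x' w w' wi wi' H {codE} all_w all_w' => [|[|p]] x x' w w' wi wi' H all_w all_w'.
- by have /codomP[[]] := all_w ord0.
- have /codomP[k kE] := all_w ord0; have /codomP[k' kE'] := all_w ord_max.
  have ekk : k = k' by rewrite (ord1 k) (ord1 k').
  by have := congr1 val kE; rewrite ekk -kE'.
have faceE k k' : w k = w' k' -> forall a, face k a x = face k' a x' /\
    forall l, w (lift k l) = w' (lift k' l).
  move=> E a; have [u uE] := lift_in k wi; have [u' uE'] := lift_in k' wi'.
  have F' := pface_in a x' erefl uE'; rewrite -E in F'.
  have [? /sel_inj eu] := PCube_inj (H _ a _ _ (pface_in a x erefl uE) F').
  by split=> // l; rewrite uE uE' -E eu.
have [E|neq] := eqVneq (w ord0) (w' ord0).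
  have ew : w = w'.
    apply: funext => k; case: (unliftP ord0 k) => [l ->|-> //].
    exact: (faceE _ _ E false).2.
  rewrite -ew; congr (PCube K _ _); apply: sK => k a.
  by case: (faceE k k _ a) => //; rewrite ew.
exfalso; case: n w w' wi wi' all_w all_w' {H} faceE neq => [|n] w w' wi wi' all_w all_w' faceE neq.
  (* There are only two directions, which [w] and [w'] list in opposite orders. *)
  have p0 : p = 0.
    by have := leq_card w wi; rewrite !card_ord !ltnS leqn0 => /eqP.
  move: x x' w w' wi wi' all_w all_w' faceE neq; rewrite p0.
  move=> x x' w w' _ _ all_w all_w' faceE neq.
  have ord2 (k : 'I_2) : k != ord0 -> k = ord_max.
    by case: k => [[|[|k]]] // lt_k _; apply: val_inj.
  have E1 : w ord0 = w' ord_max.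
    have /codomP[k kE] := all_w' (w ord0); rewrite kE (ord2 k) //.
    by apply: contraNneq neq => k0; rewrite kE k0.
  have E2 : w ord_max = w' ord0.
    have /codomP[k kE] := all_w (w' ord0); rewrite kE (ord2 k) //.
    by apply: contraNneq neq => k0; rewrite kE k0.
  by apply: (aK x x') => a; split; [exact: (faceE _ _ E1 a).1|exact: (faceE _ _ E2 a).1].
have [i i0 i0'] : exists2 i, i != w ord0 & i != w' ord0.
  have [[i /norP[]]|no_i] := pselect (exists i, ~~ ((i == w ord0) || (i == w' ord0))).
    by exists i.
  have sub : {subset enum 'I_n.+3 <= [:: w ord0; w' ord0]}.
    by move=> i _; rewrite !inE; case: (boolP (_ || _)) => // ni; case: no_i; exists i.
  by have := uniq_leq_size (enum_uniq _) sub; rewrite size_enum_ord.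
have /codomP[k kE] := all_w i; have /codomP[k' kE'] := all_w' i.
have [_ /(_ ord0)] := faceE k k' (etrans (esym kE) kE') false.
have lift0 (j : 'I_p.+2) : j != ord0 -> lift j ord0 = ord0.
  by rewrite -(inj_eq val_inj) => /negPf j0; apply: val_inj; rewrite /= /bump leqn0 j0.
rewrite !lift0; first by move/eqP; rewrite (negPf neq).
  by apply: contraNneq i0' => k0; rewrite kE' k0.
by apply: contraNneq i0 => k0; rewrite kE k0.
Qed.

Lemma pcube_asymmetric (x x' : K 2) (w w' : 'I_2 -> 'I_2) :
  asymmetric K -> (forall k, w k = k :> nat) -> (forall k, w' k = k :> nat) ->
  (forall a d d', pface ord0 a (PCube K x (sel w)) d ->
     pface ord_max a (PCube K x' (sel w')) d' -> d = d') ->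
  (forall a d d', pface ord_max a (PCube K x (sel w)) d ->
     pface ord0 a (PCube K x' (sel w')) d' -> d = d') -> False.
Proof.
move=> aK wE wE' H H'.
have wid (v : 'I_2 -> 'I_2) k : (forall k, v k = k :> nat) -> v k = k.
  by move=> vE; apply: val_inj; apply: vE.
have inj (v : 'I_2 -> 'I_2) : (forall k, v k = k :> nat) -> injective v.
  by move=> vE k k'; rewrite !(wid v).
have F (y : K 2) (v : 'I_2 -> 'I_2) a (k : 'I_2) : (forall k, v k = k :> nat) ->
    exists u, pface k a (PCube K y (sel v)) (PCube K (face k a y) (sel u)).
  move=> vE; have [u uE] := lift_in k (inj v vE); exists u.
  by rewrite -{1}(wid v k vE); apply: pface_in.
apply: (aK x x') => a; split.
  have [u uF] := F x w a ord0 wE; have [u' uF'] := F x' w' a ord_max wE'.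
  by have [] := PCube_inj (H _ _ _ uF uF').
have [u uF] := F x w a ord_max wE; have [u' uF'] := F x' w' a ord0 wE'.
by have [] := PCube_inj (H' _ _ _ uF uF').
Qed.
End ProjectedFaces.

(** * Tensor products *)

Section TensorProperties.
Variables (Sig : Type) (sg : sync_alg Sig) (K L : lpc sg).

Lemma nf_face n (i : 'I_n.+1) a (c : tensor K L n.+1) D E d e :
  nf c = (D, E) -> pface i a D d -> pface i a E e -> nf (face i a c) = (d, e).
Proof.
case: D E d e => [p x s] [q z t] [p' x' s'] [q' z' t'] cE.
move=> /pface_factor[g [/= -> sv sE]] /pface_factor[k [/= -> tv tE]].
exact: (nf_act (f := bdelta i a) cE sv sE tv tE).
Qed.

Section Faces.
Variables (n p q p' q' : nat) (i i' : 'I_n.+1) (a : bool) (c c' : tensor K L n.+1).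
Variables (x : K p) (z : L q) (x' : K p') (z' : L q').
Variables (v : 'I_p -> 'I_n.+1) (w : 'I_q -> 'I_n.+1).
Variables (v' : 'I_p' -> 'I_n.+1) (w' : 'I_q' -> 'I_n.+1).
Hypotheses (vi : injective v) (wi : injective w) (vi' : injective v') (wi' : injective w').
Hypotheses (cE : nf c = (PCube K x (sel v), PCube L z (sel w))).
Hypotheses (cE' : nf c' = (PCube K x' (sel v'), PCube L z' (sel w'))).
Hypothesis faceE : face i a c = face i' a c'.

Lemma nf_face_left d d' :
  pface i a (PCube K x (sel v)) d -> pface i' a (PCube K x' (sel v')) d' -> d = d'.
Proof.
move=> F F'; have [e G _] := pface_ex i a z wi; have [e' G' _] := pface_ex i' a z' wi'.
by have := nf_face cE F G; rewrite faceE (nf_face cE' F' G') => /(congr1 fst).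
Qed.

Lemma nf_face_right d d' :
  pface i a (PCube L z (sel w)) d -> pface i' a (PCube L z' (sel w')) d' -> d = d'.
Proof.
move=> F F'; have [e G _] := pface_ex i a x vi; have [e' G' _] := pface_ex i' a x' vi'.
by have := nf_face cE G F; rewrite faceE (nf_face cE' G' F') => /(congr1 snd).
Qed.
End Faces.

Lemma tensor_separated :
  separated K -> asymmetric K -> separated L -> asymmetric L -> separated (tensor K L).
Proof.
move=> sK aK sL aL n c c' H; apply: nf_inj.
have [p [q [x [z [v [w [cE vi wi _ _]]]]]]] := nf_shape c.
have [p' [q' [x' [z' [v' [w' [cE' vi' wi' _ _]]]]]]] := nf_shape c'.
rewrite cE cE'; congr pair; apply: pcube_separated => // i a d d'.
  exact: (nf_face_left wi wi' cE cE' (H i a)).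
exact: (nf_face_right vi vi' cE cE' (H i a)).
Qed.

(** Transposition exchanges the two directions. The left base of each cube moves in
    no direction, in the first one only or in both, so that after the exchange the
    two left bases move in both directions or in none. In the former case they
    have transposed boundaries. In the latter the right bases move in the two
    directions, taken in their order, and these have transposed boundaries. *)
Lemma tensor_asymmetric : asymmetric K -> asymmetric L -> asymmetric (tensor K L).
Proof.
move=> aK aL c c' H.
have [p [q [x [z [v [w [cE vi wi vE wE]]]]]]] := nf_shape c.
have [p' [q' [x' [z' [v' [w' [cE' vi' wi' vE' wE']]]]]]] := nf_shape c'.
have HL a := nf_face_left wi wi' cE cE' (H a).1.
have HL' a := nf_face_left wi wi' cE cE' (H a).2.
have HR a := nf_face_right vi vi' cE cE' (H a).1.
have HR' a := nf_face_right vi vi' cE cE' (H a).2.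
have codE N (u : 'I_N -> 'I_2) : (forall k, u k = k :> nat) ->
    ((ord0 \in codom u) = (0 < N)) * ((ord_max \in codom u) = (1 < N)).
  move=> uE; have cod i : (i \in codom u) = (i < N).
    apply/codomP/idP => [[k ->]|lt_iN]; first by rewrite uE.
    by exists (Ordinal lt_iN); apply: val_inj; rewrite /= uE.
  by rewrite !cod.
have le2 N (u : 'I_N -> 'I_2) : injective u -> N <= 2.
  by move=> /leq_card; rewrite !card_ord.
(* Count the dimension of the left bases on the two pairs of equal faces. *)
have dims : p + (1 < p') = p' + (0 < p) /\ p + (0 < p') = p' + (1 < p).
  have [d F dE] := pface_ex ord0 false x vi; have [d' F' dE'] := pface_ex ord_max false x' vi'.
  have [e G eE] := pface_ex ord_max false x vi; have [e' G' eE'] := pface_ex ord0 false x' vi'.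
  rewrite !codE // in dE dE' eE eE'; rewrite -{1}dE -{2}dE' -{3}eE -{4}eE'.
  by rewrite (HL _ _ _ F F') (HL' _ _ _ G G'); split; apply: addnAC.
have [pp'|pp'] : (p = 2 /\ p' = 2) \/ (p = 0 /\ p' = 0).
  move: dims (le2 _ _ vi) (le2 _ _ vi').
  by case: (p) (p') => [|[|[|m]]] [|[|[|m']]] //= [] //; [right|left].
  case: pp' => p2 p2'; move: x x' v v' vE vE' HL HL' {vi vi' HR HR' cE cE' dims wE wE'}.
  by rewrite p2 p2' => x x' v v' vE vE' HL HL'; apply: (pcube_asymmetric aK vE vE' HL HL').
have [q2 {}wE] := wE pp'.1; have [q2' {}wE'] := wE' pp'.2.
move: z z' w w' wE wE' HR HR' {wi wi' HL HL' cE cE' dims}.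
by rewrite q2 q2' => z z' w w' wE wE' HR HR'; apply: (pcube_asymmetric aL wE wE' HR HR').
Qed.
End TensorProperties.

(** * Gluing at a vertex *)

Section Wedge.
Variables (Sig : Type) (sg : sync_alg Sig) (K L : lpc sg) (v : K 0) (w : L 0).
Let W := pushout (pt v) (pt w).
Let inl_ : lhom K W := po_l (pt v) (pt w).
Let inr_ : lhom L W := po_r (pt v) (pt w).

Lemma point_gt0 n : point sg n.+1 -> False.
Proof. by move=> f; have := bmap_le f. Qed.

Definition wedge_side n : W n.+1 -> K n.+1 + L n.+1 :=
  clift (D := span_diag (pt v) (pt w)) (fun s =>
    match s return span_obj (point sg) K L s n.+1 -> K n.+1 + L n.+1 with
    | SpanM => fun f => False_rect _ (point_gt0 f)
    | SpanL => inl
    | SpanR => inr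
    end).

Lemma wedge_side_l n (x : K n.+1) : wedge_side (inl_ _ x) = inl x.
Proof.
by apply: (cliftE (D := span_diag (pt v) (pt w))) => i j [] f; case: (point_gt0 f).
Qed.
Lemma wedge_side_r n (y : L n.+1) : wedge_side (inr_ _ y) = inr y.
Proof.
by apply: (cliftE (D := span_diag (pt v) (pt w))) => i j [] f; case: (point_gt0 f).
Qed.

(** On vertices a wedge embeds into the product, each summand being sent to a
    coordinate axis; this shows that nothing is identified but [v] and [w]. *)
Definition wedge_leg s : span_obj (point sg) K L s 0 -> K 0 * L 0 :=
  match s return span_obj (point sg) K L s 0 -> (K 0 * L 0)%type with
  | SpanM => fun=> (v, w)
  | SpanL => fun x => (x, w)
  | SpanR => fun y => (v, y)
  end.

Definition wedge_coords : W 0 -> K 0 * L 0 :=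
  clift (D := span_diag (pt v) (pt w)) wedge_leg.

Lemma pt0 (M : lpc sg) (u : M 0) (f : point sg 0) : pt u 0 f = u.
Proof. by rewrite -[RHS]pt_bid; congr (pt u 0 _); apply: bmap_endo. Qed.

Lemma wedge_legP i j (a : span_arr i j) (f : span_obj (point sg) K L i 0) :
  wedge_leg (span_map (pt v) (pt w) a 0 f) = wedge_leg f.
Proof. by case: i j / a f => f; rewrite [span_map _ _ _ _ _]pt0. Qed.

Lemma wedge_coords_l x : wedge_coords (inl_ 0 x) = (x, w).
Proof. exact: (cliftE (D := span_diag (pt v) (pt w)) _ wedge_legP). Qed.
Lemma wedge_coords_r y : wedge_coords (inr_ 0 y) = (v, y).
Proof. exact: (cliftE (D := span_diag (pt v) (pt w)) _ wedge_legP). Qed.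

Lemma wedgeW n (P : W n -> Prop) :
  (forall x, P (inl_ n x)) -> (forall y, P (inr_ n y)) -> forall c, P c.
Proof.
move=> Pl Pr; apply: (@colimW _ _ (span_diag (pt v) (pt w))) => -[] x //.
rewrite -(cinj_arr (D := span_diag (pt v) (pt w)) span_l); exact: Pl.
Qed.

Lemma wedge_l_inj : injective_hom inl_.
Proof.
move=> [|n] x x' E; first by have [] := congr1 wedge_coords E; rewrite !wedge_coords_l => -[].
by have := congr1 (@wedge_side n) E; rewrite !wedge_side_l => -[].
Qed.
Lemma wedge_r_inj : injective_hom inr_.
Proof.
move=> [|n] x x' E; first by have := congr1 wedge_coords E; rewrite !wedge_coords_r => -[].
by have := congr1 (@wedge_side n) E; rewrite !wedge_side_r => -[].
Qed.
Lemma wedge_disjoint n (x : K n.+1) (y : L n.+1) : inl_ _ x <> inr_ _ y.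
Proof. by move=> /(congr1 (@wedge_side n)); rewrite wedge_side_l wedge_side_r. Qed.

Lemma wedge_separated : separated K -> separated L -> separated W.
Proof.
move=> sK sL n; apply: wedgeW => x; apply: wedgeW => x' H.
- by congr (inl_ _ _); apply: sK => i a; apply: wedge_l_inj; rewrite !hom_face H.
- by have := H ord0 false; rewrite -!hom_face => /wedge_disjoint.
- by have /esym := H ord0 false; rewrite -!hom_face => /wedge_disjoint.
- by congr (inr_ _ _); apply: sL => i a; apply: wedge_r_inj; rewrite !hom_face H.
Qed.

Lemma wedge_asymmetric : asymmetric K -> asymmetric L -> asymmetric W.
Proof.
move=> aK aL; apply: wedgeW => x; apply: wedgeW => x' H.
- by apply: (aK x x') => a; have [] := H a; rewrite -!hom_face => /wedge_l_inj-> /wedge_l_inj->.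
- by have [+ _] := H false; rewrite -!hom_face => /wedge_disjoint.
- by have [/esym + _] := H false; rewrite -!hom_face => /wedge_disjoint.
- by apply: (aL x x') => a; have [] := H a; rewrite -!hom_face => /wedge_r_inj-> /wedge_r_inj->.
Qed.
End Wedge.

(** The two summands of the target meet only at the base point, and by injectivity
    only the base point of the source is sent there. *)
Lemma wedge_map_inj (Sig : Type) (sg : sync_alg Sig) (K L K' L' : lpc sg)
    (v : K 0) (w : L 0) (v' : K' 0) (w' : L' 0) (h : lhom K K') (k : lhom L L')
    (g : lhom (pushout (pt v) (pt w)) (pushout (pt v') (pt w'))) :
  h 0 v = v' -> k 0 w = w' ->
  (forall n x, g n (po_l (pt v) (pt w) n x) = po_l (pt v') (pt w') n (h n x)) ->
  (forall n y, g n (po_r (pt v) (pt w) n y) = po_r (pt v') (pt w') n (k n y)) ->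
  injective_hom h -> injective_hom k -> injective_hom g.
Proof.
move=> hv kw gl gr hi ki n.
have glue (x : K n) (y : L n) : po_l (pt v') (pt w') n (h n x) = po_r (pt v') (pt w') n (k n y) ->
    po_l (pt v) (pt w) n x = po_r (pt v) (pt w) n y.
  case: n x y => [|n] x y E; last by case: (wedge_disjoint E).
  have := congr1 (@wedge_coords _ _ _ _ v' w') E.
  rewrite wedge_coords_l wedge_coords_r -hv -kw => -[/hi-> /ki<-].
  by have := po_comm (pt v) (pt w) (bid 0 : point sg 0); rewrite !pt_bid.
apply: wedgeW => x; apply: wedgeW => x'; rewrite ?gl ?gr.
- by move=> /wedge_l_inj/hi->.
- exact: glue.
- by move=> /esym/glue->.
- by move=> /wedge_r_inj/ki->.
Qed.

(** * Interpretation of process names *)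

Section Operations.
Variables (Sig : Type) (sg : sync_alg Sig).

Definition rigid (K : pcset) : Prop := separated K /\ asymmetric K.

Lemma cnil_rigid : rigid (cnil sg).
Proof. by split=> [n x|x]; case: (point_gt0 x). Qed.

Lemma cinit_inj (K : cobj sg) : injective_hom (cinit K).
Proof.
move=> [|n] f f'; last by case: (point_gt0 f).
by move=> _; rewrite [f]bmap_endo [f']bmap_endo.
Qed.

Lemma pre_cube_rigid (a : lact sg) : rigid (pre_cube a).
Proof. by split=> [n x|x]; have := bmap_le x. Qed.

Lemma cpre_rigid a (K : cobj sg) : rigid K -> rigid (cpre a K).
Proof.
move=> [sK aK]; have [sP aP] := pre_cube_rigid a.
by split; [exact: wedge_separated|exact: wedge_asymmetric].
Qed.

Lemma cpre_map_inj a (K L : cobj sg) (h : chom K L) :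
  injective_hom h -> injective_hom (cpre_map a h).
Proof.
move=> hi; apply: (wedge_map_inj (h := lid _) (k := h)) => //.
- exact: ch_base.
- exact: po_recl.
- exact: po_recr.
- by move=> n x y.
Qed.

Lemma csum_rigid (K L : cobj sg) : rigid K -> rigid L -> rigid (csum K L).
Proof.
by move=> [sK aK] [sL aL]; split; [exact: wedge_separated|exact: wedge_asymmetric].
Qed.

Lemma csum_map_inj (K L K' L' : cobj sg) (h : chom K K') (k : chom L L') :
  injective_hom h -> injective_hom k -> injective_hom (csum_map h k).
Proof.
move=> hi ki; apply: (wedge_map_inj (h := h) (k := k)) => //; try exact: ch_base.
  exact: po_recl.
exact: po_recr.
Qed.

Lemma cnu_rigid a (K : cobj sg) : rigid K -> rigid (cnu a K).
Proof.
move=> [sK aK]; split.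
  move=> n [[x u] e] [[x' u'] e'] H; apply: eq_exist.
  have ex : x = x' by apply: sK => i b; have := congr1 (fun y => (sval y).1) (H i b).
  by congr pair => //; apply: bang_separated => i b; have := congr1 (fun y => (sval y).2) (H i b).
move=> [[x u] e] [[x' u'] e'] H; apply: (aK x x') => b; have [H1 H2] := H b.
by split; [exact: (congr1 (fun y => (sval y).1) H1)|exact: (congr1 (fun y => (sval y).1) H2)].
Qed.

Lemma cnu_map_inj a (K L : cobj sg) (h : chom K L) :
  injective_hom h -> injective_hom (cnu_map a h).
Proof.
move=> hi n [[x u] e] [[x' u'] e'] /(congr1 sval) /= [/hi ex eu].
by apply: eq_exist; rewrite ex eu.
Qed.

Lemma cpar_rigid (K L : cobj sg) : rigid K -> rigid L -> rigid (cpar K L).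
Proof.
by move=> [sK aK] [sL aL]; split; [exact: tensor_separated|exact: tensor_asymmetric].
Qed.

Definition preserves_inj n (F : functor sg n) : Prop :=
  forall (r s : env sg n) (h : envhom r s),
    (forall i, injective_hom (h i)) -> injective_hom (fmap F h).
Definition preserves_rigid n (F : functor sg n) : Prop :=
  forall r : env sg n, (forall i, rigid (r i)) -> rigid (F r).

Lemma envhom_cons_inj n (K L : cobj sg) (r s : env sg n) (h : chom K L) (k : envhom r s) :
  injective_hom h -> (forall i, injective_hom (k i)) ->
  forall i, injective_hom (envhom_cons h k i).
Proof. by move=> hi ki i; rewrite /envhom_cons /env_cons; case: unlift. Qed.

Section Rec.
Variables (n : nat) (F : functor sg n.+1).
Hypotheses (F_inj : preserves_inj F) (F_rigid : preserves_rigid F).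

(** The first transition map picks a vertex, and the others are obtained from it by
    functors that preserve injectivity. *)
Lemma rec_step_inj r k : injective_hom (rec_step F r k).
Proof.
elim: k => [|k IHk]; first exact: cinit_inj.
by apply: F_inj; apply: envhom_cons_inj => // i m x y.
Qed.

Lemma rec_obj_rigid (r : env sg n) k : (forall i, rigid (r i)) -> rigid (rec_obj F r k).
Proof.
move=> rg; elim: k => [|k IHk]; first exact: cnil_rigid.
by apply: F_rigid => i; rewrite /env_cons; case: unlift.
Qed.

Lemma Frec_rigid : preserves_rigid (Frec F).
Proof.
move=> r rg; split.
  by apply: seqlim_separated => k; [exact: rec_step_inj|case: (rec_obj_rigid k rg)].
by apply: seqlim_asymmetric => k; [exact: rec_step_inj|case: (rec_obj_rigid k rg)].
Qed.

Lemma Frec_inj : preserves_inj (Frec F).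
Proof.
move=> r s h hi; apply: seq_lim_map_inj => k; first exact: rec_step_inj.
elim: k => [|k IHk]; first by move=> m x y.
by apply: F_inj; apply: envhom_cons_inj.
Qed.
End Rec.

Lemma interp_inj n (P : proc sg n) : preserves_inj (interp P).
Proof.
elim: P => {n} [n|n i|n a Q IHQ|n a Q IHQ|n Q IHQ Q' IHQ'|n Q IHQ Q' IHQ'|n Q IHQ];
  last exact: Frec_inj; move=> r s h hi.
- by move=> m x y.
- exact: hi.
- by apply: cpre_map_inj; exact: IHQ.
- by apply: cnu_map_inj; exact: IHQ.
- by apply: csum_map_inj; [exact: IHQ|exact: IHQ'].
- by apply: tensor_map_inj; [exact: IHQ|exact: IHQ'].
Qed.

Lemma interp_rigid n (P : proc sg n) : preserves_rigid (interp P).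
Proof.
elim: P => {n} [n|n i|n a Q IHQ|n a Q IHQ|n Q IHQ Q' IHQ'|n Q IHQ Q' IHQ'|n Q IHQ];
  last (by apply: Frec_rigid => //; exact: interp_inj); move=> r rg.
- exact: cnil_rigid.
- exact: rg.
- by apply: cpre_rigid; exact: IHQ.
- by apply: cnu_rigid; exact: IHQ.
- by apply: csum_rigid; [exact: IHQ|exact: IHQ'].
- by apply: cpar_rigid; [exact: IHQ|exact: IHQ'].
Qed.
End Operations.

Theorem theorem5p2 (Sig : Type) (Sig_inh : inhabited Sig) (sg : sync_alg Sig)
  (P : proc sg 0) (P_guarded : well_guarded P) (p : nat) (p_ge1 : (1 <= p)%N)
  (x : hom (bd p.+1) (interp0 P)) (y : hom (box p.+1) (sbang sg))
  (xy_comm : hcomp (lab (interp0 P)) x = hcomp y (bd_incl p.+1))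
  (k k' : hom (box p.+1) (interp0 P)) :
  hcomp k (bd_incl p.+1) = x -> hcomp (lab (interp0 P)) k = y ->
  hcomp k' (bd_incl p.+1) = x -> hcomp (lab (interp0 P)) k' = y ->
  k = k'.
Proof.
case: p p_ge1 x y xy_comm k k' => // p _ x y _ k k' kx _ k'x _.
apply: hom_box_separated; last by rewrite kx k'x.
by have [] := interp_rigid P (r := fun=> cnil sg) (fun=> cnil_rigid sg).
Qed.
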